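(* Let $H$ be a non-semisimple Hopf algebra of prime dimension $p$ over an algebraically closed field $\mathbf{k}$ of characteristic $q>2$. Let $X_0=\mathbf{1},X_1,\dots,X_{r-1}$ be the simple $H$-modules up to isomorphism ($r$ is their number), where $\mathbf{1}$ is the trivial module, and suppose that there exists $i\neq 0$ such that $X_i^{**}\cong X_i$ (for instance, this holds if $r>1$ and $**$ is isomorphic to $\mathrm{Id}$ as an additive functor on $\mathrm{Rep}(H)$, i.e., $S^2$ is an inner automorphism, where $S$ is the antipode). Then: (i) If $$\frac{p}{q+2}\le 2^{-2/3}p^{\frac{1}{r-1}},$$ then $H$ is commutative and cocommutative. (ii) Let $W$ be the Lambert $W$-function (the inverse to the function $f(z)=ze^z$), and $$\phi(x):=2^{-2/3}\exp\left(\tfrac12 W(2^{13/3}\log x)\right).$$ If $$\frac{p}{q+2}\le \phi(p),$$ then $H$ is commutative and cocommutative.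
   Context: $\log$ is the natural logarithm, and $W$ is used on nonnegative reals, as the inverse of the bijection $z\mapsto ze^z$ of $[0,\infty)$. For an $H$-module $X$, $X^{**}$ is the double dual, i.e. $X$ with the action of $h\in H$ twisted by $S^2$. *)

(* Defs.v *)
From HB Require Import structures.
From mathcomp Require Import all_boot all_order all_algebra all_field.
From mathcomp Require Import all_classical all_reals all_analysis.

Set Implicit Arguments.
Unset Strict Implicit.
Unset Printing Implicit Defensive.

Import Order.TTheory GRing.Theory Num.Theory.
Local Open Scope ring_scope.

(** * Tensor products of finite-dimensional vector spaces *)

(* MathComp has no tensor product of vectTypes. An element of U (x) V is
   represented by its matrix of coordinates on the [e_i (x) f_j], where e and f
   are the library's bases [vbasis {:U}] and [vbasis {:V}]. [tlift] is the
   universal map, see [tlift_pure] and [tlift_lin]. *)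
Section Tensor.
Context (k : fieldType).
Implicit Types U V W : vectType k.

Definition tens U V : vectType k := 'M[k]_(\dim {:U}, \dim {:V}).

Definition pure U V (u : U) (v : V) : tens U V :=
  \matrix_(i, j) (coord (vbasis {:U}) i u * coord (vbasis {:V}) j v).

Definition tlift U V W (B : U -> V -> W) (t : tens U V) : W :=
  \sum_i \sum_j
    t i j *: B ((vbasis {:U})`_i) ((vbasis {:V})`_j).

Definition tmap U V U' V' (f : U -> U') (g : V -> V') : tens U V -> tens U' V' :=
  tlift (fun u v => pure (f u) (g v)).

Definition tassoc U V W : tens (tens U V) W -> tens U (tens V W) :=
  tlift (fun t w => tlift (fun u v => pure u (pure v w)) t).

Definition tflip U V : tens U V -> tens V U := tlift (fun u v => pure v u).

Definition tmul (A B : falgType k) (s t : tens A B) : tens A B :=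
  tlift (fun a b => tlift (fun c d => pure (a * c) (b * d)) t) s.

Definition bilin U V W (B : U -> V -> W) : Prop :=
  (forall u, linear (B u)) /\ (forall v, linear (B^~ v)).

Lemma lin_sum U V (f : U -> V) I (r : seq I) (c : I -> k) (F : I -> U) :
  linear f -> f (\sum_(i <- r) c i *: F i) = \sum_(i <- r) c i *: f (F i).
Proof.
move=> lf; have f0 : f 0 = 0.
  have := lf 1 0 0; rewrite !scale1r addr0 => /eqP.
  by rewrite -subr_eq subrr eq_sym => /eqP.
elim: r => [|i r IH]; first by rewrite !big_nil.
by rewrite !big_cons lf IH.
Qed.

Lemma tlift_linear U V W (B : U -> V -> W) : linear (tlift B).
Proof.
move=> c s t; rewrite /tlift scaler_sumr -big_split; apply: eq_bigr => i _.
rewrite scaler_sumr -big_split; apply: eq_bigr => j _ /=.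
by rewrite !mxE scalerDl scalerA.
Qed.

Lemma eq_tlift U V W (B B' : U -> V -> W) t :
  (forall u v, B u v = B' u v) -> tlift B t = tlift B' t.
Proof. by move=> e; do 2!apply: eq_bigr => ? _; rewrite e. Qed.

Lemma tlift_lin U V W W' (L : W -> W') (B : U -> V -> W) t : linear L ->
  L (tlift B t) = tlift (fun u v => L (B u v)) t.
Proof.
move=> lL; rewrite /tlift; transitivity
  (L (\sum_i 1 *: \sum_j t i j *: B ((vbasis {:U})`_i) ((vbasis {:V})`_j))).
  by congr L; apply: eq_bigr => i _; rewrite scale1r.
by rewrite lin_sum //; apply: eq_bigr => i _; rewrite scale1r lin_sum.
Qed.

Lemma tlift_pure U V W (B : U -> V -> W) u v :
  bilin B -> tlift B (pure u v) = B u v.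
Proof.
move=> [B1 B2]; rewrite {2}(coord_vbasis (memvf u)) (lin_sum _ _ _ (B2 v)).
apply: eq_bigr => i _; rewrite {2}(coord_vbasis (memvf v)) (lin_sum _ _ _ (B1 _)).
by rewrite scaler_sumr; apply: eq_bigr => j _; rewrite scalerA mxE.
Qed.

Lemma pure_bilin U V : bilin (@pure U V).
Proof.
split=> [u c v v' | v c u u']; apply/matrixP => i j; rewrite [LHS]mxE.
  transitivity (c * pure u v i j + pure u v' i j); last by rewrite [RHS]mxE [X in _ = X + _]mxE.
  by rewrite linearP [pure u v i j]mxE [pure u v' i j]mxE mulrDr mulrCA.
transitivity (c * pure u v i j + pure u' v i j); last by rewrite [RHS]mxE [X in _ = X + _]mxE.
by rewrite linearP [pure u v i j]mxE [pure u' v i j]mxE mulrDl mulrA.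
Qed.

Lemma lin_tlift U V W W' (F : W' -> U -> V -> W) t :
  (forall u v, linear (fun x => F x u v)) -> linear (fun x => tlift (F x) t).
Proof.
move=> lF c x y; rewrite /tlift scaler_sumr -big_split; apply: eq_bigr => i _.
rewrite scaler_sumr -big_split; apply: eq_bigr => j _ /=.
by rewrite lF scalerDr !scalerA mulrC.
Qed.

Lemma exchange_tlift U V U' V' W (F : U -> V -> U' -> V' -> W) s t :
  tlift (fun u v => tlift (F u v) s) t =
  tlift (fun x y => tlift (fun u v => F u v x y) t) s.
Proof.
transitivity (\sum_i \sum_j \sum_i' \sum_j'
  (t i j * s i' j') *:
  F ((vbasis {:U})`_i) ((vbasis {:V})`_j) ((vbasis {:U'})`_i') ((vbasis {:V'})`_j')).
  do 2!apply: eq_bigr => ? _; rewrite scaler_sumr; apply: eq_bigr => ? _.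
  by rewrite scaler_sumr; apply: eq_bigr => ? _; rewrite scalerA.
under eq_bigr => i _ do rewrite exchange_big /=.
rewrite exchange_big /=; apply: eq_bigr => i' _.
under eq_bigr => i _ do rewrite exchange_big /=.
rewrite exchange_big /=; apply: eq_bigr => j' _.
rewrite /tlift scaler_sumr; apply: eq_bigr => i _; rewrite scaler_sumr.
by apply: eq_bigr => j _; rewrite scalerA mulrC.
Qed.

Lemma tlift_tmap U V U' V' W (B : U' -> V' -> W) (f : U -> U') (g : V -> V') t :
  bilin B -> tlift B (tmap f g t) = tlift (fun u v => B (f u) (g v)) t.
Proof.
move=> bB; rewrite (tlift_lin _ _ (tlift_linear B)).
by apply: eq_tlift => u v; rewrite tlift_pure.
Qed.

End Tensor.

(** * Finite-dimensional Hopf algebras *)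

HB.mixin Record isHopf (k : fieldType) H of Falgebra k H := {
  comul : H -> tens H H;
  counit : H -> k;
  antipode : H -> H;
  comul_linear : linear comul;
  counit_linear : scalar counit;
  antipode_linear : linear antipode;
  comulA : forall a, tassoc (tmap comul idfun (comul a)) = tmap idfun comul (comul a);
  counitl : forall a, tlift (fun x y : H => counit x *: y) (comul a) = a;
  counitr : forall a, tlift (fun x y : H => counit y *: x) (comul a) = a;
  comul1 : comul 1 = pure 1 1;
  comulM : forall a b, comul (a * b) = tmul (comul a) (comul b);
  counit1 : counit 1 = 1;
  counitM : forall a b, counit (a * b) = counit a * counit b;
  antipodel : forall a, tlift (fun x y : H => antipode x * y) (comul a) = (counit a)%:A;
  antipoder : forall a, tlift (fun x y : H => x * antipode y) (comul a) = (counit a)%:A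
}.

#[short(type="hopfAlgType")]
HB.structure Definition HopfAlgebra (k : fieldType) :=
  { H of isHopf k H & Falgebra k H }.

Section HopfTheory.
Context (k : fieldType) (H : hopfAlgType k).
Implicit Types a b : H.

HB.instance Definition _ :=
  GRing.isLinear.Build k H (tens H H) *:%R (@comul k H) comul_linear.
HB.instance Definition _ :=
  GRing.isLinear.Build k H k *%R (@counit k H) counit_linear.
HB.instance Definition _ :=
  GRing.isLinear.Build k H H *:%R (@antipode k H) antipode_linear.

Lemma sweedler3 (W : vectType k) (T : H -> H -> H -> W) a :
  (forall y z, linear (fun x => T x y z)) ->
  (forall x z, linear (fun y => T x y z)) ->
  (forall x y, linear (fun z => T x y z)) ->
  tlift (fun x y => tlift (fun x1 x2 => T x1 x2 y) (comul x)) (comul a) =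
  tlift (fun x y => tlift (fun y1 y2 => T x y1 y2) (comul y)) (comul a).
Proof.
move=> T1 T2 T3.
pose L : tens H (tens H H) -> W := tlift (fun x w => tlift (T x) w).
have bL : bilin (fun (x : H) (w : tens H H) => tlift (T x) w).
  split=> [x|w]; first exact: tlift_linear.
  by apply: lin_tlift => u v c x y; rewrite T1.
have := congr1 L (comulA a).
rewrite {2}/L tlift_tmap // => <-; rewrite /L /tassoc.
rewrite (tlift_lin _ _ (tlift_linear _)).
under [RHS]eq_tlift => t w.
  rewrite (tlift_lin _ _ (tlift_linear _)).
  under eq_tlift => u v.
    rewrite tlift_pure // tlift_pure; last by split=> [y|z] c x x'; rewrite ?T2 ?T3.
    over.
  over.
rewrite tlift_tmap //; split=> [t | w]; last exact: tlift_linear.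
by apply: lin_tlift => u v c x y; rewrite T3.
Qed.

Local Notation S := (@antipode k H).

Lemma antipodeM a b : antipode (a * b) = antipode b * antipode a.
Proof.
pose G (x y1 y2 u v1 v2 : H) := S (x * u) * (y1 * v1 * (S v2 * S y2)).
have Gx y1 y2 u v1 v2 : linear (fun x => G x y1 y2 u v1 v2).
  by move=> c x y; rewrite /G mulrDl -scalerAl linearP mulrDl -scalerAl.
have Gy1 x y2 u v1 v2 : linear (fun y1 => G x y1 y2 u v1 v2).
  by move=> c y y'; rewrite /G !mulrDl -!scalerAl mulrDr -scalerAr.
have Gy2 x y1 u v1 v2 : linear (fun y2 => G x y1 y2 u v1 v2).
  by move=> c y y'; rewrite /G linearP !mulrDr -!scalerAr.
have Gu x y1 y2 v1 v2 : linear (fun u => G x y1 y2 u v1 v2).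
  by move=> c y y'; rewrite /G mulrDr -scalerAr linearP mulrDl -scalerAl.
have Gv1 x y1 y2 u v2 : linear (fun v1 => G x y1 y2 u v1 v2).
  by move=> c y y'; rewrite /G mulrDr -scalerAr mulrDl mulrDr -scalerAl -scalerAr.
have Gv2 x y1 y2 u v1 : linear (fun v2 => G x y1 y2 u v1 v2).
  by move=> c y y'; rewrite /G linearP mulrDl -scalerAl !mulrDr -!scalerAr.
have inner y v : tlift (fun y1 y2 : H => tlift (fun v1 v2 : H =>
    y1 * v1 * (S v2 * S y2)) (comul v)) (comul y) = (counit y * counit v)%:A.
  transitivity (tlift (fun y1 y2 : H => counit v *: (y1 * S y2)) (comul y)).
    apply: eq_tlift => y1 y2; rewrite -[LHS]mul1r.
    transitivity (y1 * (counit v)%:A * S y2); last first.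
      by rewrite -scalerAr mulr1 -scalerAl.
    rewrite mul1r -antipoder.
    rewrite (tlift_lin (L := fun z => y1 * z * S y2)).
      by apply: eq_tlift => v1 v2; rewrite !mulrA.
    by move=> c z z'; rewrite mulrDr mulrDl -scalerAr -scalerAl.
  rewrite -(tlift_lin (L := fun z => counit v *: z)).
    by rewrite antipoder scalerA mulrC.
  by move=> c z z'; rewrite scalerDr !scalerA mulrC.
have innerL x u : tlift (fun x1 x2 : H => tlift (fun u1 u2 : H =>
    S (x1 * u1) * (x2 * u2)) (comul u)) (comul x) = (counit x * counit u)%:A.
  rewrite -counitM -antipodel comulM /tmul.
  rewrite (tlift_lin _ _ (tlift_linear _)); apply: eq_tlift => x1 x2.
  rewrite (tlift_lin _ _ (tlift_linear _)); apply: eq_tlift => u1 u2.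
  by rewrite tlift_pure //; split=> [z|z] c w w';
     rewrite ?mulrDr ?linearP ?mulrDl -?scalerAr -?scalerAl.
transitivity (tlift (fun x y : H => tlift (fun u v : H =>
    tlift (fun y1 y2 : H => tlift (fun v1 v2 : H => G x y1 y2 u v1 v2)
    (comul v)) (comul y)) (comul b)) (comul a)).
  rewrite -{1}(counitr a) -{1}(counitr b).
  rewrite (tlift_lin (L := fun z => antipode (z * _))); last first.
    by move=> c z z'; rewrite mulrDl -scalerAl linearP.
  apply: eq_tlift => x y.
  rewrite (tlift_lin (L := fun z => antipode (_ * z))); last first.
    by move=> c z z'; rewrite mulrDr -scalerAr linearP.
  apply: eq_tlift => u v.
  transitivity (S (x * u) * (counit y * counit v)%:A).
    by rewrite -scalerAl -scalerAr !linearZ /= scalerA -scalerAr mulr1.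
  rewrite -inner (tlift_lin (L := fun z => S (x * u) * z)); last first.
    by move=> c z z'; rewrite mulrDr -scalerAr.
  apply: eq_tlift => y1 y2; rewrite (tlift_lin (L := fun z => S (x * u) * z)) //.
  by move=> c z z'; rewrite mulrDr -scalerAr.
transitivity (tlift (fun x y : H => tlift (fun y1 y2 : H =>
    tlift (fun u v : H => tlift (fun v1 v2 : H => G x y1 y2 u v1 v2)
    (comul v)) (comul b)) (comul y)) (comul a)).
  by apply: eq_tlift => x y; rewrite exchange_tlift.
rewrite -(sweedler3 (T := fun x y1 y2 => tlift (fun u v : H =>
    tlift (fun v1 v2 : H => G x y1 y2 u v1 v2) (comul v)) (comul b))); first last.
- by move=> ? ?; do 2![apply: lin_tlift => ? ?].
- by move=> ? ?; do 2![apply: lin_tlift => ? ?].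
- by move=> ? ?; do 2![apply: lin_tlift => ? ?].
transitivity (tlift (fun x y : H => tlift (fun x1 x2 : H =>
    tlift (fun u v : H => tlift (fun u1 u2 : H => G x1 x2 y u1 u2 v)
    (comul u)) (comul b)) (comul x)) (comul a)).
  do 2![apply: eq_tlift => ? ?].
  by rewrite -(sweedler3 (T := fun u v1 v2 => G _ _ _ u v1 v2)).
transitivity (tlift (fun x y : H => tlift (fun u v : H =>
  (counit x * counit u) *: (S v * S y)) (comul b)) (comul a)).
  apply: eq_tlift => x y; rewrite exchange_tlift; apply: eq_tlift => u v.
  rewrite -[S v * S y]mul1r scalerAl -innerL.
  rewrite (tlift_lin (L := fun z => z * (S v * S y))); last first.
    by move=> c z z'; rewrite mulrDl -scalerAl.
  apply: eq_tlift => x1 x2; rewrite (tlift_lin (L := fun z => z * (S v * S y))).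
    by apply: eq_tlift => u1 u2; rewrite /G !mulrA.
  by move=> c z z'; rewrite mulrDl -scalerAl.
rewrite -[in RHS](counitl a) -[in RHS](counitl b).
rewrite (tlift_lin (L := fun z => _ * antipode z)); last first.
  by move=> c z z'; rewrite linearP mulrDr -scalerAr.
apply: eq_tlift => x y.
rewrite (tlift_lin (L := fun z => antipode z * _)); last first.
  by move=> c z z'; rewrite linearP mulrDl -scalerAl.
apply: eq_tlift => u v.
by rewrite !linearZ /= -scalerAl -scalerAr scalerA mulrC.
Qed.

Lemma antipode1 : antipode (1 : H) = 1.
Proof.
have := antipodel (1 : H); rewrite comul1 counit1 scale1r tlift_pure ?mulr1 //.
by split=> z c w w'; rewrite ?linearP ?mulrDr ?mulrDl -?scalerAr -?scalerAl.
Qed.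

End HopfTheory.

(** * Finite-dimensional modules *)

Section Modules.
Context (k : fieldType) (A : falgType k).

Record amod := AMod {
  amod_sort :> vectType k;
  act : A -> 'End(amod_sort);
  act_linear : linear act;
  act1 : act 1 = \1%VF;
  actM : forall a b, act (a * b) = (act a \o act b)%VF
}.

Definition mod_iso (X Y : amod) : Prop :=
  exists f : 'Hom(X, Y),
    bijective f /\ forall a x, f (act X a x) = act Y a (f x).

Definition submod (X : amod) (U : {vspace X}) : Prop :=
  forall a, (act X a @: U <= U)%VS.

Definition simple_mod (X : amod) : Prop :=
  {:X}%VS <> 0%VS /\ forall U : {vspace X}, submod U -> U = 0%VS \/ U = {:X}%VS.

Definition semisimple_mod (X : amod) : Prop :=
  forall U : {vspace X}, submod U ->
    exists V : {vspace X}, [/\ submod V, (U + V = fullv)%VS & (U :&: V = 0)%VS].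

(* [A] is finite-dimensional, so that its simple modules are, and nothing is
   lost by taking all modules finite-dimensional. *)
Definition all_simples r (X : 'I_r -> amod) : Prop :=
  [/\ forall i, simple_mod (X i),
      forall i j, mod_iso (X i) (X j) -> i = j
    & forall Y, simple_mod Y -> exists i, mod_iso Y (X i)].

Fact regular_linear : linear (@amull k A).
Proof. exact: linearP. Qed.

Fact regularM (a b : A) : amull (a * b) = (amull a \o amull b)%VF.
Proof. by apply/lfunP => x; rewrite comp_lfunE !lfunE /= mulrA. Qed.

Definition regular_mod : amod := AMod regular_linear (amull1 A) regularM.

Definition semisimple_alg : Prop := semisimple_mod regular_mod.

End Modules.

Section HopfModules.
Context (k : fieldType) (H : hopfAlgType k).

Fact triv_linear : linear (fun a : H => counit a *: (\1%VF : 'End(k^o))).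
Proof. by move=> c a b; rewrite linearP scalerDl scalerA. Qed.

Fact triv1 : counit (1 : H) *: (\1%VF : 'End(k^o)) = \1%VF.
Proof. by rewrite counit1 scale1r. Qed.

Fact trivM (a b : H) : counit (a * b) *: (\1%VF : 'End(k^o)) =
  ((counit a *: \1) \o (counit b *: \1))%VF.
Proof.
by rewrite counitM -comp_lfunZl -comp_lfunZr comp_lfun1l scalerA.
Qed.

Definition triv_mod : amod H := AMod triv_linear triv1 trivM.

Context (X : amod H).

Fact ddual_linear : linear (fun a => act X (antipode (antipode a))).
Proof. by move=> c a b; rewrite !linearP act_linear. Qed.

Fact ddual1 : act X (antipode (antipode 1)) = \1%VF.
Proof. by rewrite !antipode1 act1. Qed.

Fact ddualM a b : act X (antipode (antipode (a * b))) =
  (act X (antipode (antipode a)) \o act X (antipode (antipode b)))%VF.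
Proof. by rewrite !antipodeM actM. Qed.

(* X^**, realized on the space of X through the evaluation isomorphism. *)
Definition ddual : amod H := AMod ddual_linear ddual1 ddualM.

(* If S^2 is inner, then every module is isomorphic to its double dual. *)
Lemma inner_ddual : (exists2 g : H, g \is a GRing.unit &
    forall a, antipode (antipode a) = g * a * g^-1) ->
  mod_iso ddual X.
Proof.
case=> g gU Sg.
have aM a b (x : X) : act X a (act X b x) = act X (a * b) x.
  by rewrite actM comp_lfunE.
have a1 (x : X) : act X 1 x = x by rewrite act1 id_lfunE.
exists (act X g^-1); split=> [|a x].
  by exists (act X g) => x; rewrite aM ?divrr ?mulVr // a1.
by rewrite [LHS]aM [RHS]aM Sg !mulrA mulVr // mul1r.
Qed.

End HopfModules.

Definition cocommutative (k : fieldType) (H : hopfAlgType k) : Prop :=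
  forall a : H, tflip (comul a) = comul a.

(** * The Lambert function *)

Section Lambert.
Import numFieldNormedType.Exports.
Context (R : realType).
Implicit Types x y z : R.

(* The inverse of z |-> z e^z on [0, +oo[; junk value 0 for y < 0. *)
Definition lambertW y : R := xget 0 [set z | 0 <= z /\ z * expR z = y]%classic.

Lemma lambertWP y : 0 <= y -> 0 <= lambertW y /\ lambertW y * expR (lambertW y) = y.
Proof.
move=> y0; suff [z zP] : exists z, 0 <= z /\ z * expR z = y.
  by rewrite /lambertW; case: xgetP => [w _ //|/(_ z)].
have c : continuous (fun z : R => z * expR z).
  by move=> z; apply: cvgM; [exact: cvg_id | exact: continuous_expR].
have cf : {within `[0, y], continuous (fun z => z * expR z)}%classic.
  exact: continuous_subspaceT.
have yb : Order.min (0 * expR 0) (y * expR y) <= y <= Order.max (0 * expR 0) (y * expR y).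
  rewrite mul0r ge_min le_max y0 /=.
  by rewrite ler_peMr ?orbT // -expR0 ler_expR.
have [z] := IVT y0 cf yb.
by rewrite in_itv /= => /andP[z0 _] zy; exists z.
Qed.

Lemma lambertWK z : 0 <= z -> lambertW (z * expR z) = z.
Proof.
move=> z0; have [w0 ww] := lambertWP (mulr_ge0 z0 (expR_ge0 z)).
have mono x y : 0 <= x -> x < y -> x * expR x < y * expR y.
  by move=> x0 xy; rewrite ltr_pM ?expR_ge0 ?ltr_expR.
have [lt|lt|//] := ltgtP (lambertW (z * expR z)) z.
  by have := mono _ _ w0 lt; rewrite ww ltxx.
by have := mono _ _ z0 lt; rewrite ww ltxx.
Qed.

Definition phi x : R :=
  2 `^ (- (2 / 3)) * expR (1 / 2 * lambertW (2 `^ (13 / 3) * ln x)).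

End Lambert.

(* Main.v *)
Require Import Defs.
From HB Require Import structures.
From mathcomp Require Import all_boot all_order all_algebra all_field.
From mathcomp Require Import all_classical all_reals all_analysis.
From mathcomp Require Import ring lra.

Set Implicit Arguments.
Unset Strict Implicit.
Unset Printing Implicit Defensive.

Import Order.TTheory GRing.Theory Num.Theory.
Local Open Scope ring_scope.

(** Suppose that [H] is not both commutative and cocommutative. Write [p_j] and [d_j] for
    the multiplicity of the simple module [X_j] in [H] and for its dimension, and [N] for
    [p / (q + 2)]. The proof finds a nontrivial [X_j] with [X_j^** = X_j] such that
    [q + 2 <= p_j <= d_j ^ (r - 2)]; the two bounds together are
    incompatible with either hypothesis on [N].

    A Hopf subalgebra has dimension 1 or [p] ([nichols_zoeller]: its dimension divides that
    of [H]), so a nontrivial subcoalgebra generates [H] ([subcoalg_generates]). As a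
    group-like element other than 1 would make [H] the group algebra of a cyclic group,
    the group-like elements of [H] and of its dual are trivial; in particular a nontrivial
    simple module has dimension at least 2, and Radford's formula gives [S^4 = 1]
    ([prime_antipode4]). The coefficients of a nontrivial simple module [X] generate the
    dual of [H], so that the tensor powers of [X] contain all the simple modules
    ([tower_faithful]), and [S^2] is the identity as soon as it is so on [X]
    ([S2_trivial]).

    The lower bound. The double dual permutes the simple modules and preserves their
    multiplicities. Since [p] is odd, counting composition factors modulo 2 in [H] and in
    [H (x) X_i], for a nontrivial [X_i] with [X_i^** = X_i], yields such an [X_j] whose
    multiplicity is odd ([exists_odd_pmul]). There is a primitive idempotent [e'] for [X_j]
    with [S^2(e') = e'], and the involution [S^2] splits [e' H], of dimension [p_j], into
    eigenspaces. As [H] is not semisimple, the trace of [S^2] on [e' H] is zero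
    ([trace_S2]), so the dimensions of the eigenspaces are congruent modulo [q]; being
    positive and distinct they add up to at least [q + 2] ([pmul_ge_q]).

    The upper bound. The matrix of the tensor product by [X_j] on the Grothendieck group
    has the vectors of the [p_i] and of the [d_i] as eigenvectors for the eigenvalue [d_j].
    Let [D] be the determinant of [d_j - N_j], restricted to the simple modules other than
    [X_j] and the trivial one. It is not zero because the powers of [X_j] reach the trivial
    module, it is at most [d_j ^ (r - 2)] by Hadamard's inequality for M-matrices
    ([mmatrix_det]), and by Cramer's rule [p_j] divides all the [D p_i], hence [D p], hence
    [D] ([fusion_bound]).

    Finally, if [X_0] is the trivial module, [p_0 <= p_i d_i] by counting in [H (x) X_i], and
    [p_j <= p_0 d_j] by counting in [H (x) X_j^*]. With [p = \sum_i p_i d_i] this leads to [d_j + (r - 1) / d_j <= N], and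
    the contradiction is elementary ([numeric_contra]).

    The module theory relies on one device: a family of idempotents [e_j] with
    [dim (e_j X_i)] equal to 1 for [i = j] and to 0 otherwise, so that the multiplicity of
    [X_j] in [V] is the dimension of [e_j V] and every additive function of modules is
    computed from these numbers ([additive_expand]). *)

(** * Multilinear maps and tensor products *)

Section Linear.
Context (k : fieldType).
Implicit Types U V W : vectType k.

(** Sweedler calculus is done with bare functions; [lfn] turns one of them into
    a morphism, so that its image and kernel can be spoken of. *)
Definition lfn_lin U V (f : U -> V) (lf : linear f) : {linear U -> V} :=
  HB.pack f (GRing.isLinear.Build k U V *:%R f lf).

Definition lfn U V (f : U -> V) (lf : linear f) : 'Hom(U, V) := linfun (lfn_lin lf).

Lemma lfnE U V (f : U -> V) (lf : linear f) x : lfn lf x = f x.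
Proof. by rewrite /lfn lfunE. Qed.

Lemma lin_id U : linear (fun x : U => x). Proof. by []. Qed.

Lemma lin_fun U V (f : {linear U -> V}) : linear f.
Proof. exact: linearP. Qed.

Lemma lin0 U V (f : U -> V) : linear f -> f 0 = 0.
Proof. by move=> lf; rewrite -(linear0 (lfn_lin lf)). Qed.

Lemma linZ U V (f : U -> V) c x : linear f -> f (c *: x) = c *: f x.
Proof. by move=> lf; rewrite -[c *: x]addr0 lf lin0 // addr0. Qed.

Lemma linD U V (f : U -> V) x y : linear f -> f (x + y) = f x + f y.
Proof. by move=> lf; rewrite -[x]scale1r lf !scale1r. Qed.

Lemma linS U V (f : U -> V) I (r : seq I) (F : I -> U) : linear f ->
  f (\sum_(i <- r) F i) = \sum_(i <- r) f (F i).
Proof. by move=> lf; rewrite -(linear_sum (lfn_lin lf)). Qed.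

Lemma lin_comp U V W (g : U -> V) (f : V -> W) :
  linear f -> linear g -> linear (fun x => f (g x)).
Proof. by move=> lf lg c x y; rewrite lg lf. Qed.

Lemma lin_hom U V W (f : 'Hom(V, W)) (g : U -> V) : linear g -> linear (fun x => f (g x)).
Proof. by move=> lg c x y; rewrite lg linearP. Qed.

Lemma lin_homl U V W (g : U -> 'Hom(V, W)) v : linear g -> linear (fun x => g x v).
Proof. by move=> lg c x y; rewrite lg add_lfunE scale_lfunE. Qed.

Lemma lin_add U V (f g : U -> V) : linear f -> linear g -> linear (fun x => f x + g x).
Proof. by move=> lf lg c x y; rewrite lf lg scalerDr addrACA. Qed.

Lemma lin_opp U V (f : U -> V) : linear f -> linear (fun x => - f x).
Proof. by move=> lf c x y; rewrite lf opprD scalerN. Qed.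

Lemma lin_scale U V c (f : U -> V) : linear f -> linear (fun x => c *: f x).
Proof. by move=> lf a x y; rewrite lf scalerDr !scalerA mulrC. Qed.

Lemma lin_scalev U V (f : U -> k) (v : V) :
  linear (f : U -> k^o) -> linear (fun x => f x *: v).
Proof. by move=> lf a x y; rewrite lf scalerDl -scalerA. Qed.

Lemma lin_mulkl U (f : U -> k) c :
  linear (f : U -> k^o) -> linear ((fun x => f x * c) : U -> k^o).
Proof. by move=> lf a x y; have -> := lf a x y; rewrite mulrDl -mulrA. Qed.

Lemma lin_mulkr U (f : U -> k) c :
  linear (f : U -> k^o) -> linear ((fun x => c * f x) : U -> k^o).
Proof. by move=> lf a x y; have -> := lf a x y; rewrite mulrDr mulrCA. Qed.

Lemma lin_mull U (A : falgType k) (f : U -> A) c :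
  linear f -> linear (fun x => f x * c).
Proof. by move=> lf a x y; rewrite lf mulrDl -scalerAl. Qed.

Lemma lin_mulr U (A : falgType k) (f : U -> A) c :
  linear f -> linear (fun x => c * f x).
Proof. by move=> lf a x y; rewrite lf mulrDr -scalerAr. Qed.

Lemma lin_purel U V W (f : U -> V) (w : W) : linear f -> linear (fun x => pure (f x) w).
Proof. by move=> lf a x y; rewrite lf; case: (pure_bilin V W) => _; apply. Qed.

Lemma lin_purer U V W (f : U -> V) (w : W) : linear f -> linear (fun x => pure w (f x)).
Proof. by move=> lf a x y; rewrite lf; case: (pure_bilin W V) => + _; apply. Qed.

Lemma lin_tlifta U V W W' (B : V -> W -> W') (f : U -> tens V W) :
  linear f -> linear (fun x => tlift B (f x)).
Proof. by move=> lf a x y; rewrite lf; apply: tlift_linear. Qed.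

Lemma lin_sumf U V (I : Type) (r : seq I) (P : pred I) (F : I -> U -> V) :
  (forall i, linear (F i)) -> linear (fun x => \sum_(i <- r | P i) F i x).
Proof.
move=> lF a x y; rewrite scaler_sumr -big_split; apply: eq_bigr => i _.
exact: lF.
Qed.

Lemma lin_coord U V n (X : n.-tuple V) i (f : U -> V) :
  linear f -> linear ((fun x => coord X i (f x)) : U -> k^o).
Proof. by move=> lf a x y; rewrite lf linearP. Qed.

Lemma lin_act (A : falgType k) (X : amod A) U (f : U -> A) v :
  linear f -> linear (fun x => act X (f x) v).
Proof. by move=> lf; apply: lin_homl => c x y; rewrite lf act_linear. Qed.

Lemma lin_comul (H : hopfAlgType k) U (f : U -> H) :
  linear f -> linear (fun x => comul (f x)).
Proof. by move=> lf a x y; rewrite lf linearP. Qed.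

Lemma lin_counit (H : hopfAlgType k) U (f : U -> H) :
  linear f -> linear ((fun x => counit (f x)) : U -> k^o).
Proof. by move=> lf a x y; rewrite lf linearP. Qed.

Lemma lin_antipode (H : hopfAlgType k) U (f : U -> H) :
  linear f -> linear (fun x => antipode (f x)).
Proof. by move=> lf a x y; rewrite lf linearP. Qed.

End Linear.

(** Redefined once evaluation of functionals is available, so that [lin] sees it. *)
Ltac lin_hook := fail.

(** Linearity of a multilinear expression in one variable, by descending through
    the operations that it is built from. *)
Ltac lin := cbv beta; solve [ repeat first
 [ assumption
 | exact: lin_id
 | match goal with H : forall _, linear _ |- _ => apply: H end
 | match goal with H : forall _ _, linear _ |- _ => apply: H end
 | match goal with H : forall _ _ _, linear _ |- _ => apply: H end
 | match goal with H : bilin _ |- _ => first [apply: (proj1 H) | apply: (proj2 H)] end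
 | apply: lin_comul | apply: lin_antipode | apply: lin_counit
 | apply: lin_mull | apply: lin_mulr | apply: lin_purel | apply: lin_purer
 | apply: lin_mulkl | apply: lin_mulkr
 | apply: lin_tlifta | (apply: lin_tlift => ? ?; cbv beta)
 | apply: lin_act | apply: lin_hom | apply: lin_homl | apply: lin_scale | apply: lin_scalev
 | apply: lin_add | apply: lin_opp | apply: lin_coord
 | (apply: lin_sumf => ?; cbv beta)
 | exact: linearP
 | lin_hook
 | match goal with
   | H : forall _, linear _ |- _ => apply: (lin_comp (H _))
   | H : forall _ _, linear _ |- _ => apply: (lin_comp (H _ _))
   | H : forall _ _ _, linear _ |- _ => apply: (lin_comp (H _ _ _))
   | H : linear _ |- _ => apply: (lin_comp H)
   | H : bilin _ |- _ => first [apply: (lin_comp ((proj1 H) _)) | apply: (lin_comp ((proj2 H) _))]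
   end ] ].
Ltac bil := split=> ?; lin.

Section Tens.
Context (k : fieldType).
Implicit Types U V W : vectType k.

Lemma lin_tmap U V U' V' (f : U -> U') (g : V -> V') : linear (tmap f g).
Proof. exact: tlift_linear. Qed.

Lemma tmap_pure U V U' V' (f : U -> U') (g : V -> V') u v :
  linear f -> linear g -> tmap f g (pure u v) = pure (f u) (g v).
Proof. by move=> lf lg; rewrite /tmap tlift_pure //; bil. Qed.

Lemma tlift_id U V (t : tens U V) : tlift (@pure _ U V) t = t.
Proof.
apply/matrixP => i j; rewrite /tlift summxE (bigD1 i) //= summxE (bigD1 j) //= !mxE.
rewrite !coord_free ?(basis_free (vbasisP _)) // !eqxx !mulr1.
rewrite big1 => [|j' /negPf nj]; last first.
  by rewrite !mxE !coord_free ?(basis_free (vbasisP _)) // nj !mulr0.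
rewrite big1 ?addr0 // => i' /negPf ni; rewrite summxE big1 // => j' _.
by rewrite !mxE !coord_free ?(basis_free (vbasisP _)) // ni !mul0r mulr0.
Qed.

Lemma tens_ext U V W (f g : tens U V -> W) : linear f -> linear g ->
  (forall u v, f (pure u v) = g (pure u v)) -> f =1 g.
Proof.
move=> lf lg e t; rewrite -(tlift_id t) (tlift_lin _ _ lf) (tlift_lin _ _ lg).
exact: eq_tlift.
Qed.

Lemma tmap_comp U V U' V' U2 V2 (f : U -> U') (g : V -> V') (f' : U' -> U2)
    (g' : V' -> V2) t : linear f' -> linear g' ->
  tmap f' g' (tmap f g t) = tmap (f' \o f) (g' \o g) t.
Proof. by move=> lf' lg'; rewrite /tmap tlift_tmap //; bil. Qed.

Lemma eq_tmap U V U' V' (f f' : U -> U') (g g' : V -> V') t :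
  f =1 f' -> g =1 g' -> tmap f g t = tmap f' g' t.
Proof. by move=> ef eg; apply: eq_tlift => u v; rewrite ef eg. Qed.

Lemma dim_tens U V : \dim {: tens U V} = (\dim {:U} * \dim {:V})%N.
Proof. by rewrite dimvf dim_matrix. Qed.

Lemma tlift_sum U V W (I : Type) (r : seq I) (F : I -> U -> V -> W) t :
  \sum_(i <- r) tlift (F i) t = tlift (fun u v => \sum_(i <- r) F i u v) t.
Proof.
elim: r => [|i r IH].
  rewrite big_nil /tlift big1 // => i _; rewrite big1 // => j _.
  by rewrite big_nil scaler0.
rewrite big_cons IH /tlift -big_split; apply: eq_bigr => a _.
rewrite -big_split; apply: eq_bigr => b _ /=.
by rewrite big_cons scalerDr.
Qed.

Lemma tliftZ U V W (c : k) (B : U -> V -> W) t :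
  tlift (fun u v => c *: B u v) t = c *: tlift B t.
Proof. by rewrite (tlift_lin (L := fun x => c *: x)) //; lin. Qed.

End Tens.

Section LinDim.
Context (k : fieldType).
Implicit Types U V W : vectType k.

Lemma lker0_inj U V (f : 'Hom(U, V)) : (forall x, f x = 0 -> x = 0) -> lker f = 0%VS.
Proof.
move=> f0; apply/eqP/lker0P => x y /eqP; rewrite -subr_eq0 -linearB => /eqP /f0.
by move/eqP; rewrite subr_eq0 => /eqP.
Qed.

Lemma limg_full_surj U V (f : 'Hom(U, V)) : (forall y, exists x, f x = y) ->
  limg f = fullv.
Proof.
move=> fs; apply/eqP; rewrite eqEsubv subvf; apply/subvP => y _.
by have [x <-] := fs y; rewrite memv_img ?memvf.
Qed.

Lemma dim_lker_limg U V (f : 'Hom(U, V)) : (\dim (lker f) + \dim (limg f) = \dim {:U})%N.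
Proof. by rewrite -(limg_ker_dim f fullv) capfv. Qed.

Lemma surj_inj_dim U V (f : 'Hom(U, V)) : \dim {:U} = \dim {:V} ->
  (forall y, exists x, f x = y) -> forall x, f x = 0 -> x = 0.
Proof.
move=> dUV /limg_full_surj fs x /eqP fx; have := dim_lker_limg f; rewrite fs dUV.
move/eqP; rewrite -[X in _ == X]add0n eqn_add2r dimv_eq0 => /eqP k0.
by move: fx; rewrite -memv_ker k0 memv0 => /eqP.
Qed.

Lemma inj_surj_dim U V (f : 'Hom(U, V)) : \dim {:U} = \dim {:V} ->
  (forall x, f x = 0 -> x = 0) -> forall y, exists x, f x = y.
Proof.
move=> dUV /lker0_inj k0 y; have := dim_lker_limg f; rewrite k0 dimv0 add0n => di.
have: y \in limg f.
  have/eqP->: limg f == fullv by rewrite eqEdim subvf di dUV leqnn.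
  exact: memvf.
by case/memv_imgP => x _ ->; exists x.
Qed.

End LinDim.

(** * Modules: exact sequences, multiplicities, idempotents *)

Section ModBasics.
Context (k : fieldType) (A : falgType k).
Implicit Types U V W Q : amod A.

HB.instance Definition _ V := GRing.isLinear.Build k A 'End(V) *:%R (act V) (act_linear V).

Lemma act_mul V a b x : act V (a * b) x = act V a (act V b x).
Proof. by rewrite actM comp_lfunE. Qed.

Lemma act_one V x : act V 1 x = x.
Proof. by rewrite act1 id_lfunE. Qed.

Definition mod_hom V W (f : 'Hom(V, W)) := forall a x, f (act V a x) = act W a (f x).

Definition ses U V Q := exists (i : 'Hom(U, V)) (pi : 'Hom(V, Q)),
  [/\ mod_hom i, mod_hom pi, lker i = 0%VS, limg pi = fullv & limg i = lker pi].

Definition additive_fun (F : amod A -> nat) := forall U V Q, ses U V Q -> F V = (F U + F Q)%N.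

Definition rk a V := \dim (limg (act V a)).

Lemma submod_img V W (f : 'Hom(V, W)) : mod_hom f -> submod (limg f).
Proof.
move=> hf a; apply/subvP => y /memv_imgP[x /memv_imgP[z _ ->] ->].
by rewrite -hf memv_img ?memvf.
Qed.

Lemma submod_ker V W (f : 'Hom(V, W)) : mod_hom f -> submod (lker f).
Proof.
move=> hf a; apply/subvP => y /memv_imgP[x]; rewrite !memv_ker => /eqP fx ->.
by rewrite hf fx linear0.
Qed.

Lemma submodP V (U : {vspace V}) : submod U <-> forall a x, x \in U -> act V a x \in U.
Proof.
split=> [sU a x xU|h a]; first by apply: (subvP (sU a)); rewrite memv_img.
by apply/subvP => y /memv_imgP[x xU ->]; apply: h.
Qed.

Section Sub.
Context (V : amod A) (U : {vspace V}).
Hypothesis sU : submod U.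

Fact sub_act_lin a : linear (fun x : subvs_of U => vsproj U (act V a (vsval x))).
Proof. by move=> c x y; rewrite !linearP. Qed.

Definition sub_act a : 'End(subvs_of U) := lfn (sub_act_lin a).

Lemma sub_actE a x : vsval (sub_act a x) = act V a (vsval x).
Proof. by rewrite lfnE vsprojK //; apply: (submodP U).1 => //; apply: subvsP. Qed.

Fact sub_act_linear : linear sub_act.
Proof.
move=> c a b; apply/lfunP => x; apply: val_inj => /=.
by rewrite add_lfunE scale_lfunE !linearP /= !sub_actE linearP add_lfunE scale_lfunE.
Qed.

Fact sub_act1 : sub_act 1 = \1%VF.
Proof. by apply/lfunP => x; apply: val_inj; rewrite /= sub_actE act1 !id_lfunE. Qed.

Fact sub_actM a b : sub_act (a * b) = (sub_act a \o sub_act b)%VF.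
Proof.
by apply/lfunP => x; apply: val_inj; rewrite /= comp_lfunE !sub_actE act_mul.
Qed.

Definition sub_amod : amod A := AMod sub_act_linear sub_act1 sub_actM.

Fact incl_lin : linear (vsval : subvs_of U -> V). Proof. by []. Qed.

Definition sub_incl : 'Hom(sub_amod, V) := @lfn k (subvs_of U) V vsval incl_lin.

Lemma sub_incl_hom : mod_hom sub_incl.
Proof. by move=> a x; rewrite [LHS]lfnE [LHS]sub_actE lfnE. Qed.

Lemma sub_incl_ker : lker sub_incl = 0%VS.
Proof. by apply: lker0_inj => x; rewrite lfnE => /eqP; rewrite -[0]/(vsval (0 : subvs_of U)) (inj_eq val_inj) => /eqP. Qed.

Lemma sub_incl_img : limg sub_incl = U.
Proof.
apply/vspaceP => x; apply/idP/idP => [/memv_imgP[y _ ->]|xU].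
  by rewrite lfnE subvsP.
by apply/memv_imgP; exists (vsproj U x); rewrite ?memvf // lfnE vsprojK.
Qed.

Fact quo_lin : linear (fun x : V => vsproj (U^C)%VS (x - projv U x)).
Proof.
move=> c x y; rewrite -linearP; congr (vsproj _ _).
by rewrite linearP scalerBr opprD addrACA.
Qed.

Definition quo_map : 'Hom(V, subvs_of (U^C)%VS) := lfn quo_lin.

Lemma quo_mapE x : vsval (quo_map x) = x - projv U x.
Proof. by rewrite lfnE vsprojK // memv_projC. Qed.

Lemma quo_ker : lker quo_map = U.
Proof.
apply/vspaceP => x; rewrite memv_ker -(inj_eq val_inj) /= quo_mapE subr_eq0.
by apply/eqP/idP => [->|xU]; rewrite ?memv_proj ?projv_id.
Qed.

Lemma quo_vsval y : quo_map (vsval y) = y.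
Proof.
apply: val_inj; rewrite /= quo_mapE; suff/eqP->: projv U (vsval y) == 0 by rewrite subr0.
by rewrite -memv_ker lker_proj subvsP.
Qed.

Fact quo_act_lin a : linear (fun x : subvs_of (U^C)%VS => quo_map (act V a (vsval x))).
Proof. by move=> c x y; rewrite !linearP. Qed.

Definition quo_act a : 'End(subvs_of (U^C)%VS) := lfn (quo_act_lin a).

Lemma quo_act_val a y : quo_act a y = quo_map (act V a (vsval y)).
Proof. exact: lfnE. Qed.

Lemma quo_actE a x : quo_map (act V a x) = quo_act a (quo_map x).
Proof.
rewrite quo_act_val -{1}(subrK (projv U x) x) -quo_mapE !linearD /=.
suff -> : quo_map (act V a (projv U x)) = 0 by rewrite addr0.
by apply/eqP; rewrite -memv_ker quo_ker; apply: (submodP U).1 => //; apply: memv_proj.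
Qed.

Fact quo_act_linear : linear quo_act.
Proof.
move=> c a b; apply/lfunP => x.
by rewrite add_lfunE scale_lfunE !quo_act_val !(linearP, add_lfunE, scale_lfunE) /=.
Qed.

Fact quo_act1 : quo_act 1 = \1%VF.
Proof. by apply/lfunP => x; rewrite quo_act_val act1 !id_lfunE quo_vsval. Qed.

Fact quo_actM a b : quo_act (a * b) = (quo_act a \o quo_act b)%VF.
Proof.
by apply/lfunP => x; rewrite -(quo_vsval x) -quo_actE comp_lfunE act_mul !quo_actE.
Qed.

Definition quo_amod : amod A := AMod quo_act_linear quo_act1 quo_actM.

End Sub.

Lemma ses_dim U V Q : ses U V Q -> \dim {:V} = (\dim {:U} + \dim {:Q})%N.
Proof.
case=> i [pi [_ _ ki sp e]]; rewrite -(dim_lker_limg pi) sp -e limg_dim_eq //.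
by rewrite ki capv0.
Qed.

Lemma ses_inj U V (i : 'Hom(U, V)) : mod_hom i -> lker i = 0%VS -> exists Q, ses U V Q.
Proof.
move=> hi ki; have sU := submod_img hi; exists (quo_amod sU).

exists i, (quo_map (limg i)); split=> //; first by move=> a x; apply: quo_actE.
  by apply: limg_full_surj => y; exists (vsval y); apply: quo_vsval.
by rewrite quo_ker.
Qed.

Lemma additive_dim : additive_fun (fun V => \dim {:V}).
Proof. exact: ses_dim. Qed.

(** For an idempotent [e], [V |-> e V] is an exact functor, which makes its
    dimension additive; the rank of a general element is not. *)
Lemma additive_rk e : e * e = e -> additive_fun (rk e).
Proof.
move=> ee U V Q [i [pi [hi hp ki sp eip]]].
rewrite /rk -(limg_ker_dim pi (limg (act V e))).
have -> : (pi @: limg (act V e))%VS = limg (act Q e).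
  apply/vspaceP => y; apply/memv_imgP/memv_imgP => [[x /memv_imgP[z _ ->] ->]|[z _ ->]].
    by exists (pi z); rewrite ?memvf.
  have /memv_imgP[t _ ->] : z \in limg pi by rewrite sp memvf.
  by exists (act V e t); rewrite ?memv_img ?memvf.
congr (_ + _)%N.
have -> : (limg (act V e) :&: lker pi)%VS = (i @: limg (act U e))%VS.
  apply/vspaceP => x; rewrite memv_cap -eip; apply/andP/memv_imgP.
    case=> /memv_imgP[z _ xz] /memv_imgP[u _ xu]; exists (act U e u).
      by rewrite memv_img ?memvf.
    by rewrite hi -xu xz -act_mul ee.
  case=> z /memv_imgP[u _ ->] ->; rewrite {1}hi; split; apply: memv_img; exact: memvf.
by rewrite limg_dim_eq // ki capv0.
Qed.

Lemma iso_ses U V : mod_iso U V -> exists2 Q, ses U V Q & \dim {:Q} = 0%N.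
Proof.
case=> f [bf hf]; have k0 : lker f = 0%VS by apply/eqP/lker0P; apply: bij_inj bf.
have [Q s] := ses_inj hf k0; exists Q => //; move/eqP: (ses_dim s).
have -> : \dim {:U} = \dim {:V}; last by rewrite -{1}[\dim {:V}]addn0 eqn_add2l => /eqP.
rewrite -(limg_dim_eq (f := f) (U := fullv)) ?k0 ?capv0 //; congr (\dim _).
by case: bf => g fg gf; apply: limg_full_surj => y; exists (g y).
Qed.

(** A module of dimension 0 fits in an exact sequence with two copies of itself. *)
Lemma additive0 F V : additive_fun F -> \dim {:V} = 0%N -> F V = 0%N.
Proof.
move=> aF /eqP; rewrite dimv_eq0 => /eqP f0.
have e0 (P : {vspace V}) : P = 0%VS by apply/eqP; rewrite -subv0 -f0 subvf.
have /aF/eqP : ses V V V.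
  exists 0, 0; rewrite !(e0 (lker _)) !(e0 (limg _)) f0; split=> // a x.
    by rewrite !zero_lfunE linear0.
  by rewrite !zero_lfunE linear0.
by rewrite -{1}[F V]addn0 eqn_add2l eq_sym => /eqP.
Qed.

Lemma additive_iso F U V : additive_fun F -> mod_iso U V -> F U = F V.
Proof.
by move=> aF /iso_ses[Q /aF-> /(additive0 aF)->]; rewrite addn0.
Qed.

Lemma mod_iso_sym U V : mod_iso U V -> mod_iso V U.
Proof.
case=> f [bf hf]; have k0 : lker f == 0%VS by apply/lker0P; apply: bij_inj bf.
have fK := lker0_lfunK k0; have Kf : cancel f^-1%VF f.
  by case: bf => g fg gf x; rewrite -{1}(gf x) fK gf.
exists f^-1%VF; split; first by exists f.
by move=> a x; rewrite -{1}(Kf x) -hf fK.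
Qed.

Lemma mod_iso_trans V U W : mod_iso U V -> mod_iso V W -> mod_iso U W.
Proof.
case=> f [bf hf] [g [bg hg]]; exists (g \o f)%VF; split=> [|a x].
  by apply: (eq_bij (bij_comp bg bf)) => x; rewrite comp_lfunE.
by rewrite !comp_lfunE hf hg.
Qed.

Lemma mod_iso_refl V : mod_iso V V.
Proof. by exists \1%VF; split=> [|a x]; [exists id => x|]; rewrite !id_lfunE. Qed.

Lemma mod_hom_comp U V W (f : 'Hom(U, V)) (g : 'Hom(V, W)) :
  mod_hom f -> mod_hom g -> mod_hom (g \o f)%VF.
Proof. by move=> hf hg a x; rewrite !comp_lfunE hf hg. Qed.

Lemma simple_sub V : {:V}%VS <> 0%VS ->
  exists U (i : 'Hom(U, V)), [/\ simple_mod U, mod_hom i & lker i = 0%VS].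
Proof.
have [n] := ubnP (\dim {:V}); elim: n V => // n IH V dV nz.
have [sV|nsV] := EM (simple_mod V).
  exists V, \1%VF; split=> //; first by move=> a x; rewrite !id_lfunE.
  by apply: lker0_inj => x; rewrite id_lfunE.
have [U [sU U0 U1]] : exists U : {vspace V}, [/\ submod U, U <> 0%VS & U <> fullv].
  apply: contrapT => h; apply: nsV; split=> // U sU.
  have [->|/eqP U0] := eqVneq U 0%VS; first by left.
  have [->|/eqP U1] := eqVneq U fullv; first by right.
  by case: h; exists U.
have dU : \dim {: sub_amod sU} = \dim U.
  by rewrite -[in RHS](sub_incl_img sU) limg_dim_eq // sub_incl_ker capv0.
have ltU : (\dim U < \dim {:V})%N.
  by rewrite ltn_neqAle dimvS ?subvf // andbT; apply/eqP => e; case: U1; apply/eqP; rewrite eqEdim subvf e leqnn.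
have [||W [i [sW hi ki]]] := IH (sub_amod sU).
- by rewrite dU (leq_trans ltU).
- by move=> f0; apply: U0; apply/eqP; rewrite -dimv_eq0 -dU f0 dimv0.
exists W, (sub_incl sU \o i)%VF; split=> //.
  exact: mod_hom_comp hi (@sub_incl_hom _ _ sU).
apply: lker0_inj => x; rewrite comp_lfunE => /eqP.
by rewrite -memv_ker sub_incl_ker memv0 -memv_ker ki memv0 => /eqP.
Qed.

(** Given [all_simples X], the multiplicity of [X j] in the composition series of
    [V] is [rk (e j) V], see [additive_expand]. *)
Definition simple_idems r (X : 'I_r -> amod A) (e : 'I_r -> A) :=
  (forall j, e j * e j = e j) /\ (forall i j, rk (e j) (X i) = (i == j)).

(** Peel off one simple submodule at a time: both sides are additive, and they
    agree on the simple modules. *)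
Lemma additive_expand r (X : 'I_r -> amod A) e F V :
  all_simples X -> simple_idems X e -> additive_fun F ->
  F V = (\sum_j rk (e j) V * F (X j))%N.
Proof.
move=> [sX nX cX] [ee re] aF.
have [n] := ubnP (\dim {:V}); elim: n V => // n IH V dV.
have [V0|/eqP V0] := eqVneq (\dim {:V}) 0%N.
  rewrite (additive0 aF) // big1 // => j _.
  by rewrite (additive0 (additive_rk (ee j))).
have [|U [i [sU hi ki]]] := @simple_sub V.
  by move=> f0; apply: V0; rewrite f0 dimv0.
have [Q s] := ses_inj hi ki; have [l Ul] := cX U sU.
rewrite (aF _ _ _ s) (IH Q); last first.
  rewrite -ltnS (leq_trans _ dV) // ltnS (ses_dim s) -[X in (X < _)%N]add0n ltn_add2r.
  rewrite lt0n dimv_eq0; apply/eqP; exact: sU.1.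
rewrite (additive_iso aF Ul).
have -> : F (X l) = (\sum_j rk (e j) U * F (X j))%N.
  rewrite (bigD1 l) //= (additive_iso (additive_rk (ee l)) Ul) re eqxx mul1n.
  rewrite big1 ?addn0 // => j /negPf nj.
  by rewrite (additive_iso (additive_rk (ee j)) Ul) re eq_sym nj.
rewrite -big_split; apply: eq_bigr => j _ /=.
by rewrite (additive_rk (ee j) s) mulnDl.
Qed.

End ModBasics.

(** * Density and primitive idempotents *)

Import passmx.

Section Density.
Context (k : closedFieldType) (A : falgType k).
Implicit Types U V W X Y : amod A.

Lemma lfun_eigen (V : vectType k) (f : 'End(V)) : {:V}%VS <> 0%VS ->
  exists c x, x != 0 /\ f x = c *: x.
Proof.
move=> /eqP; rewrite -dimv_eq0 => d0.
pose e := vbasis {:V}; pose M := mxof e e f.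
have [c /eigenvalueP[v vM v0]] : exists c, eigenvalue M c.
  have /closed_rootP[c rc] : size (char_poly M) != 1%N by rewrite size_char_poly.
  by exists c; rewrite eigenvalue_root_char.
have be : basis_of fullv e by exact: vbasisP.
exists c, (vecof e v); split; first by rewrite (vecof_eq0 be).
by rewrite (hom_vecof e be) -/M vM; have := vecof_linear e c v 0; rewrite !addr0 => ->; rewrite /vecof [X in _ + X]big1 ?addr0 // => i _; rewrite mxE scale0r.
Qed.

Lemma simple_hom_bij X Y (f : 'Hom(X, Y)) : simple_mod X -> simple_mod Y -> mod_hom f ->
  f = 0 \/ mod_iso X Y.
Proof.
move=> [X0 sX] [Y0 sY] hf.
have [k0|k1] := sX _ (submod_ker hf); last first.
  by left; apply/lfunP => x; rewrite zero_lfunE; apply/eqP; rewrite -memv_ker k1 memvf.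
have [i0|i1] := sY _ (submod_img hf).
  left; apply/lfunP => x; rewrite zero_lfunE; apply/eqP.
  by rewrite -memv0 -i0 memv_img ?memvf.
have fi : lker f == 0%VS by rewrite k0.
right; exists f; split=> //; exists f^-1%VF; first exact: lker0_lfunK.
by move=> y; rewrite limg_lfunVK // i1 memvf.
Qed.

Lemma schur X (f : 'End(X)) : simple_mod X -> mod_hom f -> exists c, forall x, f x = c *: x.
Proof.
move=> [X0 sX] hf; have [c [x [x0 fx]]] := lfun_eigen f X0.
exists c => y; pose g := f - c *: \1%VF.
have hg : mod_hom g.
  move=> a z; rewrite /g !(add_lfunE, opp_lfunE, scale_lfunE, id_lfunE) hf linearB /=.
  by rewrite [act X a (c *: z)]linearZ.
have [k0|k1] := sX _ (submod_ker hg).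
  suff: x \in lker g by rewrite k0 memv0 (negPf x0).
  by rewrite memv_ker /g !(add_lfunE, opp_lfunE, scale_lfunE, id_lfunE) fx subrr.
have: y \in lker g by rewrite k1 memvf.
by rewrite memv_ker /g !(add_lfunE, opp_lfunE, scale_lfunE, id_lfunE) subr_eq0 => /eqP.
Qed.

Lemma factor_lfun (U V W : vectType k) (g : 'Hom(U, V)) (h : 'Hom(U, W)) :
  (forall x, g x = 0 -> h x = 0) -> exists phi : 'Hom(V, W), forall x, phi (g x) = h x.
Proof.
move=> gh; exists (h \o g^-1)%VF => x; rewrite comp_lfunE.
apply/eqP; rewrite -subr_eq0 -linearB; apply/eqP/gh.
by rewrite linearB /= limg_lfunVK ?subrr // memv_img ?memvf.
Qed.

Definition lideal (L : {vspace A}) := forall a b, b \in L -> a * b \in L.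

Fact ev_lin X (x : X) : linear (fun a => act X a x).
Proof. by lin. Qed.

Definition ev X (x : X) : 'Hom(A, X) := lfn (ev_lin x).

Lemma lideal_ker X (x : X) : lideal (lker (ev x)).
Proof. by move=> a b; rewrite !memv_ker !lfnE act_mul => /eqP->; rewrite linear0. Qed.

Lemma lideal_cap L L' : lideal L -> lideal L' -> lideal (L :&: L')%VS.
Proof. by move=> l l' a b; rewrite !memv_cap => /andP[/l-> /l'->]. Qed.

(** [a y |-> a x] is well defined on the submodule [L y], which is [0] or [Y]. *)
Lemma ann_hom L X Y (x : X) (y : Y) : lideal L -> simple_mod Y ->
    (forall a, a \in L -> act Y a y = 0 -> act X a x = 0) ->
  exists2 phi : 'Hom(Y, X), mod_hom phi &
    forall a, a \in L -> phi (act Y a y) = act X a x.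
Proof.
move=> lL [Y0 sY] Lx; pose Ly := (ev y @: L)%VS.
have sLy : submod Ly.
  apply/submodP => a z /memv_imgP[b bL ->]; rewrite lfnE -act_mul -(lfnE (ev_lin y)).
  by rewrite memv_img // lL.
have [l0|l1] := sY _ sLy.
  exists 0 => [a z|a aL]; first by rewrite !zero_lfunE linear0.
  rewrite zero_lfunE Lx //; apply/eqP; rewrite -memv0 -l0 -(lfnE (ev_lin y)).
  by rewrite memv_img.
have [|phi phiE] := @factor_lfun (subvs_of L) Y X (ev y \o lfn (@vsval_is_linear _ _ L))%VF
  (ev x \o lfn (@vsval_is_linear _ _ L))%VF.
  by move=> a; rewrite !comp_lfunE !lfnE => /Lx; apply; apply: subvsP.
have E a : a \in L -> phi (act Y a y) = act X a x.
  by move=> aL; have := phiE (vsproj L a); rewrite !comp_lfunE !lfnE vsprojK.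
exists phi => // a z; have: z \in Ly by rewrite l1 memvf.
by case/memv_imgP => b bL ->; rewrite lfnE -act_mul !E ?lL // act_mul.
Qed.

Definition faithful_on (L : {vspace A}) X :=
  forall x : X, (forall a, a \in L -> act X a x = 0) -> x = 0.

(** Otherwise [a y |-> a x] would be a nonzero morphism from [Y] to [X]. *)
Lemma faithful_on_cap L X Y (y : Y) : lideal L -> simple_mod X -> simple_mod Y ->
  ~ mod_iso Y X -> faithful_on L X -> faithful_on (L :&: lker (ev y))%VS X.
Proof.
move=> lL sX sY nXY fL x Lx; apply: fL => a aL.
have [b bL by0|phi hphi phiE] := @ann_hom L X Y x y lL sY.
  by apply: Lx; rewrite memv_cap bL memv_ker lfnE by0 eqxx.
have [phi0|//] := simple_hom_bij sY sX hphi.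
by rewrite -phiE // phi0 zero_lfunE.
Qed.

Lemma faithful_on_mod L X Y : lideal L -> simple_mod X -> simple_mod Y ->
    ~ mod_iso Y X -> faithful_on L X ->
  exists L', [/\ lideal L', faithful_on L' X, (L' <= L)%VS &
    forall a, a \in L' -> act Y a = 0].
Proof.
move=> lL sX sY nXY fL.
suff [L' [l' f' s' h]] : exists L', [/\ lideal L', faithful_on L' X, (L' <= L)%VS &
    forall a, a \in L' -> forall y, y \in (vbasis {:Y} : seq Y) -> act Y a y = 0].
  exists L'; split=> // a aL; apply/lfunP => z; rewrite zero_lfunE.
  rewrite (coord_vbasis (memvf z)) linear_sum big1 // => i _.
  by rewrite linearZ /= h ?scaler0 // mem_nth // size_tuple.
elim: (vbasis {:Y} : seq Y) => [|y s [L' [l' f' s' h]]]; first by exists L.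
exists (L' :&: lker (ev y))%VS; split.
- by apply: lideal_cap => //; apply: lideal_ker.
- exact: faithful_on_cap.
- exact: subv_trans (capvSl _ _) s'.
move=> a; rewrite memv_cap => /andP[aL]; rewrite memv_ker lfnE => /eqP ay z.
by rewrite inE => /orP[/eqP->|]; [|apply: h].
Qed.

(** Jacobson density for one simple module, by induction on the family: if [y] is
    its last member, [a y |-> a x] is an endomorphism on the annihilator of the
    others, hence a scalar [c] by Schur's lemma, and [x - c y] is in their span. *)
Lemma density L X (s : seq X) (x : X) : lideal L -> simple_mod X -> faithful_on L X ->
    (forall a, a \in L -> (forall y, y \in s -> act X a y = 0) -> act X a x = 0) ->
  x \in << s >>%VS.
Proof.
move=> lL sX; elim: s L x lL => [|y s IH] L x lL fL Lx.
  by rewrite span_nil memv0; apply/eqP/fL => a aL; apply: Lx.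
suff [L' [lL' hL' LL']] : exists L' : {vspace A}, [/\ lideal L', (L' <= L)%VS &
    forall a, (a \in L') = (a \in L) && all (fun y => act X a y == 0) s].
  have [a aL ay|phi hphi phiE] := @ann_hom L' X X x y lL' sX.
    move: aL; rewrite LL' => /andP[aL /allP as0]; apply: Lx => // z.
    by rewrite inE => /orP[/eqP->//|/as0/eqP].
  have [c phic] := schur sX hphi.
  have : x - c *: y \in << s >>%VS.
    apply: (IH L) => // a aL as0; rewrite linearB linearZ /= -phic phiE ?subrr //.
    by rewrite LL' aL; apply/allP => z /as0->.
  rewrite span_cons => xs; rewrite -(subrK (c *: y) x) addrC memv_add //.
  by rewrite memvZ // memv_line.
elim: {IH Lx} s => [|z s [L' [l1 l2 l3]]].
  by exists L; split=> // a; rewrite andbT.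
exists (L' :&: lker (ev z))%VS; split.
- by apply: lideal_cap => //; apply: lideal_ker.
- exact: subv_trans (capvSl _ _) l2.
by move=> a; rewrite memv_cap l3 memv_ker lfnE /= -andbA; congr (_ && _); rewrite andbC.
Qed.

(** The elements killing the other simple modules form a left ideal that still
    separates the points of [X j]; density then provides [b] in it with [b v] nonzero
    and [b s = 0], and [c] with [c b v = v] exists as [X j] is simple. *)
Lemma simple_projector r (X : 'I_r -> amod A) j (v : X j) (s : seq (X j)) :
    (forall i, simple_mod (X i)) -> (forall i l, mod_iso (X i) (X l) -> i = l) ->
    v \notin << s >>%VS ->
  exists a, [/\ act (X j) a v = v, forall y, y \in s -> act (X j) a y = 0
    & forall i, i != j -> act (X i) a = 0].
Proof.
move=> sX nX vs.
have [L [lL fL hL]] : exists L, [/\ lideal L, faithful_on L (X j) &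
    forall i a, a \in L -> i != j -> act (X i) a = 0].
  suff [L [lL fL hL]] : exists L, [/\ lideal L, faithful_on L (X j) &
      forall i, i \in enum 'I_r -> forall a, a \in L -> i != j -> act (X i) a = 0].
    by exists L; split=> // i a aL; apply: hL; rewrite ?mem_enum.
  elim: (enum 'I_r) => [|i s' [L [lL fL hL]]].
    exists fullv; split=> // [a b _|x /(_ 1 (memvf _))]; first exact: memvf.
    by rewrite act_one.
  have [->|nij] := eqVneq i j.
    exists L; split=> // l; rewrite inE => /orP[/eqP->|ls a aL]; first by rewrite eqxx.
    exact: hL.
  have nXij : ~ mod_iso (X i) (X j) by move/nX => e; rewrite e eqxx in nij.
  have [L' [lL' fL' s1 h1]] := faithful_on_mod lL (sX j) (sX i) nXij fL.
  exists L'; split=> // l; rewrite inE => /orP[/eqP-> a aL _|ls a aL]; first exact: h1.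
  by apply: hL => //; apply: (subvP s1).
have [b [bL bs bv]] : exists b, [/\ b \in L, forall y, y \in s -> act (X j) b y = 0
    & act (X j) b v != 0].
  apply: contrapT => h; move/negP: vs; apply; apply: (density lL (sX j) fL) => b bL bs.
  by apply/eqP/negP => /negP bv; apply: h; exists b.
have [c cv] : exists c, act (X j) c (act (X j) b v) = v.
  pose U := limg (ev (act (X j) b v)).
  have sU : submod U.
    apply/submodP => a z /memv_imgP[c _ ->].
    by rewrite lfnE -act_mul -(lfnE (ev_lin _)) memv_img ?memvf.
  have [U0|U1] := (sX j).2 U sU.
    have : ev (act (X j) b v) 1 \in U by rewrite memv_img ?memvf.
    by rewrite lfnE act_one U0 memv0 (negPf bv).
  have: v \in U by rewrite U1 memvf.
  by case/memv_imgP => c _ vc; exists c; rewrite [RHS]vc lfnE.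
exists (c * b); split=> [|y ys|i nij]; first by rewrite act_mul.
  by rewrite act_mul bs // linear0.
by rewrite actM (hL i b) // comp_lfun0r.
Qed.

End Density.

Section Idempotents.
Context (k : closedFieldType) (A : falgType k).
Implicit Types U V W X Y : amod A.

Lemma idem_poly_identity (R : comNzRingType) (x : R) n :
  exists g, (1 - (1 - x ^+ n) ^+ n) * (1 - x ^+ n) ^+ n = (x * (1 - x)) ^+ n * g.
Proof.
have [g1 e1] : exists g, 1 - (1 - x ^+ n) ^+ n = x ^+ n * g.
  exists (\sum_(i < n) (1 - x ^+ n) ^+ i).
  by rewrite -[LHS]opprB subrX1 -mulNr opprB opprB addrC subrK.
have [g2 e2] : exists g, 1 - x ^+ n = (1 - x) * g.
  by exists (\sum_(i < n) x ^+ i); rewrite -[LHS]opprB subrX1 -mulNr opprB.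
exists (g1 * g2 ^+ n); rewrite e1 e2 !exprMn -!mulrA; congr (_ * _).
by rewrite mulrCA.
Qed.

(** Lifting an idempotent modulo a nilpotent ideal, by a universal polynomial
    in [a] so that any endomorphism fixing [a] fixes the result. *)
Definition idem_of (a : A) n := 1 - (1 - a ^+ n) ^+ n.

Lemma idem_of_idem a n : (a * (1 - a)) ^+ n = 0 -> idem_of a n * idem_of a n = idem_of a n.
Proof.
move=> nil; suff e0 : idem_of a n * (1 - a ^+ n) ^+ n = 0.
  by rewrite {2}/idem_of mulrBr mulr1 e0 subr0.
have [g /(congr1 (horner_alg a))] := idem_poly_identity ('X : {poly k}) n.
rewrite !(rmorphM, rmorphXn, rmorphB, rmorph1) /= !horner_algX => ->.
by rewrite nil mul0r.
Qed.

Lemma act_idemX V a n : act V (a * a) = act V a -> act V (a ^+ n.+1) = act V a.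
Proof. by move=> h; elim: n => // n IH; rewrite exprS actM IH -actM. Qed.

Lemma act_idem_of V a n : (0 < n)%N -> act V (a * a) = act V a ->
  act V (idem_of a n) = act V a.
Proof.
case: n => // n _ h; rewrite /idem_of.
have idC b : act V (b * b) = act V b -> act V ((1 - b) * (1 - b)) = act V (1 - b).
  move=> hb; have z : act V (b - b * b) = 0 by rewrite linearB /= hb subrr.
  by rewrite mulrBr mulr1 mulrBl mul1r [LHS]linearB /= z subr0.
have hX := act_idemX n h.
have hXX : act V (a ^+ n.+1 * a ^+ n.+1) = act V (a ^+ n.+1) by rewrite !actM hX -actM.
by rewrite linearB /= (act_idemX _ (idC _ hXX)) linearB /= hX opprB addrC subrK.
Qed.

(** An element killing all simple modules is nilpotent: it shifts a composition
    series. *)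
Lemma rad_nilp b V : (forall Y, simple_mod Y -> act Y b = 0) ->
  act V (b ^+ \dim {:V}) = 0.
Proof.
move=> h; have [n] := ubnP (\dim {:V}); elim: n V => // n IH V dV.
have [V0|/eqP V0] := eqVneq (\dim {:V}) 0%N.
  have f0 : {:V}%VS = 0%VS by apply/eqP; rewrite -dimv_eq0 V0.
  apply/lfunP => x; rewrite zero_lfunE; apply/eqP; rewrite -memv0 -f0; exact: memvf.
have [|U [i [sU hi ki]]] := @simple_sub k A V.
  by move=> f0; apply: V0; rewrite f0 dimv0.
have [Q s] := ses_inj hi ki.
have dU : (0 < \dim {:U})%N by rewrite lt0n dimv_eq0; apply/eqP; apply: sU.1.
have bQ : act Q (b ^+ \dim {:Q}) = 0.
  apply: IH; rewrite -ltnS (leq_trans _ dV) // ltnS (ses_dim s).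
  by rewrite -[X in (X < _)%N]add0n ltn_add2r.
case: s (ses_dim s) => i' [pi [hi' hp _ _ e]] ->.
rewrite -(prednK dU) addSn exprS exprD; apply/lfunP => x; rewrite zero_lfunE !act_mul.
set y := act V (b ^+ \dim {:Q}) x.
have: y \in limg i' by rewrite e memv_ker hp bQ zero_lfunE.
case/memv_imgP => u _ ->; rewrite -!hi' -act_mul -exprS exprSr act_mul (h U sU).
by rewrite zero_lfunE !linear0.
Qed.

Lemma idem_lift a : (forall Y, simple_mod Y -> act Y (a * a) = act Y a) ->
  exists n, (0 < n)%N /\ idem_of a n * idem_of a n = idem_of a n.
Proof.
move=> h; exists (\dim {:A}); have d0 : (0 < \dim {:A})%N.
  rewrite lt0n dimv_eq0; apply/negP => /eqP f0.
  have: (1 : A) \in (0%VS : {vspace A}) by rewrite -f0 memvf.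
  by rewrite memv0 oner_eq0.
split=> //; apply: idem_of_idem; set b := a * (1 - a).
have : act (regular_mod A) (b ^+ \dim {:A}) = 0.
  by apply: rad_nilp => Y sY; rewrite /b mulrBr mulr1 linearB /= h // subrr.
move/lfunP/(_ (1 : A)); rewrite zero_lfunE /= lfunE /= mulr1; exact.
Qed.

Lemma line_proj_rk X a (v : X) (s : seq X) : v != 0 ->
    (<[v]> + << s >> = fullv)%VS ->
    act X a v = v -> (forall y, y \in s -> act X a y = 0) ->
  act X (a * a) = act X a /\ rk a X = 1%N.
Proof.
move=> v0 vs av as0.
have as1 z : z \in << s >>%VS -> act X a z = 0.
  move=> zs; apply/eqP; rewrite -memv_ker; move: z zs; apply/subvP/span_subvP => y ys.
  by rewrite memv_ker as0.
have aE z : exists c, act X a z = c *: v.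
  have: z \in (<[v]> + << s >>)%VS by rewrite vs memvf.
  case/memv_addP => _ /vlineP[c ->] [y ys ->]; exists c.
  by rewrite linearD linearZ /= av as1 // addr0.
split.
  by apply/lfunP => z; rewrite act_mul; have [c ->] := aE z; rewrite linearZ /= av.
rewrite /rk; suff -> : limg (act X a) = <[v]>%VS by rewrite dim_vline v0.
apply/vspaceP => z; apply/memv_imgP/vlineP => [[y _ ->]|[c ->]]; first exact: aE.
by exists (c *: v); rewrite ?memvf // linearZ /= av.
Qed.

(** The lift of a projector to an idempotent of the algebra still acts in the same
    way on the simple modules. *)
Lemma rk_idem_of r (X : 'I_r -> amod A) j a : all_simples X ->
    act (X j) (a * a) = act (X j) a -> rk a (X j) = 1%N ->
    (forall i, i != j -> act (X i) a = 0) ->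
  exists n, let e := idem_of a n in
  [/\ e * e = e, forall i, rk e (X i) = (i == j) & act (X j) e = act (X j) a].
Proof.
move=> [sX nX cX] aa ra a0.
have aa' i : act (X i) (a * a) = act (X i) a.
  by have [->//|nij] := eqVneq i j; rewrite actM a0 // comp_lfun0l.
have [n [n0 ee]] : exists n, (0 < n)%N /\ idem_of a n * idem_of a n = idem_of a n.
  apply: idem_lift => Y /cX[i /mod_iso_sym[f [[g fg gf] hf]]].
  by apply/lfunP => y; rewrite -(gf y) -!hf aa'.
exists n; split=> // [i|]; last exact: act_idem_of.
rewrite /rk act_idem_of // -/(rk a _); have [->//|nij] := eqVneq i j.
by rewrite /rk a0 // lim0g dimv0.
Qed.

Lemma line_compl (V : vectType k) (v : V) : v != 0 ->
  exists s : seq V, v \notin << s >>%VS /\ (<[v]> + << s >> = fullv)%VS.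
Proof.
move=> v0; exists (vbasis (<[v]>^C)%VS).
rewrite (span_basis (vbasisP _)) addv_complf; split=> //; apply/negP => vC.
have: v \in (<[v]> :&: <[v]>^C)%VS by rewrite memv_cap memv_line vC.
by rewrite capv_compl memv0 (negPf v0).
Qed.

Lemma simple_nz X : simple_mod X -> exists v : X, v != 0.
Proof.
case=> X0 _; exists (vpick {:X}); rewrite vpick0; exact/eqP.
Qed.

Lemma exists_idems r (X : 'I_r -> amod A) : all_simples X -> exists e, simple_idems X e.
Proof.
move=> aX; have [sX nX cX] := aX.
suff /fin_all_exists[e eP] : forall j, exists e : A,
    e * e = e /\ forall i, rk e (X i) = (i == j).
  by exists e; split=> [j|i j]; case: (eP j).
move=> j; have [v v0] := simple_nz (sX j); have [s [vs fs]] := line_compl v0.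
have [a [av as0 a0]] := simple_projector sX nX vs.
have [aa ra] := line_proj_rk v0 fs av as0.
by have [n [ee re _]] := rk_idem_of aX aa ra a0; exists (idem_of a n).
Qed.

(** The projectors on lines of the various [X i] are linearly independent. *)
Lemma simples_bound r (X : 'I_r -> amod A) : (forall i, simple_mod (X i)) ->
  (forall i l, mod_iso (X i) (X l) -> i = l) -> (r <= \dim {:A})%N.
Proof.
move=> sX nX.
have /fin_all_exists[a aP] j : exists a, act (X j) a != 0 /\
    forall i, i != j -> act (X i) a = 0.
  have [v v0] := simple_nz (sX j); have [s [vs _]] := line_compl v0.
  have [a [av _ a0]] := simple_projector sX nX vs; exists a; split=> //.
  by apply/eqP => az; move: v0; rewrite -av az zero_lfunE eqxx.
pose t := [tuple a i | i < r].
have tE (l : 'I_r) : t`_l = a l by rewrite -tnth_nth tnth_mktuple.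
have ft : free t.
  apply/freeP => c c0 i; have /(congr1 (act (X i))) := c0.
  rewrite linear0 linear_sum (bigD1 i) //= big1 => [|l nl]; last first.
    by rewrite tE linearZ /= (aP l).2 ?scaler0 // eq_sym.
  rewrite addr0 tE linearZ /= => /eqP.
  by rewrite scaler_eq0 (negPf (aP i).1) orbF => /eqP.
by move: ft; rewrite /free size_tuple => /eqP <-; rewrite dimvS ?subvf.
Qed.

(** A family of pairwise non-isomorphic simple modules of maximal size is complete. *)
Lemma exists_simples : exists r (X : 'I_r -> amod A), all_simples X.
Proof.
pose P r := exists X : 'I_r -> amod A, (forall i, simple_mod (X i)) /\
  forall i l, mod_iso (X i) (X l) -> i = l.
have P0 : exists n, `[< P n >] by exists 0%N; apply/asboolP; exists (fun=> regular_mod A); split=> [[]|[]].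
have Pb n : `[< P n >] -> (n <= \dim {:A})%N.
  by move/asboolP => [X [sX nX]]; apply: simples_bound sX nX.
case: (ex_maxnP P0 Pb) => r /asboolP[X [sX nX]] mx.
exists r, X; split=> // Y sY; apply: contrapT => nY.
suff /asboolP/mx : P r.+1 by rewrite ltnn.
exists (fun i => if unlift ord0 i is Some j then X j else Y); split=> [i|i l].
  by case: unliftP.
case: unliftP => [i'|] ->; case: unliftP => [l'|] -> //.
- by move/nX->.
- by move=> h; case: nY; exists i'; apply: mod_iso_sym.
- by move=> h; case: nY; exists l'.
Qed.

End Idempotents.

(** * Tensor products of modules over a Hopf algebra *)

Section Sweedler.
Context (k : fieldType) (H : hopfAlgType k) (W : vectType k).
Implicit Types a b : H.

Local Notation S := (@antipode k H).

Lemma sw_counitl (F : H -> W) a : linear F ->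
  tlift (fun x y => counit x *: F y) (comul a) = F a.
Proof.
move=> lF; rewrite -[in RHS](counitl a) (tlift_lin _ _ lF).
by apply: eq_tlift => x y; rewrite linZ.
Qed.

Lemma sw_counitr (F : H -> W) a : linear F ->
  tlift (fun x y => counit y *: F x) (comul a) = F a.
Proof.
move=> lF; rewrite -[in RHS](counitr a) (tlift_lin _ _ lF).
by apply: eq_tlift => x y; rewrite linZ.
Qed.

Lemma sw_antipodel (F : H -> W) a : linear F ->
  tlift (fun x y => F (S x * y)) (comul a) = counit a *: F 1.
Proof.
move=> lF; rewrite -(tlift_lin _ _ lF) antipodel.
by rewrite linZ.
Qed.

Lemma sw_antipoder (F : H -> W) a : linear F ->
  tlift (fun x y => F (x * S y)) (comul a) = counit a *: F 1.
Proof.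
move=> lF; rewrite -(tlift_lin _ _ lF) antipoder.
by rewrite linZ.
Qed.

Lemma sw_mul (B : H -> H -> W) a b : bilin B ->
  tlift B (comul (a * b)) =
  tlift (fun a1 a2 => tlift (fun b1 b2 => B (a1 * b1) (a2 * b2)) (comul b)) (comul a).
Proof.
move=> bB; rewrite comulM /tmul (tlift_lin _ _ (tlift_linear _)); apply: eq_tlift => a1 a2.
rewrite (tlift_lin _ _ (tlift_linear _)); apply: eq_tlift => b1 b2.
by rewrite tlift_pure.
Qed.

Lemma sw_one (B : H -> H -> W) : bilin B -> tlift B (comul 1) = B 1 1.
Proof. by move=> bB; rewrite comul1 tlift_pure. Qed.

End Sweedler.

Section TensMod.
Context (k : fieldType) (H : hopfAlgType k).
Implicit Types V W X Y : amod H.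

Fact tact_lin V W a :
  linear (fun t : tens V W => tlift (fun x y => tmap (act V x) (act W y) t) (comul a)).
Proof. by rewrite /tmap; lin. Qed.

Definition tact V W a : 'End(tens V W) := lfn (tact_lin a).

Lemma tact_pure V W a v w :
  tact V W a (pure v w) = tlift (fun x y => pure (act V x v) (act W y w)) (comul a).
Proof. by rewrite lfnE; apply: eq_tlift => x y; rewrite tmap_pure //; lin. Qed.

Lemma lfun_tens_ext V W (U : vectType k) (f g : 'Hom(tens V W, U)) :
  (forall v w, f (pure v w) = g (pure v w)) -> f = g.
Proof. by move=> e; apply/lfunP; apply: tens_ext => //; apply: linearP. Qed.

Fact tact_linear V W : linear (@tact V W).
Proof.
move=> c a b; apply: lfun_tens_ext => v w.
by rewrite add_lfunE scale_lfunE !tact_pure linearP tlift_linear.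
Qed.

Fact tact1 V W : tact V W 1 = \1%VF.
Proof.
apply: lfun_tens_ext => v w; rewrite tact_pure sw_one ?act_one ?id_lfunE //; bil.
Qed.

Fact tactM V W a b : tact V W (a * b) = (tact V W a \o tact V W b)%VF.
Proof.
apply: lfun_tens_ext => v w; rewrite comp_lfunE !tact_pure sw_mul; last by bil.
rewrite (tlift_lin (L := tact V W a)); last by lin.
under [RHS]eq_tlift => b1 b2 do rewrite tact_pure.
rewrite exchange_tlift; apply: eq_tlift => b1 b2; apply: eq_tlift => a1 a2.
by rewrite !act_mul.
Qed.

Definition tmod V W : amod H := AMod (@tact_linear V W) (tact1 V W) (@tactM V W).

Lemma act_tmod V W a v w :
  act (tmod V W) a (pure v w) = tlift (fun x y => pure (act V x v) (act W y w)) (comul a).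
Proof. exact: tact_pure. Qed.

Fact tmap_lfn_lin (U V U' V' : vectType k) (f : 'Hom(U, U')) (g : 'Hom(V, V')) :
  linear (tmap f g).
Proof. exact: tlift_linear. Qed.

Definition tmapf (U V U' V' : vectType k) (f : 'Hom(U, U')) (g : 'Hom(V, V')) :
  'Hom(tens U V, tens U' V') := lfn (tmap_lfn_lin f g).

Lemma tmapf_pure (U V U' V' : vectType k) (f : 'Hom(U, U')) (g : 'Hom(V, V')) u v :
  tmapf f g (pure u v) = pure (f u) (g v).
Proof. by rewrite lfnE tmap_pure //; lin. Qed.

Lemma tmapf_comp (U V U' V' U2 V2 : vectType k) (f : 'Hom(U, U')) (g : 'Hom(V, V'))
    (f' : 'Hom(U', U2)) (g' : 'Hom(V', V2)) :
  (tmapf f' g' \o tmapf f g)%VF = tmapf (f' \o f)%VF (g' \o g)%VF.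
Proof.
apply/lfunP; apply: tens_ext; [exact: linearP | exact: linearP |] => u v.
by rewrite comp_lfunE !tmapf_pure !comp_lfunE.
Qed.

Lemma tmapf_id (U V : vectType k) : tmapf (\1 : 'End(U)) (\1 : 'End(V)) = \1%VF.
Proof.
apply/lfunP; apply: tens_ext; [exact: linearP | exact: linearP |] => u v.
by rewrite tmapf_pure !id_lfunE.
Qed.

Lemma tmapf_hom V W V' W' (f : 'Hom(V, V')) (g : 'Hom(W, W')) :
  mod_hom f -> mod_hom g -> @mod_hom k H (tmod V W) (tmod V' W') (tmapf f g).
Proof.
move=> hf hg a; apply: tens_ext; [lin | lin |] => v w.
rewrite tmapf_pure !act_tmod (tlift_lin (L := tmapf f g)); last by lin.
by apply: eq_tlift => x y; rewrite tmapf_pure hf hg.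
Qed.

(** Injections and surjections of vector spaces have one-sided inverses, which
    survive tensoring with anything; this is how tensor products are shown to be
    exact. *)
Lemma lker0_left_inv (U V : vectType k) (f : 'Hom(U, V)) :
  lker f = 0%VS -> exists g : 'Hom(V, U), (g \o f = \1)%VF.
Proof. by move/eqP => k0; exists f^-1%VF; apply: lker0_compVf. Qed.

Lemma limgf_right_inv (U V : vectType k) (f : 'Hom(U, V)) :
  limg f = fullv -> exists g : 'Hom(V, U), (f \o g = \1)%VF.
Proof.
move=> s; exists f^-1%VF; apply/lfunP => x.
by rewrite comp_lfunE id_lfunE limg_lfunVK // s memvf.
Qed.

Lemma left_inv_lker0 (U V : vectType k) (f : 'Hom(U, V)) (g : 'Hom(V, U)) :
  (g \o f = \1)%VF -> lker f = 0%VS.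
Proof.
move=> gf; apply: lker0_inj => x fx.
by rewrite -[x]id_lfunE -gf comp_lfunE fx linear0.
Qed.

Lemma right_inv_limgf (U V : vectType k) (f : 'Hom(U, V)) (g : 'Hom(V, U)) :
  (f \o g = \1)%VF -> limg f = fullv.
Proof.
move=> fg; apply: limg_full_surj => y; exists (g y).
by rewrite -comp_lfunE fg id_lfunE.
Qed.

Lemma ses_tmod U V Q W : ses U V Q -> ses (tmod U W) (tmod V W) (tmod Q W).
Proof.
move=> s; have ds := ses_dim s; case: s => i [pi [hi hp ki sp e]].
have [i' i'i] := lker0_left_inv ki; have [pi' pip'] := limgf_right_inv sp.
pose I := tmapf i (\1 : 'End(W)); pose P := tmapf pi (\1 : 'End(W)).
have h1 : mod_hom (\1 : 'End(W)) by move=> a x; rewrite !id_lfunE.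
have kI : lker I = 0%VS.
  by apply: (left_inv_lker0 (g := tmapf i' \1)); rewrite tmapf_comp i'i comp_lfun1l tmapf_id.
have sP : limg P = fullv.
  by apply: (right_inv_limgf (g := tmapf pi' \1)); rewrite tmapf_comp pip' comp_lfun1l tmapf_id.
exists I, P; split=> //; [exact: tmapf_hom | exact: tmapf_hom |].
apply/eqP; rewrite eqEdim; apply/andP; split.
  apply/subvP => _ /memv_imgP[t _ ->]; rewrite memv_ker; apply/eqP.
  have -> : P (I t) = (P \o I)%VF t by rewrite comp_lfunE.
  rewrite tmapf_comp; suff -> : (pi \o i = 0)%VF.
    apply: (tens_ext (g := fun=> 0)); [lin | by move=> c x y; rewrite scaler0 addr0 |] => u v.
    rewrite tmapf_pure zero_lfunE (@lin0 _ _ _ (fun x => pure x _)) //; lin.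
  apply/lfunP => u; rewrite comp_lfunE zero_lfunE; apply/eqP.
  by rewrite -memv_ker -e memv_img ?memvf.
rewrite [X in (_ <= X)%N]limg_dim_eq ?kI ?capv0 //.
have := dim_lker_limg P; rewrite sP !dim_tens ds mulnDl => /eqP.
by rewrite eqn_add2r => /eqP->.
Qed.

Lemma tmod_iso V W V' W' : mod_iso V V' -> mod_iso W W' -> mod_iso (tmod V W) (tmod V' W').
Proof.
have inv X Y (f : 'Hom(X, Y)) : bijective f ->
    exists g : 'Hom(Y, X), (g \o f = \1)%VF /\ (f \o g = \1)%VF.
  move=> bf; have k0 : lker f = 0%VS by apply/eqP/lker0P; apply: bij_inj bf.
  have s : limg f = fullv by case: bf => g fg gf; apply: limg_full_surj => y; exists (g y).
  exists f^-1%VF; split; first by apply: lker0_compVf; rewrite k0.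
  by apply/lfunP => x; rewrite comp_lfunE id_lfunE limg_lfunVK // s memvf.
case=> f [/inv[f' [f'f ff']] hf] [g [/inv[g' [g'g gg']] hg]].
exists (tmapf f g); split; last exact: tmapf_hom.
by exists (tmapf f' g') => t; rewrite -comp_lfunE tmapf_comp ?f'f ?g'g ?ff' ?gg' tmapf_id id_lfunE.
Qed.

Lemma tmod_trivl V : mod_iso (tmod (triv_mod H) V) V.
Proof.
have lf : linear (tlift (fun (c : k^o) (v : V) => c *: v) : tens k^o V -> V).
  exact: tlift_linear.
have bB : bilin (fun (c : k^o) (v : V) => c *: v) by split=> ?; lin.
have lg : linear (fun v : V => pure (1 : k^o) v) by lin.
exists (lfn lf); split.
  exists (lfn lg) => [t|v]; rewrite !lfnE; last by rewrite tlift_pure // scale1r.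
  move: t; apply: tens_ext; [lin | exact: lin_id |] => c v.
  rewrite tlift_pure //; transitivity (c *: pure (1 : k^o) v).
    by apply: (@linZ _ _ _ (fun x => pure 1 x)); lin.
  have := @linZ _ _ _ (fun x : k^o => pure x v) c 1; rewrite [c *: 1]mulr1 => -> //; lin.
move=> a; apply: tens_ext; [lin | lin |] => c v.
have lF : linear (tlift (fun (c : k^o) (v : V) => c *: v) : tens k^o V -> V) by [].
rewrite act_tmod !lfnE (tlift_lin _ _ lF) tlift_pure //.
under eq_tlift => x y.
  rewrite tlift_pure // /= scale_lfunE id_lfunE -scalerA [counit x *: _]scalerA [_ * c]mulrC -scalerA; over.
by rewrite tliftZ (sw_counitl (F := fun y => act V y v)) ?linearZ //; lin.
Qed.

End TensMod.

Section Rank.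
Context (k : fieldType).

Lemma dim_limg_tmapl (U V W : vectType k) (f : 'Hom(U, V)) :
  \dim (limg (tmapf f (\1 : 'End(W)))) = (\dim (limg f) * \dim {:W})%N.
Proof.
pose i := lfn (@vsval_is_linear _ _ (limg f)).
pose I := tmapf i (\1 : 'End(W)).
have kI : lker I = 0%VS.
  have [|i' i'i] := @lker0_left_inv _ _ _ i.
    by apply: lker0_inj => x; rewrite lfnE => x0; apply: val_inj.
  by apply: (left_inv_lker0 (g := tmapf i' \1)); rewrite tmapf_comp i'i comp_lfun1l tmapf_id.
have -> : limg (tmapf f (\1 : 'End(W))) = limg I.
  pose g := lfn (lin_hom (linfun (vsproj (limg f))) (lin_fun f)).
  have fE : f = (i \o g)%VF.
    apply/lfunP => x; have gE : g x = vsproj (limg f) (f x) by rewrite lfnE lfunE.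
    by rewrite comp_lfunE gE lfnE vsprojK // memv_img ?memvf.
  pose h : 'Hom(subvs_of (limg f), U) := (f^-1 \o i)%VF.
  have iE : i = (f \o h)%VF.
    apply/lfunP => x; rewrite !comp_lfunE limg_lfunVK // lfnE; exact: subvsP.
  apply/eqP; rewrite eqEsubv; apply/andP; split.
    have -> : tmapf f (\1 : 'End(W)) = (I \o tmapf g \1)%VF.
      by rewrite tmapf_comp comp_lfun1l -fE.
    by rewrite limg_comp limgS ?subvf.
  have -> : I = (tmapf f \1 \o tmapf h \1)%VF by rewrite tmapf_comp comp_lfun1l -iE.
  by rewrite limg_comp limgS ?subvf.
rewrite limg_dim_eq ?kI ?capv0 // dim_tens; congr (_ * _)%N.
by rewrite dimvf.
Qed.

End Rank.

Section Theta.
Context (k : fieldType) (H : hopfAlgType k).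
Implicit Types V W X Y : amod H.

Local Notation reg := (regular_mod H).

Lemma act_reg (a x : H) : act reg a x = a * x.
Proof. by rewrite /= lfunE. Qed.

Fact theta_lin V : linear (tlift (fun (a : H) (v : V) => act (tmod reg V) a (pure (1 : H) v))).
Proof. exact: tlift_linear. Qed.

(** The map [a (x) v |-> a1 (x) a2 v], which untwists the diagonal action. *)
Definition theta V : 'End(tens H V) := lfn (@theta_lin V).

Lemma theta_pure_act V (a : H) (v : V) :
  theta V (pure a v) = act (tmod reg V) a (pure (1 : H) v).
Proof. by rewrite lfnE tlift_pure //; bil. Qed.

Lemma theta_pure V (a : H) (v : V) :
  theta V (pure a v) = tlift (fun x y : H => pure x (act V y v)) (comul a).
Proof.
by rewrite theta_pure_act act_tmod; apply: eq_tlift => x y; rewrite act_reg mulr1.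
Qed.

Lemma theta_surj V t : exists u, theta V u = t.
Proof.
have lg : linear (tlift (fun (a : H) (v : V) =>
    tlift (fun x y : H => pure x (act V (antipode y) v)) (comul a))).
  exact: tlift_linear.
exists (lfn lg t); rewrite lfnE; move: t; apply: tens_ext; [lin | exact: lin_id |] => a v.
rewrite tlift_pure; last by bil.
rewrite (tlift_lin (L := theta V)); last by lin.
under eq_tlift => x y do rewrite theta_pure.
rewrite (sweedler3 (T := fun x1 x2 y => pure x1 (act V x2 (act V (antipode y) v)))); try by move=> *; lin.
under eq_tlift => x y.
  under eq_tlift => y1 y2 do rewrite -act_mul.
  rewrite (sw_antipoder (F := fun z => pure x (act V z v))); last by lin.
  rewrite act_one; over.
by rewrite (sw_counitr (F := fun x => pure x v)); last by lin.
Qed.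

Lemma theta_inj V t : theta V t = 0 -> t = 0.
Proof. by apply: surj_inj_dim => // u; apply: theta_surj. Qed.

Lemma theta_act V (a : H) t : theta V (tmapf (amull a) (\1 : 'End(V)) t) = act (tmod reg V) a (theta V t).
Proof.
move: t; apply: tens_ext; [lin | lin |] => b v.
have -> : tmapf (amull a) (\1 : 'End(V)) (pure b v) = pure (a * b) v.
  by rewrite tmapf_pure id_lfunE lfunE.
by rewrite !theta_pure_act act_mul.
Qed.

(** The tensor identity: through [theta], the module [H (x) V] is a sum of [dim V]
    copies of [H], whatever the action on [V] is. *)
Lemma rk_reg_tmod V (a : H) : rk a (tmod reg V) = (rk a reg * \dim {:V})%N.
Proof.
rewrite -dim_limg_tmapl /rk.
have <- : (theta V @: limg (tmapf (amull a) (\1 : 'End(V))))%VS = limg (act (tmod reg V) a).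
  apply/vspaceP => t; apply/memv_imgP/memv_imgP.
    by case=> _ /memv_imgP[u _ ->] ->; exists (theta V u); rewrite ?memvf ?theta_act.
  case=> s _ ->; have [u <-] := theta_surj s; rewrite -theta_act.
  by exists (tmapf (amull a) (\1 : 'End(V)) u); rewrite ?memv_img ?memvf.
rewrite (limg_dim_eq (f := theta V)) //; apply/eqP; rewrite -subv0; apply/subvP => t.
by rewrite memv_cap memv_ker memv0 => /andP[_ /eqP/theta_inj->].
Qed.

Context (V : amod H).

Fact dual_act_lin a : linear (fun f : 'Hom(V, k^o) => (f \o act V (antipode a))%VF).
Proof. by move=> c f g; rewrite comp_lfunDl comp_lfunZl. Qed.

Definition dual_act a : 'End('Hom(V, k^o)) := lfn (dual_act_lin a).

Fact dual_act_linear : linear dual_act.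
Proof.
move=> c a b; apply/lfunP => f; rewrite add_lfunE scale_lfunE !lfnE.
by rewrite !linearP /= comp_lfunDr comp_lfunZr.
Qed.

Fact dual_act1 : dual_act 1 = \1%VF.
Proof. by apply/lfunP => f; rewrite lfnE antipode1 act1 comp_lfun1r id_lfunE. Qed.

Fact dual_actM a b : dual_act (a * b) = (dual_act a \o dual_act b)%VF.
Proof. by apply/lfunP => f; rewrite comp_lfunE !lfnE antipodeM actM comp_lfunA. Qed.

Definition dual_mod : amod H := AMod dual_act_linear dual_act1 dual_actM.

(** Evaluating [V^*] at a nonzero [x] maps [V (x) V^*] to [V] and sends the
    invariant vector [\sum_i b_i (x) b_i^*] to [x]. *)
Lemma rk_tmod_dual e : {:V}%VS <> 0%VS -> counit e = 1 -> (0 < rk e (tmod V dual_mod))%N.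
Proof.
move=> /eqP; rewrite -vpick0; set x := vpick _ => x0 e1.
pose b := vbasis {:V}.
have lc i : linear (coord b i : V -> k^o) by move=> c u v; rewrite linearP.
pose t : tens V dual_mod := \sum_(i < \dim {:V}) pure b`_i (lfn (lc i) : dual_mod).
pose EV : tens V dual_mod -> V := tlift (fun v (f : dual_mod) => (f : 'Hom(V, k^o)) x *: v).
have bB : bilin (fun v (f : dual_mod) => (f : 'Hom(V, k^o)) x *: v).
  split=> [v|f]; last by lin.
  by move=> c f g; rewrite add_lfunE scale_lfunE scalerDl scalerA.
have lEV : linear EV by exact: tlift_linear.
have EVt : EV (act (tmod V dual_mod) e t) = x.
  rewrite (@linS _ _ _ (fun t => EV (act (tmod V dual_mod) e t))); last by lin.
  transitivity (\sum_i tlift (fun a1 a2 : H =>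
      coord b i (act V (antipode a2) x) *: act V a1 b`_i) (comul e)).
    apply: eq_bigr => i _; rewrite act_tmod (tlift_lin _ _ lEV).
    apply: eq_tlift => a1 a2; rewrite /EV tlift_pure // lfnE comp_lfunE lfnE.
    by [].
  rewrite tlift_sum -[RHS]scale1r -e1 -[X in _ *: X](act_one x).
  rewrite -(sw_antipoder (F := fun a => act V a x)); last by lin.
  apply: eq_tlift => a1 a2; rewrite act_mul [in RHS](coord_vbasis (memvf (act V _ x))).
  by rewrite linear_sum; apply: eq_bigr => i _; rewrite linearZ.
rewrite lt0n dimv_eq0; apply/negP => /eqP i0; move/negP: x0; apply; rewrite -EVt.
have : act (tmod V dual_mod) e t \in limg (act (tmod V dual_mod) e).
  by rewrite memv_img ?memvf.
by rewrite i0 memv0 => /eqP ->; rewrite lin0.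
Qed.

End Theta.

Section Restriction.
Context (k : fieldType) (A B : falgType k) (f : A -> B).
Hypotheses (lf : linear f) (f1 : f 1 = 1) (fM : forall a b, f (a * b) = f a * f b).
Context (V : amod B).

Fact res_linear : linear (fun a => act V (f a)).
Proof. by move=> c a b; rewrite lf act_linear. Qed.

Fact res1 : act V (f 1) = \1%VF.
Proof. by rewrite f1 act1. Qed.

Fact resM a b : act V (f (a * b)) = (act V (f a) \o act V (f b))%VF.
Proof. by rewrite fM actM. Qed.

Definition res : amod A := AMod res_linear res1 resM.

End Restriction.

(** * The dual Hopf algebra *)

Section DualAlgebra.
Context (k : fieldType) (H : hopfAlgType k).

(** A name of its own for the space of functionals, to carry the convolution
    product. *)
Definition hdual := 'Hom(H, k^o).

HB.instance Definition _ := Vector.copy hdual 'Hom(H, k^o).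

Definition hev (f : hdual) (x : H) : k^o := (f : 'Hom(H, k^o)) x.

Lemma lin_hevl (U : vectType k) (f : U -> hdual) x : linear f -> linear (fun u => hev (f u) x).
Proof. by move=> lf c u v; rewrite lf /hev add_lfunE scale_lfunE. Qed.

Lemma lin_hevr (U : vectType k) (f : hdual) (g : U -> H) : linear g -> linear (fun u => hev f (g u)).
Proof. by move=> lg c u v; rewrite lg /hev linearP. Qed.

End DualAlgebra.

Ltac lin_hook ::= first [apply: lin_hevl | apply: lin_hevr].

Section DualEval.
Context (k : fieldType) (H : hopfAlgType k).
Implicit Types (f : hdual H) (x y : H).

Lemma hevZr f c x : hev f (c *: x) = c * hev f x.
Proof. by rewrite /hev linearZ. Qed.

Lemma hevBr f x y : hev f (x - y) = hev f x - hev f y.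
Proof. by rewrite /hev linearB. Qed.

Lemma hev0r f : hev f 0 = 0.
Proof. by rewrite /hev linear0. Qed.

End DualEval.

Section DualRing.
Context (k : fieldType) (H : hopfAlgType k).
Local Notation K := (hdual H).
Implicit Types f g h : K.

Lemma hevP f g : (forall x, hev f x = hev g x) -> f = g.
Proof. by move=> e; apply/lfunP. Qed.

Fact hmul_lin f g : linear (fun a : H => tlift (fun x y : H => (hev f x * hev g y : k^o)) (comul a)).
Proof. by lin. Qed.

Definition hmul f g : K := lfn (hmul_lin f g).
Definition hone : K := lfn (@counit_linear k H : linear (@counit k H : H -> k^o)).

Fact hmulE f g a : hev (hmul f g) a = tlift (fun x y : H => (hev f x * hev g y : k^o)) (comul a).
Proof. exact: (lfnE (hmul_lin f g)). Qed.

Fact honeE a : hev hone a = counit a.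
Proof. exact: (lfnE (@counit_linear k H : linear (@counit k H : H -> k^o))). Qed.

Fact hmulA : associative hmul.
Proof.
move=> f g h; apply: hevP => a; rewrite !hmulE.
transitivity (tlift (fun x y : H => tlift (fun y1 y2 : H => (hev f x * (hev g y1 * hev h y2) : k^o))
   (comul y)) (comul a)).
  by apply: eq_tlift => x y; rewrite hmulE (tlift_lin (L := fun z : k^o => (hev f x * z : k^o))) //; lin.
rewrite -(sweedler3 (T := fun x y z : H => (hev f x * (hev g y * hev h z) : k^o))); try by move=> *; lin.
apply: eq_tlift => x y; rewrite hmulE (tlift_lin (L := fun z : k^o => (z * hev h y : k^o))); last by lin.
by apply: eq_tlift => x1 x2; rewrite mulrA.
Qed.

Fact hmul1l : left_id hone hmul.
Proof.
move=> f; apply: hevP => a; rewrite hmulE -(sw_counitl (F := hev f) a); last by lin.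
by apply: eq_tlift => x y; rewrite honeE.
Qed.

Fact hmul1r : right_id hone hmul.
Proof.
move=> f; apply: hevP => a; rewrite hmulE -(sw_counitr (F := hev f) a); last by lin.
by apply: eq_tlift => x y; rewrite honeE mulrC.
Qed.

Fact hevD f g x : hev (f + g) x = hev f x + hev g x.
Proof. exact: add_lfunE. Qed.

Fact hevZ c f x : hev (c *: f) x = c * hev f x.
Proof. exact: scale_lfunE. Qed.

Fact hmul_linl g : linear (hmul^~ g).
Proof.
move=> c f f'; apply: hevP => a; rewrite hevD hevZ !hmulE.
have := lin_tlift (F := fun f (x y : H) => (hev f x * hev g y : k^o)) (comul a).
by apply=> u v; lin.
Qed.

Fact hmul_linr f : linear (hmul f).
Proof.
move=> c g g'; apply: hevP => a; rewrite hevD hevZ !hmulE.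
have := lin_tlift (F := fun g (x y : H) => (hev f x * hev g y : k^o)) (comul a).
by apply=> u v; lin.
Qed.

Fact hmulDl : left_distributive hmul +%R.
Proof. by move=> f g h; apply: (linD (f := hmul^~ h)); apply: hmul_linl. Qed.

Fact hmulDr : right_distributive hmul +%R.
Proof. by move=> f g h; apply: linD; apply: hmul_linr. Qed.

Fact hone_neq0 : hone != 0.
Proof.
apply/eqP => /(congr1 (fun f : K => hev f (1 : H))); rewrite honeE counit1 /hev zero_lfunE => /eqP.
by rewrite oner_eq0.
Qed.

HB.instance Definition _ := GRing.Zmodule_isNzRing.Build K
  hmulA hmul1l hmul1r hmulDl hmulDr hone_neq0.

Fact hscaleAl c f g : c *: (f * g) = (c *: f) * g.
Proof. by rewrite -(linZ (f := hmul^~ g)) //; apply: hmul_linl. Qed.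

HB.instance Definition _ := GRing.Lmodule_isLalgebra.Build k K hscaleAl.

Fact hscaleAr c f g : c *: (f * g) = f * (c *: g).
Proof. by rewrite -(linZ (f := hmul f)) //; apply: hmul_linr. Qed.

HB.instance Definition _ := GRing.Lalgebra_isAlgebra.Build k K hscaleAr.
HB.instance Definition _ := Algebra_isFalgebra.Build k K.

Lemma hevM f g a : hev (f * g) a = tlift (fun x y : H => (hev f x * hev g y : k^o)) (comul a).
Proof. exact: hmulE. Qed.

Lemma hev1 a : hev 1 a = counit a.
Proof. exact: honeE. Qed.

Local Notation n := (\dim {:H}).
Local Notation b := (vbasis {:H}).

Fact coord_lin (i : 'I_n) : linear (coord b i : H -> k^o).
Proof. by lin. Qed.

Definition hbasis (i : 'I_n) : K := lfn (coord_lin i).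

Lemma hbasisE i a : hev (hbasis i) a = coord b i a.
Proof. exact: (lfnE (coord_lin i)). Qed.

Lemma hdual_expand f : f = \sum_(i < n) hev f b`_i *: hbasis i.
Proof.
apply: hevP => a; rewrite {1}(coord_vbasis (memvf a)) linS; last by lin.
rewrite (linS (f := fun g => hev g a)); last by lin.
by apply: eq_bigr => i _; rewrite linZ ?hevZ ?hbasisE 1?mulrC; last by lin.
Qed.

Lemma contract_inj (W : vectType k) (s t : tens K W) :
    (forall x, tlift (fun f w => (hev f x : k) *: w) s = tlift (fun f w => (hev f x : k) *: w) t) ->
  s = t.
Proof.
have E (u : tens K W) : u = \sum_(i < n) pure (hbasis i) (tlift (fun f w => (hev f b`_i : k) *: w) u).
  transitivity (\sum_(i < n) tlift (fun (f : K) w => hev f b`_i *: pure (hbasis i) w) u).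
    rewrite tlift_sum -[LHS]tlift_id; apply: eq_tlift => f w.
    rewrite {1}(hdual_expand f) (linS (f := fun f => pure f w)); last by lin.
    by apply: eq_bigr => i _; rewrite (linZ (f := fun f => pure f w)) //; lin.
  apply: eq_bigr => i _; rewrite (tlift_lin (L := fun w => pure (hbasis i) w)); last by lin.
  by apply: eq_tlift => f w; rewrite (linZ (f := fun w => pure _ w)) //; lin.
by move=> e; rewrite (E s) (E t); apply: eq_bigr => i _; rewrite e.
Qed.

Definition tev (t : tens K K) x y : k^o := tlift (fun f g => (hev f x * hev g y : k^o)) t.

Lemma tev_inj s t : (forall x y, tev s x y = tev t x y) -> s = t.
Proof.
move=> e; apply: contract_inj => x; apply: hevP => y.
have := e x y; rewrite /tev !(tlift_lin (L := fun f => hev f y)); try by lin.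
have E u : tlift (fun f g : K => (hev f x * hev g y : k^o)) u = tlift (fun f g : K => hev ((hev f x : k) *: g : K) y) u.
  by apply: eq_tlift => f g; rewrite hevZ.
by rewrite !E.
Qed.

Definition hcomul f : tens K K :=
  \sum_(i < n) \sum_(j < n) hev f (b`_i * b`_j) *: pure (hbasis i) (hbasis j).

Lemma tev_comul f x y : tev (hcomul f) x y = hev f (x * y).
Proof.
have lt : linear (fun t => tev t x y) by rewrite /tev; lin.
rewrite /hcomul (linS (f := fun t => tev t x y)) //.
rewrite [x in RHS](coord_vbasis (memvf x)) mulr_suml (linS (f := hev f)); last by lin.
apply: eq_bigr => i _; rewrite (linS (f := fun t => tev t x y)) //.
rewrite [y in RHS](coord_vbasis (memvf y)) mulr_sumr (linS (f := hev f)); last by lin.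
apply: eq_bigr => j _; rewrite (linZ (f := fun t => tev t x y)) // -scalerAl -scalerAr.
rewrite !(linZ (f := hev f)); try by lin.
rewrite /tev tlift_pure; last by bil.
rewrite !hbasisE /GRing.scale /= mulrC -!mulrA; congr (_ * _).
Qed.

Definition hcounit f : k := hev f 1.

Fact hantipode_lin f : linear ((fun x : H => hev f (antipode x)) : H -> k^o).
Proof. by lin. Qed.

Definition hantipode f : K := lfn (hantipode_lin f).

Lemma hantipodeE f x : hev (hantipode f) x = hev f (antipode x).
Proof. exact: (lfnE (hantipode_lin f)). Qed.

Fact hcomul_linear : linear hcomul.
Proof. by rewrite /hcomul; lin. Qed.

Fact hcounit_linear : scalar hcounit.
Proof. by move=> c f g; rewrite /hcounit hevD hevZ. Qed.

Fact hantipode_linear : linear hantipode.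
Proof. by move=> c f g; apply: hevP => x; rewrite hevD hevZ !hantipodeE hevD hevZ. Qed.

Fact hcomulA f : tassoc (tmap hcomul idfun (hcomul f)) = tmap idfun hcomul (hcomul f).
Proof.
have lh := hcomul_linear.
apply: contract_inj => x; apply: tev_inj => y z.
pose L (s : tens K (tens K K)) : k^o := tev (tlift (fun f w => (hev f x : k) *: w) s) y z.
have lL : linear L by rewrite /L /tev; lin.
have Lp g (w : tens K K) : L (pure g w) = hev g x * tev w y z.
  rewrite /L tlift_pure; last by bil.
  by rewrite (linZ (f := fun t => tev t y z)) //; rewrite /tev; lin.
rewrite -/(L _) -[RHS]/(L _) /tassoc tlift_tmap; last by bil.
rewrite /tmap !(tlift_lin _ _ lL).
transitivity (hev f (x * y * z)).
  rewrite -tev_comul /tev; apply: eq_tlift => g h; rewrite (tlift_lin _ _ lL) -tev_comul.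
  rewrite /tev (tlift_lin (L := fun w : k^o => (w * hev h z : k^o))); last by lin.
  apply: eq_tlift => u v; rewrite Lp /tev tlift_pure ?mulrA //; bil.
rewrite -mulrA -tev_comul /tev; apply: eq_tlift => g h.
by rewrite Lp tev_comul.
Qed.

Fact hcounitl f : tlift (fun g h : K => hcounit g *: h) (hcomul f) = f.
Proof.
apply: hevP => y; rewrite (tlift_lin (L := fun g => hev g y)); last by lin.
rewrite -[in RHS](mul1r y) -tev_comul; apply: eq_tlift => g h.
by rewrite hevZ.
Qed.

Fact hcounitr f : tlift (fun g h : K => hcounit h *: g) (hcomul f) = f.
Proof.
apply: hevP => y; rewrite (tlift_lin (L := fun g => hev g y)); last by lin.
rewrite -[in RHS](mulr1 y) -tev_comul; apply: eq_tlift => g h.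
by rewrite hevZ mulrC.
Qed.

Fact hcomul1 : hcomul 1 = pure 1 1.
Proof.
apply: tev_inj => x y; rewrite tev_comul hev1 counitM /tev tlift_pure ?hev1 //; bil.
Qed.

Fact hcomulM f g : hcomul (f * g) = tmul (hcomul f) (hcomul g).
Proof.
apply: tev_inj => x y; rewrite tev_comul hevM sw_mul; last by bil.
have lt : linear (fun t : tens K K => tlift (fun a b : K => (hev a x * hev b y : k^o)) t) by lin.
rewrite /tmul [in RHS]/tev (tlift_lin _ _ lt).
transitivity (tlift (fun a1 a2 : K => tlift (fun c d : K => tlift (fun x1 x2 : H =>
   tlift (fun y1 y2 : H => ((hev a1 x1 * hev a2 y1) * (hev c x2 * hev d y2) : k^o)) (comul y))
   (comul x)) (hcomul g)) (hcomul f)); last first.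
  apply: eq_tlift => a1 a2; rewrite (tlift_lin _ _ lt); apply: eq_tlift => c d.
  rewrite tlift_pure; last by bil.
  rewrite !hevM (tlift_lin (L := fun w : k^o => (w * _ : k^o))); last by lin.
  apply: eq_tlift => x1 x2; rewrite (tlift_lin (L := fun w : k^o => (_ * w : k^o))); last by lin.
  by apply: eq_tlift => y1 y2; rewrite mulrACA.
under [RHS]eq_tlift => a1 a2.
  rewrite exchange_tlift; under eq_tlift => x1 x2 do rewrite exchange_tlift; over.
rewrite exchange_tlift; apply: eq_tlift => x1 x2; rewrite exchange_tlift.
apply: eq_tlift => y1 y2; rewrite -!tev_comul {1}/tev.
rewrite (tlift_lin (L := fun w : k^o => (w * _ : k^o))); last by lin.
apply: eq_tlift => a1 a2.
by rewrite /tev (tlift_lin (L := fun w : k^o => (_ * w : k^o))) //; lin.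
Qed.

Fact hcounit1 : hcounit 1 = 1.
Proof. by rewrite /hcounit hev1 counit1. Qed.

Fact hcounitM f g : hcounit (f * g) = hcounit f * hcounit g.
Proof. by rewrite /hcounit hevM sw_one //; bil. Qed.

Fact hantipodel f : tlift (fun g h : K => hantipode g * h) (hcomul f) = (hcounit f)%:A.
Proof.
apply: hevP => a; rewrite (tlift_lin (L := fun g => hev g a)); last by lin.
under eq_tlift => g h do rewrite hevM.
rewrite exchange_tlift; transitivity (tlift (fun x y : H => hev f (antipode x * y)) (comul a)).
  apply: eq_tlift => x y; rewrite -tev_comul; apply: eq_tlift => g h.
  by rewrite hantipodeE.
rewrite (sw_antipodel (F := fun x => hev f x)); last by lin.
by rewrite hevZ hev1 mulrC.
Qed.

Fact hantipoder f : tlift (fun g h : K => g * hantipode h) (hcomul f) = (hcounit f)%:A.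
Proof.
apply: hevP => a; rewrite (tlift_lin (L := fun g => hev g a)); last by lin.
under eq_tlift => g h do rewrite hevM.
rewrite exchange_tlift; transitivity (tlift (fun x y : H => hev f (x * antipode y)) (comul a)).
  apply: eq_tlift => x y; rewrite -tev_comul; apply: eq_tlift => g h.
  by rewrite hantipodeE.
rewrite (sw_antipoder (F := fun x => hev f x)); last by lin.
by rewrite hevZ hev1 mulrC.
Qed.

HB.instance Definition _ := isHopf.Build k K hcomul_linear hcounit_linear
  hantipode_linear hcomulA hcounitl hcounitr hcomul1 hcomulM hcounit1 hcounitM
  hantipodel hantipoder.

Lemma dim_hdual : \dim {:K} = \dim {:H}.
Proof. by rewrite !dimvf /dim /= muln1. Qed.

Lemma sw_hdual f x y : tlift (fun g h : K => (hev g x * hev h y : k^o)) (comul f) = hev f (x * y).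
Proof. exact: tev_comul. Qed.

Lemma hev_antipode f x : hev (antipode f) x = hev f (antipode x).
Proof. exact: hantipodeE. Qed.

Lemma tens_sep (s t : tens H H) :
    (forall f g : K, tlift (fun x y => (hev f x * hev g y : k^o)) s =
                     tlift (fun x y => (hev f x * hev g y : k^o)) t) -> s = t.
Proof.
move=> e; apply/matrixP => i j; have := e (hbasis i) (hbasis j).
have E (u : tens H H) : tlift (fun x y => (hev (hbasis i) x * hev (hbasis j) y : k^o)) u = u i j.
  rewrite -[in RHS](tlift_id u).
  have lij : linear ((fun u : tens H H => u i j) : tens H H -> k^o).
    by move=> c u' v'; rewrite [LHS]mxE [X in X + _]mxE.
  rewrite (tlift_lin _ _ lij); apply: eq_tlift => x y.
  by rewrite mxE !hbasisE.
by rewrite !E.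
Qed.

Lemma hev_sep (x y : H) : (forall f : K, hev f x = hev f y) -> x = y.
Proof.
move=> e; rewrite (coord_vbasis (memvf x)) (coord_vbasis (memvf y)).
by apply: eq_bigr => i _; rewrite -!hbasisE e.
Qed.

(** The antipode of [H] reverses the comultiplication, because the antipode of
    the dual reverses the product. *)
Lemma comul_antipode (a : H) :
  comul (antipode a) = tmap (@antipode k H) (@antipode k H) (tflip (comul a)).
Proof.
apply: tens_sep => f g; rewrite -hevM -hev_antipode antipodeM hevM.
rewrite tlift_tmap; last by bil.
rewrite /tflip (tlift_lin (L := tlift _)); last by exact: tlift_linear.
apply: eq_tlift => x y; rewrite tlift_pure; last by bil.
by rewrite !hev_antipode mulrC.
Qed.

Lemma sw_antipode (W : vectType k) (B : H -> H -> W) a : bilin B ->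
  tlift B (comul (antipode a)) = tlift (fun x y => B (antipode y) (antipode x)) (comul a).
Proof.
move=> bB; rewrite comul_antipode tlift_tmap // /tflip (tlift_lin _ _ (tlift_linear _)).
by apply: eq_tlift => x y; rewrite tlift_pure //; split=> ?; lin.
Qed.

Lemma counit_antipode (a : H) : counit (antipode a) = counit a.
Proof.
have := congr1 (fun f => hev f a) (antipode1 K); rewrite hev_antipode !hev1.
by [].
Qed.

End DualRing.

(** * Integrals *)

Section Trace.
Context (k : fieldType) (V : vectType k).
Local Notation n := (\dim {:V}).
Local Notation b := (vbasis {:V}).

Definition ltr (f : V -> V) : k^o := \sum_(i < n) coord b i (f b`_i).

Lemma eq_ltr (f g : V -> V) : f =1 g -> ltr f = ltr g.
Proof. by move=> e; apply: eq_bigr => i _; rewrite e. Qed.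

Lemma ltr_comp (f g : V -> V) : linear f -> linear g -> ltr (f \o g) = ltr (g \o f).
Proof.
move=> lf lg.
have E (f' g' : V -> V) : linear f' -> ltr (f' \o g') =
    \sum_(i < n) \sum_(j < n) coord b j (g' b`_i) * coord b i (f' b`_j).
  move=> lf'; apply: eq_bigr => i _ /=.
  rewrite {1}(coord_vbasis (memvf (g' b`_i))) linS // linear_sum.
  by apply: eq_bigr => j _; rewrite linZ // linearZ.
rewrite (E _ _ lf) (E _ _ lg) exchange_big; apply: eq_bigr => i _; apply: eq_bigr => j _.
by rewrite mulrC.
Qed.

Lemma ltr_tlift (U U' : vectType k) (F : U -> U' -> V -> V) t :
  ltr (fun a => tlift (fun u v => F u v a) t) = tlift (fun u v => ltr (F u v)) t.
Proof.
rewrite /ltr -tlift_sum; apply: eq_bigr => i _.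
by rewrite (tlift_lin (L := coord b i : V -> k^o)) //; lin.
Qed.

Lemma ltrZ (c : k) (f : V -> V) : ltr (fun a => c *: f a) = c *: ltr f.
Proof. by rewrite /ltr scaler_sumr; apply: eq_bigr => i _; rewrite linearZ. Qed.

Lemma lin_ltr (U : vectType k) (F : U -> V -> V) :
  (forall a, linear (fun u => F u a)) -> linear (fun u => ltr (F u)).
Proof. by move=> lF; apply: lin_sumf => i; apply: lin_coord. Qed.

End Trace.

Section Integrals.
Context (k : fieldType) (H : hopfAlgType k).
Local Notation K := (hdual H).
Local Notation S := (@antipode k H).
Implicit Types (a b x y : H) (f g lam : K).

(** As [lam] ranges over the dual algebra, these are its left integrals:
    [f * lam = f(1) lam]. *)
Definition lcoint lam :=
  forall y, tlift (fun y1 y2 => (hev lam y2 : k) *: y1) (comul y) = (hev lam y : k) *: 1.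

Definition s2r (phi : K) a := tlift (fun a1 a2 => (hev phi a2 : k) *: S (S a1)) (comul a).
Definition lhit f a := tlift (fun a1 a2 => (hev f a1 : k) *: a2) (comul a).

Fact lin_s2r phi : linear (s2r phi). Proof. by rewrite /s2r; lin. Qed.
Fact lin_lhit f : linear (lhit f). Proof. by rewrite /lhit; lin. Qed.

Fact trint_lin phi : linear (fun y => ltr (fun a => y * s2r phi a)).
Proof. by apply: lin_ltr => a; lin. Qed.

(** The twisted trace [y |-> Tr (a |-> sum y S^2(a1) phi(a2))]; for the counit [phi]
    it is the trace of the product by [y] composed with [S^2]. *)
Definition trint phi : K := lfn (trint_lin phi).

Lemma trintE phi y : hev (trint phi) y = ltr (fun a => y * s2r phi a).
Proof. exact: lfnE. Qed.

Lemma sw_S2 (W : vectType k) (B : H -> H -> W) a : bilin B ->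
  tlift B (comul (S (S a))) = tlift (fun x y => B (S (S x)) (S (S y))) (comul a).
Proof.
move=> bB; rewrite sw_antipode // sw_antipode //; split=> ?; lin.
Qed.

(** [lhit] is a right action of the dual, so that this is the action of [u * S v]. *)
Lemma lhit_hit f a : tlift (fun u v : K => lhit (antipode v) (lhit u a)) (comul f) = (hev f 1 : k) *: a.
Proof.
transitivity (tlift (fun a1 a2 => tlift (fun x y : H => (hev f (x * S y) : k) *: a2) (comul a1)) (comul a)).
  rewrite (sweedler3 (T := fun x y z => (hev f (x * S y) : k) *: z)); try by move=> *; lin.
  transitivity (tlift (fun u v : K => tlift (fun a1 a2 => tlift (fun x y : H =>
     (hev u a1 * hev v (S x) : k) *: y) (comul a2)) (comul a)) (comul f)).
    apply: eq_tlift => u v; rewrite {2}/lhit (tlift_lin _ _ (lin_lhit _)).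
    apply: eq_tlift => a1 a2; rewrite (linZ _ _ (lin_lhit _)) -tliftZ.
    by apply: eq_tlift => x y; rewrite hev_antipode scalerA.
  rewrite exchange_tlift; apply: eq_tlift => a1 a2; rewrite exchange_tlift.
  apply: eq_tlift => x y; rewrite -sw_hdual.
  by rewrite (tlift_lin (L := fun z : k^o => z *: y)) //; lin.
under eq_tlift => a1 a2.
  rewrite (sw_antipoder (F := fun z => (hev f z : k) *: a2)); last by lin.
  over.
by rewrite (sw_counitl (F := fun a => (hev f 1 : k) *: a)) //; lin.
Qed.

(** Test the identity against a functional [f], of coproduct [u (x) v]. Then
    [f(y1) Tr (a |-> y2 s2r phi a)] is the trace of [a |-> u.(y s2r phi (S(v).a))], where
    the dot is [lhit]; by cyclicity the two actions come together, and reduce to the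
    factor [f 1] by [lhit_hit]. *)
Lemma lcoint_trint phi : lcoint (trint phi).
Proof.
move=> y; apply: hev_sep => f.
rewrite (tlift_lin (L := hev f)); last by lin.
transitivity (ltr (fun a => tlift (fun y1 y2 => (hev f y1 : k) *: (y2 * s2r phi a)) (comul y))).
  rewrite ltr_tlift; apply: eq_tlift => y1 y2; rewrite ltrZ linZ; last by lin.
  by rewrite -trintE; exact: mulrC.
transitivity (ltr (fun a => tlift (fun u v : K =>
    lhit u (y * s2r phi (lhit (antipode v) a))) (comul f))).
  apply: eq_ltr => a.
  have lh u : linear (lhit u) by exact: lin_lhit.
  have ls : linear (s2r phi) by exact: lin_s2r.
  transitivity (tlift (fun y1 y2 => tlift (fun a1 a2 => tlift (fun p q => tlift (fun c d =>
     (hev f (y1 * (S (S c) * S a1)) * hev phi q : k) *: (y2 * S (S d))) (comul p))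
     (comul a2)) (comul a)) (comul y)); last first.
    symmetry; rewrite /lhit.
    transitivity (tlift (fun u v : K => tlift (fun a1 a2 => tlift (fun p q =>
       (hev v (S a1) * hev phi q : k) *: lhit u (y * S (S p))) (comul a2)) (comul a)) (comul f)).
      apply: eq_tlift => u v; rewrite -/(lhit u _).
      rewrite (tlift_lin (L := fun z => lhit u (y * s2r phi z))); last by lin.
      apply: eq_tlift => a1 a2; rewrite (linZ (f := fun z => lhit u (y * s2r phi z))); last by lin.
      rewrite /s2r (tlift_lin (L := fun z => lhit u (y * z))); last by lin.
      rewrite -tliftZ; apply: eq_tlift => p q.
      by rewrite (linZ (f := fun z => lhit u (y * z))) ?hev_antipode ?scalerA //; lin.
    transitivity (tlift (fun a1 a2 => tlift (fun p q => tlift (fun y1 y2 => tlift (fun c d =>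
       (hev f (y1 * (S (S c) * S a1)) * hev phi q : k) *: (y2 * S (S d))) (comul p))
       (comul y)) (comul a2)) (comul a)); last first.
      rewrite [RHS]exchange_tlift; apply: eq_tlift => a1 a2.
      by rewrite [RHS]exchange_tlift.
    rewrite exchange_tlift; apply: eq_tlift => a1 a2; rewrite exchange_tlift.
    apply: eq_tlift => p q.
    under eq_tlift => u v.
      rewrite /lhit sw_mul; last by bil.
      under eq_tlift => y1 y2.
        rewrite sw_S2; last by bil.
        over.
      rewrite -tliftZ; under eq_tlift => y1 y2 do rewrite -tliftZ.
      over.
    rewrite exchange_tlift; apply: eq_tlift => y1 y2; rewrite exchange_tlift.
    apply: eq_tlift => c d.
    have -> : hev f (y1 * (S (S c) * S a1)) =
        tlift (fun u v : K => (hev u (y1 * S (S c)) * hev v (S a1) : k^o)) (comul f).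
      by rewrite sw_hdual mulrA.
    rewrite (tlift_lin (L := fun z : k^o => (z * hev phi q : k) *: (y2 * S (S d)))); last by lin.
    by apply: eq_tlift => u v; rewrite !scalerA mulrC mulrA.
  apply: eq_tlift => y1 y2; symmetry.
  pose G a1 c d q := (hev f (y1 * (S (S c) * S a1)) * hev phi q : k) *: (y2 * S (S d)).
  rewrite -(sweedler3 (T := fun a1 p q => tlift (fun c d => G a1 c d q) (comul p)));
    try by move=> *; rewrite /G; lin.
  transitivity (tlift (fun r q => (hev f y1 * hev phi q : k) *: (y2 * S (S r))) (comul a)).
    apply: eq_tlift => r q.
    rewrite -(sweedler3 (T := fun a1 c d => G a1 c d q)); try by move=> *; rewrite /G; lin.
    rewrite -(sw_counitl (F := fun r => (hev f y1 * hev phi q : k) *: (y2 * S (S r)))); last by lin.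
    apply: eq_tlift => t d.
    transitivity (tlift (fun a1 c : H => (hev f (y1 * S (a1 * S c)) * hev phi q : k) *: (y2 * S (S d)))
      (comul t)); first by apply: eq_tlift => a1 c; rewrite antipodeM.
    rewrite (sw_antipoder (F := fun z => (hev f (y1 * S z) * hev phi q : k) *: (y2 * S (S d)))).
      by rewrite antipode1 mulr1.
    by lin.
  rewrite /s2r (tlift_lin (L := fun z => y2 * z)); last by lin.
  rewrite -tliftZ; apply: eq_tlift => r q.
  by rewrite -scalerAr scalerA.
rewrite ltr_tlift; transitivity (ltr (fun a => tlift (fun u v : K =>
    y * s2r phi (lhit (antipode v) (lhit u a))) (comul f))).
  rewrite ltr_tlift; apply: eq_tlift => u v.
  have lh w : linear (lhit w) by exact: lin_lhit.
  have ls : linear (s2r phi) by exact: lin_s2r.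
  apply: (ltr_comp (f := lhit u) (g := fun a => y * s2r phi (lhit (antipode v) a))) => //.
  by apply: lin_mulr; apply: (lin_comp ls); apply: lh.
have ls : linear (s2r phi) by exact: lin_s2r.
transitivity (ltr (fun a => (hev f 1 : k) *: (y * s2r phi a))).
  apply: eq_ltr => a; have lys : linear (fun z => y * s2r phi z) by lin.
  by rewrite -(tlift_lin _ _ lys) lhit_hit; apply: (linZ _ _ lys).
rewrite ltrZ -trintE linZ; last by lin.
exact: mulrC.
Qed.

(** If all the twisted traces were zero, the sum over a basis [b_j] with dual basis
    [c_j] of the traces of [a |-> z b_j s2r (S c_j * phi) a] would be zero. But the
    operators add up to [a |-> phi(a) z], as [S(u) S^2(p) = S(S(p) u)], and the trace of
    that one is [phi z]. *)
Lemma exists_lcoint : exists2 lam, lam <> 0 & lcoint lam.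
Proof.
apply: contrapT => h.
have t0 phi : trint phi = 0.
  apply: contrapT => n0; apply: h; exists (trint phi) => //; exact: lcoint_trint.
have /eqP : (1 : K) = 0; last by rewrite oner_eq0.
apply: hevP => z; move: 1%R => phi; rewrite [RHS]zero_lfunE.
pose n := \dim {:H}; pose b := vbasis {:H}.
transitivity (\sum_(j < n) hev (trint (antipode (hbasis j : K) * phi)) (z * b`_j)); last first.
  by apply: big1 => j _; rewrite t0; apply: zero_lfunE.
transitivity (\sum_(j < n) \sum_(i < n) coord b i (z * b`_j * s2r (antipode (hbasis j : K) * phi) b`_i));
  last by apply: eq_bigr => j _; rewrite trintE.
have E a : \sum_(j < n) z * b`_j * s2r (antipode (hbasis j : K) * phi) a = (hev phi a : k) *: z.
  transitivity (tlift (fun p q => tlift (fun u v => (hev phi v : k) *: (z * (S u * S (S p)))) (comul q)) (comul a)).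
    rewrite /s2r; under eq_bigr => j _.
      rewrite (tlift_lin (L := fun w => z * b`_j * w)); last by lin.
      over.
    rewrite tlift_sum; apply: eq_tlift => p q.
    under eq_bigr => j _.
      rewrite hevM (tlift_lin (L := fun w : k^o => z * b`_j * ((w : k) *: S (S p)))); last by lin.
      over.
    rewrite tlift_sum; apply: eq_tlift => u v.
    rewrite [S u](coord_vbasis (memvf (S u))) mulr_suml mulr_sumr scaler_sumr.
    apply: eq_bigr => j _; rewrite hev_antipode hbasisE -/b.
    by rewrite -!scalerAr -!scalerAl -scalerAr scalerA mulrA mulrC.
  rewrite -(sweedler3 (T := fun p u v => (hev phi v : k) *: (z * (S u * S (S p)))));
    try by move=> *; lin.
  rewrite -(sw_counitl (F := fun v => (hev phi v : k) *: z)); last by lin.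
  apply: eq_tlift => r v.
  transitivity (tlift (fun p u : H => (hev phi v : k) *: (z * S (S p * u))) (comul r)).
    by apply: eq_tlift => p u; rewrite [S (S p * u)]antipodeM.
  rewrite (sw_antipodel (F := fun w => (hev phi v : k) *: (z * S w))); last by lin.
  by rewrite antipode1 mulr1.
rewrite exchange_big {1}(coord_vbasis (memvf z)) linS; last by lin.
apply: eq_bigr => i _; rewrite -linear_sum E linZ; last by lin.
by rewrite linearZ; apply: mulrC.
Qed.

End Integrals.

Section Frobenius.
Context (k : fieldType) (H : hopfAlgType k).
Local Notation K := (hdual H).
Local Notation S := (@antipode k H).
Implicit Types (a b x y : H) (f g : K).

Variable lam : K.
Hypotheses (lam0 : lam <> 0) (llam : lcoint lam).

(** Invariance of [lam] moves a coproduct from one factor to the other, at the cost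
    of an antipode. *)
Lemma lcoint_shift a b :
  tlift (fun a1 a2 => (hev lam (b * a2) : k) *: a1) (comul a) =
  tlift (fun b1 b2 => (hev lam (b2 * a) : k) *: S b1) (comul b).
Proof.
transitivity (tlift (fun b1 c => tlift (fun b2 b3 => tlift (fun a1 a2 =>
   (hev lam (b3 * a2) : k) *: (S b1 * (b2 * a1))) (comul a)) (comul c)) (comul b)); last first.
  apply: eq_tlift => b1 c.
  transitivity (S b1 * ((hev lam (c * a) : k) *: 1)); last by rewrite -scalerAr mulr1.
  rewrite -llam sw_mul; last by bil.
  rewrite (tlift_lin (L := fun z => S b1 * z)); last by lin.
  apply: eq_tlift => b2 b3; rewrite (tlift_lin (L := fun z => S b1 * z)); last by lin.
  by apply: eq_tlift => a1 a2; rewrite -scalerAr.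
rewrite -(sweedler3 (T := fun b1 b2 b3 => tlift (fun a1 a2 =>
   (hev lam (b3 * a2) : k) *: (S b1 * (b2 * a1))) (comul a))); try by move=> *; lin.
rewrite -(sw_counitl (F := fun b => tlift (fun a1 a2 => (hev lam (b * a2) : k) *: a1) (comul a)));
  last by lin.
apply: eq_tlift => r b3.
transitivity (tlift (fun b1 b2 : H => tlift (fun a1 a2 =>
   (hev lam (b3 * a2) : k) *: (S b1 * b2 * a1)) (comul a)) (comul r)); last first.
  by apply: eq_tlift => b1 b2; apply: eq_tlift => a1 a2; rewrite mulrA.
rewrite (sw_antipodel (F := fun z => tlift (fun a1 a2 =>
   (hev lam (b3 * a2) : k) *: (z * a1)) (comul a))); last by lin.
by congr (_ *: _); apply: eq_tlift => a1 a2; rewrite mul1r.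
Qed.

Lemma lam_neq0 : exists y, hev lam y != 0.
Proof.
apply: contrapT => h; apply: lam0; apply: hevP => y; rewrite [RHS]zero_lfunE.
by apply/eqP/negP => /negP hy; apply: h; exists y.
Qed.

(** The left kernel [N] of the form [lam (a b)] is a left ideal and, by the shift
    formula, a one-sided coideal. Expanding [eps(b) = S(b1) b2] under [lam (y _)], the
    shift formula shows that [eps] vanishes on [N]; then so do all functionals. *)
Lemma lcoint_nondeg b : (forall a, hev lam (a * b) = 0) -> b = 0.
Proof.
pose N b := forall a, hev lam (a * b) = 0.
have NB b' : N b' -> forall c, tlift (fun b1 b2 => (hev lam (c * b2) : k) *: b1) (comul b') = 0.
  move=> Nb c; rewrite lcoint_shift.
  under eq_tlift => x y do rewrite Nb scale0r.
  by rewrite /tlift big1 // => i _; rewrite big1 // => j _; rewrite scaler0.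
have Neps b' : N b' -> counit b' = 0.
  move=> Nb; have [y y0] := lam_neq0.
  suff : counit b' * hev lam y = 0 :> k^o by move/eqP; rewrite mulf_eq0 (negPf y0) orbF => /eqP.
  transitivity (tlift (fun x1 x2 : H => (hev lam (y * (S x1 * x2)) : k^o)) (comul b')).
    rewrite (sw_antipodel (F := fun x => hev lam (y * x))); last by lin.
    by rewrite mulr1.
  pose n := \dim {:H}; pose e := vbasis {:H}.
  transitivity (\sum_(i < n) (coord e i
     (tlift (fun x1 x2 => (hev lam (y * S e`_i * x2) : k) *: x1) (comul b')) : k^o)).
    rewrite (eq_bigr (fun i => tlift (fun x1 x2 : H =>
      (coord e i x1 * hev lam (y * S e`_i * x2) : k^o)) (comul b'))); last first.
      move=> i _; rewrite (tlift_lin (L := coord e i : H -> k^o)); last by lin.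
      by apply: eq_tlift => x1 x2; rewrite linearZ mulrC.
    rewrite tlift_sum; apply: eq_tlift => x1 x2.
    rewrite {1}(coord_vbasis (memvf x1)) (linS (f := fun z => hev lam (y * (S z * x2)))); last by lin.
    apply: eq_bigr => i _; rewrite (linZ (f := fun z => hev lam (y * (S z * x2)))); last by lin.
    by rewrite mulrA.
  by apply: big1 => i _; rewrite NB // linear0.
move=> Nb; apply: hev_sep => f.
transitivity (counit (lhit f b) : k^o).
  rewrite /lhit (tlift_lin (L := @counit k H : H -> k^o)); last by lin.
  rewrite -(sw_counitr (F := hev f) b); last by lin.
  by apply: eq_tlift => x1 x2; rewrite linearZ; apply: mulrC.
rewrite [RHS]linear0; apply: Neps => a.
rewrite /lhit (tlift_lin (L := fun z => hev lam (a * z))); last by lin.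
transitivity (hev f (tlift (fun b1 b2 => (hev lam (a * b2) : k) *: b1) (comul b))).
  rewrite (tlift_lin (L := hev f)); last by lin.
  apply: eq_tlift => x1 x2; rewrite -scalerAr (linZ (f := hev lam)); last by lin.
  by rewrite (linZ (f := hev f)); [apply: mulrC | lin].
by rewrite NB // lin0 //; lin.
Qed.

Fact frob_lin b : linear (fun a => hev lam (a * b)). Proof. by lin. Qed.
Definition frob b : K := lfn (frob_lin b).
Lemma frobE b a : hev (frob b) a = hev lam (a * b). Proof. exact: lfnE. Qed.
Fact frob_linear : linear frob.
Proof.
by move=> c x y; apply: hevP => a; rewrite frobE hevD hevZ !frobE mulrDr -scalerAr; apply: (lin_hevr lam (lin_id (U := H))).
Qed.

Lemma frob_surj f : exists b, forall a, hev f a = hev lam (a * b).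
Proof.
have [|x fx] := @inj_surj_dim _ _ _ (lfn frob_linear) (esym (dim_hdual H)) _ f.
  move=> b; rewrite lfnE => b0; apply: lcoint_nondeg => a.
  by rewrite -frobE b0; apply: zero_lfunE.
by exists x => a; rewrite -fx lfnE frobE.
Qed.

Lemma lcoint_nondegr a : (forall b, hev lam (a * b) = 0) -> a = 0.
Proof.
move=> h; apply: hev_sep => f; have [b ->] := frob_surj f.
by rewrite h lin0 //; lin.
Qed.

Fact frobr_lin a : linear (fun b => hev lam (a * b)). Proof. by lin. Qed.
Definition frobr a : K := lfn (frobr_lin a).
Lemma frobrE a b : hev (frobr a) b = hev lam (a * b). Proof. exact: lfnE. Qed.
Fact frobr_linear : linear frobr.
Proof.
by move=> c x y; apply: hevP => a; rewrite frobrE hevD hevZ !frobrE mulrDl -scalerAl; apply: (lin_hevr lam (lin_id (U := H))).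
Qed.

Lemma frobr_surj f : exists a, forall b, hev f b = hev lam (a * b).
Proof.
have [|x fx] := @inj_surj_dim _ _ _ (lfn frobr_linear) (esym (dim_hdual H)) _ f.
  move=> a; rewrite lfnE => a0; apply: lcoint_nondegr => b.
  by rewrite -frobrE a0; apply: zero_lfunE.
by exists x => a; rewrite -fx lfnE frobrE.
Qed.

(** An integral of [H] represents the counit for the form [lam (a b)]. *)
Lemma exists_lint : exists2 L, forall b, hev lam (b * L) = counit b &
  forall h, h * L = counit h *: L.
Proof.
have [L LE] := frob_surj (1 : K); exists L => [b|h]; first by rewrite -LE hev1.
apply/eqP; rewrite -subr_eq0; apply/eqP/lcoint_nondeg => a.
by rewrite mulrBr mulrA -scalerAr hevBr hevZr -!LE !hev1 counitM mulrC subrr.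
Qed.

Lemma exists_rint : exists2 L, forall b, hev lam (L * b) = counit b &
  forall h, L * h = counit h *: L.
Proof.
have [L LE] := frobr_surj (1 : K); exists L => [b|h]; first by rewrite -LE hev1.
apply/eqP; rewrite -subr_eq0; apply/eqP/lcoint_nondegr => a.
by rewrite mulrBl -mulrA -scalerAl hevBr hevZr -!LE !hev1 counitM mulrC subrr.
Qed.

Lemma lint_unique L x : (forall b, hev lam (b * L) = counit b) ->
  (forall h, h * x = counit h *: x) -> x = (hev lam x : k) *: L.
Proof.
move=> LE xint; apply/eqP; rewrite -subr_eq0; apply/eqP/lcoint_nondeg => a.
by rewrite mulrBr xint -scalerAr hevBr !hevZr LE mulrC subrr.
Qed.

(** The shift formula at a right integral writes [a] as an image of the antipode. *)
Lemma antipode_surj a : exists b, S b = a.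
Proof.
have [L LE _] := exists_rint.
exists (tlift (fun b1 b2 => (hev lam (b2 * a) : k) *: b1) (comul L)).
rewrite (tlift_lin (L := S)); last by lin.
transitivity (tlift (fun b1 b2 => (hev lam (b2 * a) : k) *: S b1) (comul L)).
  by apply: eq_tlift => x y; rewrite linearZ.
rewrite -lcoint_shift -[RHS](sw_counitr (F := fun x => x)); last by lin.
by apply: eq_tlift => x y; rewrite LE.
Qed.

Lemma antipode_inj a : S a = 0 -> a = 0.
Proof.
have lS : linear S by lin.
rewrite -(lfnE lS); apply: surj_inj_dim => // y.
by have [b <-] := antipode_surj y; exists b; rewrite lfnE.
Qed.

(** Write [mu = lam (b _)]. The shift formula for [lam] and the invariance of [mu] show
    that the coproduct of [b] is [1 (x) b], so that [b] is a scalar. *)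
Lemma lcoint_unique mu : lcoint mu -> exists c, mu = c *: lam.
Proof.
move=> lmu; have [b bE] := frobr_surj mu; exists (counit b).
suff -> : mu = frobr (counit b *: 1).
  by apply: hevP => a; rewrite frobrE hevZ -scalerAl mul1r linZ //; lin.
apply: hevP => a; rewrite bE frobrE; congr (hev lam (_ * a)).
apply: hev_sep => f.
have [Sinv SK] : exists g : 'End(H), forall x, g (S x) = x.
  have lS : linear S by lin.
  exists ((lfn lS)^-1)%VF => x; rewrite -(lfnE lS) lker0_lfunK //.
  by apply/eqP/lker0_inj => y; rewrite lfnE; apply: antipode_inj.
suff: tlift (fun b1 b2 => (hev f b1 : k) *: b2) (comul b) = (hev f 1 : k) *: b.
  move/(congr1 (@counit k H : H -> k)); rewrite [RHS]linearZ /=.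
  rewrite (tlift_lin (L := @counit k H : H -> k^o)); last by lin.
  under eq_tlift => x y do rewrite linearZ.
  move=> e; rewrite linZ; last by lin.
  rewrite [RHS]mulrC -e -(sw_counitr (F := hev f) b); last by lin.
  by apply: eq_tlift => x y; apply: mulrC.
apply/eqP; rewrite -subr_eq0; apply/eqP/lcoint_nondegr => a'.
rewrite mulrBl -scalerAl hevBr hevZr; apply/eqP; rewrite subr_eq0; apply/eqP.
have lg : linear (fun z : H => hev f (Sinv z)) by lin.
have /(congr1 (lfn lg)) := lcoint_shift a' b.
under eq_tlift => x y do rewrite -bE.
rewrite lmu linearZ /= lfnE -[X in Sinv X](antipode1 H) SK bE.
rewrite (tlift_lin (L := lfn lg)); last by lin.
move=> e; rewrite (tlift_lin (L := fun z => hev lam (z * a'))); last by lin.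
rewrite [RHS]mulrC [RHS]e; apply: eq_tlift => x y.
by rewrite -scalerAl hevZr linearZ /= lfnE SK; apply: mulrC.
Qed.

End Frobenius.

Section Radford.
Context (k : fieldType) (H : hopfAlgType k).
Local Notation K := (hdual H).
Local Notation S := (@antipode k H).
Implicit Types (a b x y : H) (f g : K).

Lemma antipode_bij : exists Sinv : 'End(H), (forall x, Sinv (S x) = x) /\ (forall x, S (Sinv x) = x).
Proof.
have [lam lam0 llam] := exists_lcoint H.
have lS : linear S by lin.
have SK x : (lfn lS)^-1%VF (S x) = x.
  rewrite -(lfnE lS) lker0_lfunK //; apply/eqP/lker0_inj => y; rewrite lfnE.
  exact: antipode_inj llam _.
exists (lfn lS)^-1%VF; split=> // x.
by have [y <-] := antipode_surj lam0 llam x; rewrite SK.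
Qed.

(** The modular element. Each [lam * f] is again an integral, hence proportional to
    [lam]; the factor is multiplicative in [f], and so is given by a group-like [g]. *)
Lemma modular_elt lam : lam <> 0 -> lcoint lam ->
  exists g : H, [/\ comul g = pure g g, counit g = 1 &
    forall y, tlift (fun y1 y2 => (hev lam y1 : k) *: y2) (comul y) = (hev lam y : k) *: g].
Proof.
move=> lam0 llam.
have lf f : lcoint (lam * f).
  move=> y; rewrite hevM.
  transitivity (tlift (fun y1 y2 => tlift (fun u v => (hev lam u * hev f v : k) *: y1) (comul y2)) (comul y)).
    apply: eq_tlift => y1 y2; rewrite hevM.
    by rewrite (tlift_lin (L := fun z : k^o => (z : k) *: y1)) //; lin.
  rewrite -(sweedler3 (T := fun y1 u v => (hev lam u * hev f v : k) *: y1)); try by move=> *; lin.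
  rewrite (tlift_lin (L := fun z : k^o => (z : k) *: (1 : H))); last by lin.
  apply: eq_tlift => x v.
  transitivity ((hev f v : k) *: tlift (fun y1 u => (hev lam u : k) *: y1) (comul x)).
    by rewrite -tliftZ; apply: eq_tlift => y1 u; rewrite scalerA mulrC.
  by rewrite llam scalerA mulrC.
have [y0 ly0] : exists y0, hev lam y0 = 1.
  have [y yn] := lam_neq0 lam0; exists ((hev lam y : k)^-1 *: y).
  rewrite linZ; last by lin.
  exact: mulVf yn.
pose g := tlift (fun y1 y2 => (hev lam y1 : k) *: y2) (comul y0).
have gE f : hev f g = hev (lam * f) y0.
  rewrite hevM /g (tlift_lin (L := hev f)); last by lin.
  by apply: eq_tlift => y1 y2; rewrite linZ //; lin.
have lamM f : lam * f = (hev f g : k) *: lam.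
  have [c ec] := lcoint_unique lam0 llam (lf f).
  by rewrite gE ec hevZ ly0 mulr1.
have gM f h : hev (f * h) g = hev f g * hev h g.
  have := congr1 (fun f : K => hev f y0) (lamM (f * h)).
  rewrite mulrA lamM -scalerAl lamM scalerA !hevZ ly0 !mulr1; exact: esym.
exists g; split.
- apply: tens_sep => f h; rewrite -hevM gM tlift_pure //; bil.
- by rewrite -hev1 gE mulr1.
move=> y; apply: hev_sep => f; rewrite linZ; last by lin.
rewrite [RHS]mulrC -hevZ -lamM hevM (tlift_lin (L := hev f)); last by lin.
by apply: eq_tlift => y1 y2; rewrite linZ //; lin.
Qed.

(** The modular character: by uniqueness of left integrals, [L h] is a multiple of [L]. *)
Lemma modular_char lam L : lam <> 0 -> lcoint lam -> (forall b, hev lam (b * L) = counit b) ->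
    (forall h, h * L = counit h *: L) ->
  exists al : K, [/\ hev al 1 = 1, forall x y, hev al (x * y) = hev al x * hev al y &
    forall h, L * h = (hev al h : k) *: L].
Proof.
move=> lam0 llam LE Lint.
have lal : linear (fun h => hev lam (L * h)) by lin.
pose al : K := lfn lal.
have alE h : hev al h = hev lam (L * h) by apply: lfnE.
have Lh h : L * h = (hev al h : k) *: L.
  rewrite alE; apply: (lint_unique lam0 llam LE) => h'.
  by rewrite mulrA Lint -scalerAl.
exists al; split=> // [|x y]; first by rewrite alE mulr1 -[L]mul1r LE counit1.
by rewrite [LHS]alE mulrA Lh -scalerAl hevZr -alE.
Qed.

(** For a unimodular Hopf algebra, the Nakayama automorphism of [lam] is [S^2]: the
    two ways to represent a functional by [lam] are related to its action on the
    integral [L] by [S] and by [S^-1] respectively. *)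
Lemma lam_S2 lam L : lam <> 0 -> lcoint lam -> (forall b, hev lam (b * L) = counit b) ->
    (forall b, hev lam (L * b) = counit b) ->
  forall b x, hev lam (b * x) = hev lam (x * S (S b)).
Proof.
move=> lam0 llam LE LE' b x.
pose E f := tlift (fun x1 x2 => (hev f x2 : k) *: x1) (comul L).
have E1 c : E (frobr lam c) = S c.
  rewrite /E; transitivity (tlift (fun x1 x2 => (hev lam (c * x2) : k) *: x1) (comul L)).
    by apply: eq_tlift => x1 x2; rewrite frobrE.
  rewrite lcoint_shift // -[c in RHS](sw_counitr (F := fun x => x) c); last by lin.
  rewrite (tlift_lin (L := S)); last by lin.
  by apply: eq_tlift => x1 x2; rewrite LE linearZ.
have E2 c : S (E (frob lam c)) = c.
  rewrite /E (tlift_lin (L := S)); last by lin.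
  transitivity (tlift (fun x1 x2 => (hev lam (x2 * c) : k) *: S x1) (comul L)).
    by apply: eq_tlift => x1 x2; rewrite linearZ frobE.
  rewrite -lcoint_shift // -[RHS](sw_counitr (F := fun x => x)); last by lin.
  by apply: eq_tlift => x1 x2; rewrite LE'.
have Einj f : E f = 0 -> f = 0.
  have [c cE] := frobr_surj lam0 llam f.
  have -> : f = frobr lam c by apply: hevP => a; rewrite cE frobrE.
  rewrite E1 => /(antipode_inj lam0 llam) ->.
  by apply: hevP => a; rewrite frobrE mul0r lin0; [rewrite [RHS]zero_lfunE | lin].
have lE : linear E by rewrite /E; lin.
suff: frobr lam b = frob lam (S (S b)) by move/(congr1 (fun f : K => hev f x)); rewrite frobE frobrE.
apply/eqP; rewrite -subr_eq0; apply/eqP/Einj.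
apply: (antipode_inj lam0 llam).
rewrite -scaleN1r linD // linZ // scaleN1r linearB /=.
by rewrite E1 E2 subrr.
Qed.

(** Radford's formula for [S^4] in the unimodular case: the form [lam (a b)] changes
    by [S^2] when its arguments are exchanged, by [lam_S2], and by a scalar [c] when
    [S] is applied to their product. *)
Lemma antipode4 lam L : lam <> 0 -> lcoint lam ->
    (forall y, tlift (fun y1 y2 => (hev lam y1 : k) *: y2) (comul y) = (hev lam y : k) *: 1) ->
    (forall b, hev lam (b * L) = counit b) -> (forall b, hev lam (L * b) = counit b) ->
  forall a, S (S (S (S a))) = a.
Proof.
move=> lam0 llam rlam LE LE' a.
have S2 := lam_S2 lam0 llam LE LE'.
have lS : lcoint (antipode lam : K).
  move=> y; have Si := antipode_inj lam0 llam.
  apply/eqP; rewrite -subr_eq0; apply/eqP/Si; rewrite linearB /= linearZ /= antipode1.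
  rewrite hev_antipode -rlam sw_antipode; last by bil.
  rewrite (tlift_lin (L := S)); last by lin.
  by apply/eqP; rewrite subr_eq0; apply/eqP/eq_tlift => y1 y2; rewrite linearZ hev_antipode.
have [c cE] := lcoint_unique lam0 llam lS.
have cS x : hev lam (S x) = c * hev lam x by rewrite -hev_antipode cE hevZ.
have c0 : c != 0.
  apply/eqP => c0; have [y yn] := lam_neq0 lam0; have [z zy] := antipode_surj lam0 llam y.
  by move: yn; rewrite -zy cS c0 mul0r eqxx.
apply/eqP; rewrite -subr_eq0; apply/eqP/(lcoint_nondeg lam0 llam) => b.
rewrite mulrBr -scaleN1r linD; last by lin.
rewrite linZ; last by lin.
rewrite scaleN1r; apply/eqP; rewrite subr_eq0; apply/eqP/(mulfI c0).
by rewrite -[RHS]cS antipodeM S2 -antipodeM cS S2.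
Qed.

(** Maschke's theorem: averaging a projector over an integral of augmentation 1. *)
Lemma maschke (L : H) : (forall h, h * L = counit h *: L) -> counit L = 1 ->
  semisimple_alg H.
Proof.
move=> Lint L1 U sU; pose X := regular_mod H.
pose P := fun x : X => tlift (fun a b => act X a (projv U (act X (S b) x))) (comul L).
have lP : linear P by rewrite /P; lin.
have PU x : P x \in U.
  rewrite /P /tlift; apply: memv_suml => i _; apply: memv_suml => j _; apply: memvZ.
  by apply: (submodP U).1 => //; apply: memv_proj.
have Pid x : x \in U -> P x = x.
  move=> xU; transitivity (tlift (fun a b => act X (a * S b) x) (comul L)).
    apply: eq_tlift => a b; rewrite projv_id ?act_mul //.
    exact: (submodP U).1.
  by rewrite (sw_antipoder (F := fun a => act X a x)) ?L1 ?scale1r ?act_one //; lin.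
have hP h x : P (act X h x) = act X h (P x).
  pose F (h1 h2 : H) (u : tens H H) : X := tlift (fun a b => act X a (projv U (act X (S b * h2) x))) u.
  transitivity (tlift (fun h1 h2 : H => F h1 h2 (comul (h1 * L))) (comul h)).
    rewrite -[in LHS](sw_counitl (F := fun h => P (act X h x)) h); last by lin.
    apply: eq_tlift => h1 h2; rewrite /F Lint linearZ (linZ _ _ (tlift_linear _)).
    by congr (_ *: _); apply: eq_tlift => a b; rewrite act_mul.
  transitivity (tlift (fun h1 h2 => tlift (fun c d => tlift (fun a b =>
      act X (c * a) (projv U (act X (S b * (S d * h2)) x))) (comul L)) (comul h1)) (comul h)).
    apply: eq_tlift => h1 h2; rewrite /F sw_mul; last by bil.
    apply: eq_tlift => c d; apply: eq_tlift => a b.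
    by rewrite antipodeM mulrA.
  rewrite (sweedler3 (T := fun c d h2 => tlift (fun a b =>
      act X (c * a) (projv U (act X (S b * (S d * h2)) x))) (comul L))); try by move=> *; lin.
  transitivity (tlift (fun c d : H => counit d *: act X c (P x)) (comul h)).
    apply: eq_tlift => c d.
    rewrite (sw_antipodel (F := fun z => tlift (fun a b =>
      act X (c * a) (projv U (act X (S b * z) x))) (comul L))); last by lin.
    congr (_ *: _); rewrite /P (tlift_lin (L := act X c)); last by lin.
    by apply: eq_tlift => a b; rewrite mulr1 act_mul.
  by rewrite (sw_counitr (F := fun c => act X c (P x))) //; lin.
have kU : (lker (lfn lP) :&: U = 0)%VS.
  apply/eqP; rewrite -subv0; apply/subvP => x; rewrite memv_cap memv_ker memv0 lfnE.
  by case/andP => /eqP Px xU; rewrite -(Pid x xU) Px.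
exists (lker (lfn lP)); split; last by rewrite capvC.
  by apply: submod_ker => h x; rewrite [LHS](lfnE lP) (lfnE lP); apply: hP.
apply/eqP; rewrite eqEsubv subvf; apply/subvP => x _; apply/memv_addP.
exists (P x) => //; exists (x - P x); last by rewrite addrC subrK.
by rewrite memv_ker linearB /= !(lfnE lP) [P (P x)](Pid _ (PU x)) subrr.
Qed.

(** The functional [x |-> Tr (L_x S^2)] is an integral [lam] by [lcoint_trint]. Were it
    nonzero, there would be a right integral [R] with [lam (R b) = eps(b)]; then [L_R S^2]
    is [eps(-) R], of trace [eps(R)], so that [eps(R) = lam(R) = 1]. Left integrals are
    multiples of [R], and Maschke's theorem applies. *)
Lemma trace_S2 : ~ semisimple_alg H -> forall x, ltr (fun a => x * S (S a)) = 0.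
Proof.
move=> nss x; have sE a : s2r (1 : K) a = S (S a).
  rewrite /s2r; under eq_tlift => u v do rewrite hev1.
  by rewrite (sw_counitr (F := fun u => S (S u))) //; lin.
have tE y : hev (trint (1 : K)) y = ltr (fun a => y * S (S a)).
  by rewrite trintE; apply: eq_ltr => a; rewrite sE.
have [t0|tn] := EM (trint (1 : K) = 0); first by rewrite -tE t0; apply: zero_lfunE.
case: nss; have tl := lcoint_trint (1 : K).
have [L LE Lint] := exists_lint tn tl; have [R RE Rint] := exists_rint tn tl.
have R1 : counit R = 1.
  have := RE 1; rewrite mulr1 counit1 tE => <-.
  have lc : linear (@counit k H : H -> k^o) by lin.
  transitivity (ltr (fun a => counit a *: R)); last first.
    by apply: eq_ltr => a; rewrite Rint !counit_antipode.
  rewrite [in LHS](coord_vbasis (memvf R)) (linS (f := @counit k H : H -> k^o)) //.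
  apply: eq_bigr => i _; rewrite linearZ linearZ; exact: mulrC.
have LR : L = counit L *: R by rewrite -Rint Lint R1 scale1r.
have L0 : counit L != 0.
  apply/eqP => l0; have := LE 1; rewrite LR l0 scale0r mulr0 hev0r counit1 => /eqP.
  by rewrite eq_sym oner_eq0.
apply: (maschke (L := (counit L)^-1 *: L)) => [h|].
  by rewrite -scalerAr Lint !scalerA mulrC.
by rewrite linearZ; apply: mulVf.
Qed.

End Radford.

(** * Divisibility of dimensions for a sub-Hopf algebra *)

Section InverseAntipode.
Context (k : fieldType) (H : hopfAlgType k).
Local Notation S := (@antipode k H).
Implicit Types V W Y : amod H.
Local Notation reg := (regular_mod H).

Lemma sw_antipodeVl (Sinv : 'End(H)) (W : vectType k) (F : H -> W) a :
    (forall x, Sinv (S x) = x) -> (forall x, S (Sinv x) = x) -> linear F ->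
  tlift (fun x y => F (Sinv y * x)) (comul a) = counit a *: F 1.
Proof.
move=> SK KS lF; transitivity (tlift (fun x y : H => F (Sinv (S x * y))) (comul a)).
  by apply: eq_tlift => x y; rewrite -{2}(KS y) -antipodeM SK.
rewrite (sw_antipodel (F := fun z => F (Sinv z))); last by lin.
by rewrite -{1}(antipode1 H) SK.
Qed.

(** The inverse antipode untwists the diagonal action on [V (x) H], as the antipode
    does for [H (x) V]. *)
Lemma reg_tensr_inj V (a : H) (v : V) :
  act (tmod V reg) a (pure v (1 : H)) = 0 -> a = 0 \/ v = 0.
Proof.
have [Sinv [SK KS]] := antipode_bij H.
pose psi := tlift (fun (v : V) (a : H) =>
  tlift (fun x y : H => pure y (act V (Sinv x) v)) (comul a)).
have lpsi : linear psi by apply: tlift_linear.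
have psiE : psi (act (tmod V reg) a (pure v (1 : H))) = pure a v.
  rewrite act_tmod (tlift_lin _ _ lpsi).
  transitivity (tlift (fun x y : H => tlift (fun y1 y2 : H =>
      pure y2 (act V (Sinv y1 * x) v)) (comul y)) (comul a)).
    apply: eq_tlift => x y; rewrite act_reg mulr1 /psi tlift_pure; last by bil.
    by apply: eq_tlift => y1 y2; rewrite act_mul.
  rewrite -(sweedler3 (T := fun x y1 y2 => pure y2 (act V (Sinv y1 * x) v))); try by move=> *; lin.
  under eq_tlift => x y.
    rewrite (sw_antipodeVl (F := fun z => pure y (act V z v)) _ SK KS); last by lin.
    rewrite act_one; over.
  by rewrite (sw_counitl (F := fun y => pure y v)) //; lin.
move=> e; move: psiE; rewrite e lin0 // => /esym p0.
have [->|a0] := eqVneq a 0; [by left|right].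
have [f fa] : exists f : hdual H, hev f a != 0.
  apply: contrapT => h; move/negP: a0; apply; apply/eqP/hev_sep => f; rewrite hev0r.
  by apply/eqP/negP => /negP fa; apply: h; exists f.
have := congr1 (tlift (fun (a : H) (v : V) => (hev f a : k) *: v)) p0.
rewrite tlift_pure; last by bil.
by rewrite lin0; [move/eqP; rewrite scaler_eq0 (negPf fa) => /eqP | exact: tlift_linear].
Qed.

End InverseAntipode.

Section Frames.
Context (k : fieldType) (A : hopfAlgType k).
Local Notation S := (@antipode k A).
Implicit Types V Y : amod A.

Fact frame_lin V (W : vectType k) (j : 'Hom(W, V)) :
  linear (tlift (fun (a : A) w => act V a (j w)) : tens A W -> V).
Proof. exact: tlift_linear. Qed.

(** Surjective when [j] maps [W] onto a generating space of [V], bijective when [V]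
    is moreover free on it. *)
Definition framef V (W : vectType k) (j : 'Hom(W, V)) : 'Hom(tens A W, V) := lfn (frame_lin j).

Lemma framef_pure V (W : vectType k) (j : 'Hom(W, V)) a w :
  framef j (pure a w) = act V a (j w).
Proof. rewrite [LHS]lfnE tlift_pure //; bil. Qed.

Lemma framef_act V (W : vectType k) (j : 'Hom(W, V)) a t :
  framef j (tmapf (amull a) (\1 : 'End(W)) t) = act V a (framef j t).
Proof.
move: t; apply: tens_ext; [lin | lin |] => b w.
have -> : tmapf (amull a) (\1 : 'End(W)) (pure b w) = pure (a * b) w.
  by rewrite tmapf_pure id_lfunE lfunE.
by rewrite !framef_pure act_mul.
Qed.

Lemma limg_tmapf_id (U V W : vectType k) (f : 'Hom(U, V)) :
  limg f = fullv -> limg (tmapf f (\1 : 'End(W))) = fullv.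
Proof.
case/limgf_right_inv => g fg; apply: (right_inv_limgf (g := tmapf g \1)).
by rewrite tmapf_comp fg comp_lfun1l tmapf_id.
Qed.

Lemma limg_tmapfr_id (U V W : vectType k) (f : 'Hom(U, V)) :
  limg f = fullv -> limg (tmapf (\1 : 'End(W)) f) = fullv.
Proof.
case/limgf_right_inv => g fg; apply: (right_inv_limgf (g := tmapf \1 g)).
by rewrite tmapf_comp fg comp_lfun1l tmapf_id.
Qed.

Lemma limg_factor (U V W : vectType k) (f : 'Hom(U, W)) (g : 'Hom(V, W)) (h : U -> V) :
  limg f = fullv -> (forall x, g (h x) = f x) -> limg g = fullv.
Proof.
move=> fs gh; apply: limg_full_surj => y.
have /memv_imgP[x _ ->] : y \in limg f by rewrite fs memvf.
by exists (h x).
Qed.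

(** A generating space of [V] gives one of [V (x) Y] and of [Y (x) V]: the diagonal
    action can be untwisted before tensoring, with the antipode or its inverse. *)
Lemma frame_tmodl V Y (W : vectType k) (j : 'Hom(W, V)) : limg (framef j) = fullv ->
  limg (@framef (tmod V Y) (tens W Y) (tmapf j (\1 : 'End(Y)))) = fullv.
Proof.
move=> fs.
pose G : tens (tens A W) Y -> tens A (tens W Y) := tlift (fun s y => tlift (fun a w =>
  tlift (fun x z : A => pure x (pure w (act Y (S z) y))) (comul a)) s).
have lG : linear G by apply: tlift_linear.
apply: (limg_factor (h := G) (limg_tmapf_id Y fs)) => t; move: t.
apply: tens_ext; [lin | lin |] => s y; move: s; apply: tens_ext; [lin | lin |] => a w.
rewrite /G tmapf_pure tlift_pure; last by bil.
rewrite tlift_pure; last by bil.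
rewrite (tlift_lin (L := @framef (tmod V Y) _ (tmapf j (\1 : 'End(Y))))); last by lin.
rewrite id_lfunE [framef j _]framef_pure.
transitivity (tlift (fun x z : A => tlift (fun x1 x2 : A =>
   pure (act V x1 (j w)) (act Y (x2 * S z) y)) (comul x)) (comul a)).
  apply: eq_tlift => x z; rewrite framef_pure tmapf_pure id_lfunE act_tmod.
  by apply: eq_tlift => x1 x2; rewrite act_mul.
rewrite (sweedler3 (T := fun x1 x2 z => pure (act V x1 (j w)) (act Y (x2 * S z) y))); try by move=> *; lin.
under eq_tlift => x1 x.
  rewrite (sw_antipoder (F := fun z => pure (act V x1 (j w)) (act Y z y))); last by lin.
  rewrite act_one; over.
by rewrite (sw_counitr (F := fun x => pure (act V x (j w)) y)) //; lin.
Qed.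

Lemma frame_tmodr V Y (W : vectType k) (j : 'Hom(W, V)) : limg (framef j) = fullv ->
  limg (@framef (tmod Y V) (tens Y W) (tmapf (\1 : 'End(Y)) j)) = fullv.
Proof.
have [Sinv [SK KS]] := antipode_bij A.
move=> fs.
pose G : tens Y (tens A W) -> tens A (tens Y W) := tlift (fun y s => tlift (fun a w =>
  tlift (fun x z : A => pure z (pure (act Y (Sinv x) y) w)) (comul a)) s).
have lG : linear G by apply: tlift_linear.
apply: (limg_factor (h := G) (limg_tmapfr_id Y fs)) => t; move: t.
apply: tens_ext; [lin | lin |] => y s; move: s; apply: tens_ext; [lin | lin |] => a w.
rewrite /G tmapf_pure tlift_pure; last by bil.
rewrite tlift_pure; last by bil.
rewrite (tlift_lin (L := @framef (tmod Y V) _ (tmapf (\1 : 'End(Y)) j))); last by lin.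
rewrite id_lfunE [framef j _]framef_pure.
transitivity (tlift (fun x z : A => tlift (fun z1 z2 : A =>
   pure (act Y (z1 * Sinv x) y) (act V z2 (j w))) (comul z)) (comul a)).
  apply: eq_tlift => x z; rewrite framef_pure tmapf_pure id_lfunE act_tmod.
  by apply: eq_tlift => x1 x2; rewrite act_mul.
rewrite -(sweedler3 (T := fun x z1 z2 => pure (act Y (z1 * Sinv x) y) (act V z2 (j w)))); try by move=> *; lin.
rewrite -(sw_counitl (F := fun x => pure y (act V x (j w)))); last by lin.
apply: eq_tlift => r z.
transitivity (tlift (fun x z1 : A => pure (act Y (Sinv (x * S z1)) y) (act V z (j w))) (comul r)).
  apply: eq_tlift => x z1; congr (pure (act Y _ y) _).
  by rewrite -[LHS]SK antipodeM KS.
rewrite (sw_antipoder (F := fun u => pure (act Y (Sinv u) y) (act V z (j w)))); last by lin.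
by rewrite -[X in Sinv X](antipode1 A) SK act_one.
Qed.

(** Counting dimensions, the module is free on [W], and then everything happens in
    copies of [A], where the image of a left integral [L] is its line, and the only
    invariants are on that line. *)
Lemma frame_free V (W : vectType k) (j : 'Hom(W, V)) (L : A) : limg (framef j) = fullv ->
    \dim {:V} = (\dim {:A} * \dim {:W})%N -> L != 0 -> (forall h, h * L = counit h *: L) ->
    (forall x, (forall h, h * x = counit h *: x) -> exists c, x = c *: L) ->
  rk L V = \dim {:W} /\
  forall v, (forall a, act V a v = counit a *: v) -> v \in limg (act V L).
Proof.
move=> fs dV L0 Lint Luniq.
have fI t : framef j t = 0 -> t = 0.
  apply: surj_inj_dim; first by rewrite dim_tens dV.
  move=> y; have /memv_imgP[x _ ->] : y \in limg (framef j) by rewrite fs memvf.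
  by exists x.
have LA : limg (amull L) = <[L]>%VS.
  apply/vspaceP => x; apply/memv_imgP/vlineP => [[y _ ->]|[c ->]].
    rewrite lfunE; apply: Luniq => h.
    by rewrite [h * _]mulrA Lint -scalerAl.
  by exists (c *: 1); rewrite ?memvf // lfunE /= -scalerAr mulr1.
split.
  have -> : rk L V = \dim (framef j @: limg (tmapf (amull L) (\1 : 'End(W))))%VS.
    congr (\dim _); apply/vspaceP => v; apply/memv_imgP/memv_imgP.
      case=> u _ ->; have /memv_imgP[x _ ->] : u \in limg (framef j) by rewrite fs memvf.
      by exists (tmapf (amull L) (\1 : 'End(W)) x); rewrite ?framef_act ?memv_img ?memvf.
    by case=> _ /memv_imgP[x _ ->] ->; exists (framef j x); rewrite ?memvf ?framef_act.
  rewrite limg_dim_eq ?dim_limg_tmapl ?LA ?dim_vline ?L0 ?mul1n //.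
  by apply/eqP; rewrite -subv0; apply/subvP => t; rewrite memv_cap memv_ker memv0 => /andP[_ /eqP/fI->].
move=> v vinv; have /memv_imgP[t _ vt] : v \in limg (framef j) by rewrite fs memvf.
have tinv a : tmapf (amull a) (\1 : 'End(W)) t = counit a *: t.
  apply/eqP; rewrite -subr_eq0; apply/eqP/fI.
  by rewrite linearB linearZ /= framef_act -vt vinv subrr.
pose n := \dim {:W}; pose b := vbasis {:W}.
pose C (i : 'I_n) := fun t : tens A W => tlift (fun (a : A) (w : W) => coord b i w *: a) t.
have lC i : linear (C i) by apply: tlift_linear.
have tE s : s = \sum_(i < n) pure (C i s) b`_i.
  rewrite /C; under eq_bigr => i _.
    rewrite (tlift_lin (L := fun a : A => pure a b`_i)); last by lin.
    over.
  rewrite tlift_sum -[LHS]tlift_id; apply: eq_tlift => a w.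
  rewrite {1}(coord_vbasis (memvf w)) linS; last by lin.
  apply: eq_bigr => i _; rewrite (linZ (f := fun w => pure a w)); last by lin.
  by rewrite (linZ (f := fun a => pure a b`_i)) //; lin.
have /fin_all_exists[c cE] i : exists c, C i t = c *: L.
  apply: Luniq => h; rewrite -linZ // -tinv.
  move: t {vt tinv}; apply: tens_ext; [lin | lin |] => a w.
  have -> : tmapf (amull h) (\1 : 'End(W)) (pure a w) = pure (h * a) w.
    by rewrite tmapf_pure id_lfunE lfunE.
  by rewrite /C !tlift_pure -?scalerAr //; bil.
rewrite vt (tE t) linear_sum; apply: memv_suml => i _.
rewrite cE (linZ (f := fun a => pure a b`_i)); last by lin.
rewrite linearZ /= memvZ // framef_pure memv_img ?memvf //.
Qed.

End Frames.

(** The sum of [dim W] copies of [A]. *)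
Section FreeModule.
Context (k : fieldType) (A : falgType k) (W : vectType k).

Definition free_act (a : A) : 'End(tens A W) := tmapf (amull a) (\1 : 'End(W)).

Lemma free_act_pure a b w : free_act a (pure b w) = pure (a * b) w.
Proof. by rewrite /free_act tmapf_pure id_lfunE lfunE. Qed.

Fact free_act_linear : linear free_act.
Proof.
move=> c a b; apply/lfunP; apply: tens_ext; [lin | lin |] => x w.
rewrite add_lfunE scale_lfunE !free_act_pure mulrDl -scalerAl.
by have := pure_bilin A W => -[_ ->].
Qed.

Fact free_act1 : free_act 1 = \1%VF.
Proof.
apply/lfunP; apply: tens_ext; [lin | lin |] => x w.
by rewrite free_act_pure mul1r id_lfunE.
Qed.

Fact free_actM a b : free_act (a * b) = (free_act a \o free_act b)%VF.
Proof.
apply/lfunP; apply: tens_ext; [lin | lin |] => x w.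
by rewrite comp_lfunE !free_act_pure mulrA.
Qed.

Definition free_mod : amod A := AMod free_act_linear free_act1 free_actM.

End FreeModule.

Section NicholsZoeller.
Context (k : closedFieldType) (A H : hopfAlgType k) (iota : A -> H).
Hypotheses (li : linear iota) (i1 : iota 1 = 1) (iM : forall a b, iota (a * b) = iota a * iota b).
Hypothesis iinj : forall a, iota a = 0 -> a = 0.
Hypothesis iC : forall a, comul (iota a) = tmap iota iota (comul a).

Local Notation regA := (regular_mod A).
Local Notation regH := (regular_mod H).
Local Notation M := (res li i1 iM regH).

Lemma res_tmod (V W : amod H) a :
  act (tmod (res li i1 iM V) (res li i1 iM W)) a = act (tmod V W) (iota a).
Proof.
apply: lfun_tens_ext => v w.
by rewrite act_tmod [RHS](@act_tmod k H V W) iC tlift_tmap //; bil.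
Qed.

Lemma rk_MM a : rk a (tmod M M) = (rk a M * \dim {:H})%N.
Proof. by rewrite /rk res_tmod -/(rk (iota a) (tmod regH regH)) rk_reg_tmod. Qed.

Lemma act_M a (x : H) : act M a x = iota a * x.
Proof. by rewrite -act_reg. Qed.

Lemma rk_reg_gt0 (B : falgType k) (e : B) : e != 0 -> (0 < rk e (regular_mod B))%N.
Proof.
move=> e0; rewrite lt0n dimv_eq0; apply: contra e0 => /eqP i0.
have : act (regular_mod B) e 1 \in limg (act (regular_mod B) e) by rewrite memv_img ?memvf.
by rewrite i0 memv0 /= lfunE /= mulr1.
Qed.

Lemma rk_VM_gt0 (V : amod A) e (v : V) : e != 0 -> v != 0 -> (0 < rk e (tmod V M))%N.
Proof.
move=> e0 v0; rewrite lt0n dimv_eq0; apply/negP => /eqP r0.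
have z : act (tmod V M) e (pure v (1 : H)) = 0.
  by apply/eqP; rewrite -memv0 -r0 memv_img ?memvf.
suff : act (tmod V regA) e (pure v (1 : A)) = 0.
  by case/reg_tensr_inj => /eqP; rewrite ?(negPf e0) ?(negPf v0).
have [|g gi] := @lker0_left_inv k A H (lfn li).
  by apply: lker0_inj => a; rewrite lfnE; apply: iinj.
have gK a : g (iota a) = a.
  by have := congr1 (fun f : 'End(A) => f a) gi; rewrite comp_lfunE lfnE id_lfunE.
have := congr1 (tmapf (\1 : 'End(V)) g) z; rewrite linear0 => <-.
rewrite !act_tmod (tlift_lin (L := tmapf (\1 : 'End(V)) g)); last by lin.
by apply: eq_tlift => x y; rewrite tmapf_pure id_lfunE act_M act_reg !mulr1 gK.
Qed.

Local Notation m := (\dim {:A}).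
Local Notation p := (\dim {:H}).

Lemma mod_dim_gt0 (B : falgType k) : (0 < \dim {:B})%N.
Proof.
rewrite lt0n dimv_eq0; apply/eqP => f0.
by have := memvf (1 : B); rewrite f0 memv0 oner_eq0.
Qed.

(** [H] and [A] are proportional in the Grothendieck group of [A]: both are
    eigenvectors, for the same eigenvalue [dim H], of the tensor product with [H],
    whose matrix is positive. *)
Lemma rk_proportional r (X : 'I_r -> amod A) e l : all_simples X -> simple_idems X e ->
  (m * rk (e l) M = p * rk (e l) regA)%N.
Proof.
move=> aX ie; have [ee re] := ie; have [sX _ _] := aX.
pose al j := rk (e j) regA; pose mu j := rk (e j) M.
pose T i j := rk (e j) (tmod (X i) M).
have e0 j : e j != 0.
  apply/eqP => ej; have := re j j; rewrite ej /rk linear0 lim0g dimv0 eqxx; discriminate.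
have al0 j : (0 < al j)%N by apply: rk_reg_gt0.
have T0 i j : (0 < T i j)%N.
  by have [v v0] := simple_nz (sX i); apply: rk_VM_gt0 (e0 j) v0.
have aT j : additive_fun (fun V => rk (e j) (tmod V M)).
  by move=> U V Q s; rewrite (additive_rk (ee j) (ses_tmod M s)).
have muT j : (\sum_i mu i * T i j = p * mu j)%N.
  by rewrite -(additive_expand M aX ie (aT j)) rk_MM mulnC.
have alT j : (\sum_i al i * T i j = p * al j)%N.
  by rewrite -(additive_expand regA aX ie (aT j)) rk_reg_tmod mulnC.
(* The smallest ratio [mu j / al j]: the excess over it is a nonnegative vector
   with the same eigenvalue, zero at [j0], and positivity makes it zero. *)
have [j0 min] : exists j0, forall j, (mu j0 * al j <= mu j * al j0)%N.
  have [j0 _ h] := @arg_minP _ _ _ l xpredT (fun j => (mu j)%:Q / (al j)%:Q) isT.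
  exists j0 => j; have := h j isT.
  have pos i : (0 : rat) < (al i)%:Q by rewrite ltr0n.
  rewrite ler_pdivrMr // mulrAC ler_pdivlMr // -!intrM.
  by rewrite ler_int lez_nat.
have eps0 j : (mu j * al j0 - mu j0 * al j = 0)%N.
  have: (\sum_i (mu i * al j0 - mu j0 * al i) * T i j0 = 0)%N.
    apply/eqP; rewrite -(eqn_add2r (\sum_i mu j0 * al i * T i j0)%N) -big_split /= add0n.
    have -> : (\sum_i mu j0 * al i * T i j0 = mu j0 * (p * al j0))%N.
      by rewrite -alT big_distrr; apply: eq_bigr => i _; rewrite /= mulnA.
    under eq_bigr => i _ do rewrite -mulnDl subnK // mulnAC.
    by rewrite -big_distrl /= muT mulnA [(mu j0 * p)%N]mulnC.
  move/eqP; rewrite sum_nat_eq0 => /forallP/(_ j) /=.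
  by rewrite muln_eq0 => /orP[/eqP //|]; rewrite eqn0Ngt T0.
have prop j : (mu j * al j0 = mu j0 * al j)%N.
  by apply/eqP; rewrite eqn_leq min andbT -subn_eq0 eps0.
have sal : (\sum_j al j * \dim {:X j} = m)%N.
  by rewrite -(additive_expand regA aX ie (@additive_dim k A)).
have smu : (\sum_j mu j * \dim {:X j} = p)%N.
  by rewrite -(additive_expand M aX ie (@additive_dim k A)).
have E0 : (p * al j0 = mu j0 * m)%N.
  rewrite -sal -smu big_distrl big_distrr; apply: eq_bigr => j _ /=.
  by rewrite mulnAC prop mulnA.
apply/eqP; rewrite -(eqn_pmul2r (al0 j0)) -/(mu l) -/(al l) -mulnA prop.
by rewrite mulnCA mulnA -E0 -mulnA [(al j0 * _)%N]mulnC mulnA.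
Qed.

Definition unipotent := forall Y : amod A, simple_mod Y -> mod_iso Y (triv_mod A).

Lemma triv_dim : \dim {: triv_mod A} = 1%N.
Proof. by rewrite dimvf. Qed.

Lemma triv_simple : simple_mod (triv_mod A).
Proof.
split=> [f0|U _]; first by have := triv_dim; rewrite f0 dimv0.
have [/eqP|u0] := posnP (\dim U); first by rewrite dimv_eq0 => /eqP; left.
by right; apply/eqP; rewrite eqEdim subvf triv_dim.
Qed.

Lemma unipotent_inv (V : amod A) : unipotent -> {:V}%VS <> 0%VS ->
  exists2 v : V, v != 0 & forall a, act V a v = counit a *: v.
Proof.
move=> uA /simple_sub[U [i [sU hi ki]]]; have [f [bf hf]] := mod_iso_sym (uA U sU).
exists (i (f (1 : k^o))).
  apply/eqP => /eqP; rewrite -memv_ker ki memv0 => /eqP f0.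
  have /(bij_inj bf)/eqP : f (1 : k^o) = f 0 by rewrite f0 linear0.
  by rewrite oner_eq0.
by move=> a; rewrite -hi -hf -linearZ -linearZ /= scale_lfunE id_lfunE.
Qed.

(** The multiplicity in [A] of the trivial module is then divisible by [dim A], so that
    its idempotent is 1. *)
Lemma coprime_unipotent : coprime m p -> unipotent.
Proof.
move=> cop; have [r [X aX]] := exists_simples A; have [e ie] := exists_idems aX.
have [sX _ cX] := aX; have [l tl] := cX _ triv_simple.
have [ee re] := ie; have := rk_proportional l aX ie.
move/(congr1 (fun x => m %| x)%N); rewrite dvdn_mulr // Gauss_dvdr // => /esym.
move/dvdn_leq => lem; have el : e l = 1.
  have le : limg (amull (e l)) = fullv.
    apply/eqP; rewrite eqEdim subvf lem //; apply: rk_reg_gt0.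
    apply/eqP => el0; have := re l l; rewrite el0 /rk linear0 lim0g dimv0 eqxx; discriminate.
  have : (1 : A) \in limg (amull (e l)) by rewrite le memvf.
  by case/memv_imgP => x _; rewrite lfunE /= => h1; rewrite -[LHS]mulr1 h1 mulrA ee.
move=> Y sY; have [i Yi] := cX Y sY.
suff il : i = l by subst i; apply: mod_iso_trans Yi (mod_iso_sym tl).
apply/eqP; have := re i l; rewrite el /rk act1 lim1g; case: eqP => // _ /eqP.
by rewrite dimv_eq0 => /eqP; case: (sX i).
Qed.

(** In the unipotent case [H] is free over [A]. The submodule [F] generated by a
    complement of the kernel of an integral [L] is free, as a nonzero kernel would contain
    an invariant, that is [L w] with [w] in the complement. Now [L] has the same rank on
    [F (x) H], [H (x) F] and [H (x) H], so that its image on the latter lies in [F (x) F];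
    comparing dimensions, [F] is everything. *)
Lemma unipotent_dvd : unipotent -> (m %| p)%N.
Proof.
move=> uA; have [lam lam0 llam] := exists_lcoint A.
have [L LE Lint] := exists_lint lam0 llam.
have Luniq x : (forall h, h * x = counit h *: x) -> exists c, x = c *: L.
  by move/(lint_unique lam0 llam LE) => ->; exists (hev lam x).
have L0 : L != 0.
  apply/eqP => l0; have := LE 1; rewrite l0 mulr0 hev0r counit1 => /eqP.
  by rewrite eq_sym oner_eq0.
pose K := lker (act M L); pose W := (K^C)%VS; pose n := rk L M.
have dW : \dim W = n.
  by have d := dim_lker_limg (act M L); rewrite dimv_compl -d addKn.
have n0 : (0 < n)%N.
  rewrite lt0n dimv_eq0; apply/negP => /eqP i0.
  have : act M L (1 : H) \in 0%VS by rewrite -i0 memv_img ?memvf.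
  rewrite memv0 act_M mulr1 => /eqP/iinj l0; by rewrite l0 eqxx in L0.
pose j : 'Hom(subvs_of W, M) := lfn (@vsval_is_linear _ _ W).
pose Fr := framef j.
have dsW : \dim {:subvs_of W} = n by rewrite dimvf -dW.
have FrE a w : Fr (pure a w) = act M a (vsval w) by rewrite /Fr framef_pure [j w]lfnE.
have kFr : lker Fr = 0%VS.
  apply/eqP/negPn/negP => /eqP k0.
  have hF : @mod_hom _ _ (free_mod A (subvs_of W)) M Fr.
    by move=> a x; rewrite /Fr -framef_act.
  have sK := submod_ker hF; pose sub := sub_amod sK.
  have [|t t0 tinv] := @unipotent_inv sub uA.
    move=> f0; apply: k0; apply/eqP; rewrite -dimv_eq0.
    by rewrite -(sub_incl_img sK) limg_dim_eq ?sub_incl_ker ?capv0 // f0 dimv0.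
  pose s : free_mod A (subvs_of W) := vsval t.
  have sinv a : act (free_mod A (subvs_of W)) a s = counit a *: s.
    by rewrite -(sub_actE sK a t) (tinv a).
  pose j0 : 'Hom(subvs_of W, free_mod A (subvs_of W)) := lfn (lin_purer (1 : A) (lin_id (U := subvs_of W))).
  have j0E : framef j0 = \1%VF.
    apply/lfunP; apply: tens_ext; [lin | lin |] => a w.
    by rewrite framef_pure [j0 w]lfnE [LHS]free_act_pure mulr1 id_lfunE.
  have [||_ /(_ s sinv)/memv_imgP[u _ su]] := frame_free (j := j0) _ _ L0 Lint Luniq.
  - by rewrite j0E lim1g.
  - by rewrite dim_tens.
  have [w sw] : exists w, s = pure L w.
    exists (tlift (fun a (w : subvs_of W) => (hev lam (L * a) : k) *: w) u); rewrite su.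
    move: u {su}; apply: tens_ext; [lin | lin |] => a w.
    rewrite [LHS]free_act_pure tlift_pure; last by bil.
    rewrite (linZ (f := fun w => pure L w)); last by lin.
    rewrite -(linZ (f := fun a => pure a w)); last by lin.
    congr (pure _ w); apply: (lint_unique lam0 llam LE) => h.
    by rewrite mulrA Lint -scalerAl.
  have : Fr s = 0 by apply/eqP; rewrite -memv_ker /s subvsP.
  rewrite sw FrE => /eqP; rewrite -memv_ker => wK.
  have : vsval w \in (K :&: W)%VS by rewrite memv_cap wK subvsP.
  rewrite capv_compl memv0 => /eqP w0; move: t0.
  rewrite -(inj_eq val_inj) /= -/s sw.
  have -> : w = 0 by apply: val_inj.
  by rewrite (lin0 (f := fun w => pure L w)) ?eqxx //; lin.
pose F := limg Fr; have dF : \dim F = (m * n)%N.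
  by rewrite limg_dim_eq ?kFr ?capv0 // dim_tens dsW.
have sF : submod F.
  apply: (@submod_img k A (free_mod A (subvs_of W)) M Fr) => a x.
  by rewrite /Fr -framef_act.
pose F' := sub_amod sF; pose jF : 'Hom(subvs_of W, F') := (linfun (vsproj F) \o j)%VF.
have dF' : \dim {:F'} = (m * n)%N by rewrite dimvf -dF.
have jFE w : vsval (jF w) = vsval w.
  rewrite /jF comp_lfunE lfunE /= [j w]lfnE vsprojK //.
  by apply/memv_imgP; exists (pure 1 w); rewrite ?memvf // FrE act_one.
have fF : limg (framef jF) = fullv.
  apply: limg_full_surj => y; have /memv_imgP[t _ yt] : vsval y \in F by apply: subvsP.
  exists t; apply: val_inj; rewrite /= yt; move: t {yt}.
  apply: (tens_ext (f := fun t => vsval (framef jF t))); [|lin|] => [|a w].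
    by move=> c u v; rewrite linearP.
  by rewrite [RHS]FrE framef_pure [LHS](sub_actE sF) jFE.
have dM : \dim {:M} = p by [].
have rMM : rk L (tmod M M) = (n * p)%N by rewrite rk_MM.
have [|rFM _] := frame_free (frame_tmodl M fF) _ L0 Lint Luniq.
  by rewrite !dim_tens dF' dsW mulnA.
have [|rMF _] := frame_free (frame_tmodr M fF) _ L0 Lint Luniq.
  by rewrite !dim_tens dF' dsW mulnCA.
have [|rFF invFF] := frame_free (frame_tmodl F' fF) _ L0 Lint Luniq.
  by rewrite !dim_tens dF' dsW -mulnA.
rewrite !dim_tens dsW dF' in rFM rMF rFF.
pose i := sub_incl sF; have hi : mod_hom i by apply: sub_incl_hom.
have ki : lker i = 0%VS by apply: sub_incl_ker.
have [i' i'i] := lker0_left_inv ki.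
have h1 : mod_hom (\1 : 'End(M)) by move=> a x; rewrite !id_lfunE.
pose il := tmapf i (\1 : 'End(M)); pose ir := tmapf (\1 : 'End(M)) i.
have LS (V : amod A) (f : 'Hom(V, tmod M M)) : mod_hom f -> lker f = 0%VS ->
    rk L V = (n * p)%N -> limg (act (tmod M M) L) = (f @: limg (act V L))%VS.
  move=> hf kf rV; apply/eqP; rewrite eq_sym eqEdim (limg_dim_eq (f := f)) ?kf ?capv0 //.
  rewrite -/(rk L V) rV -/(rk L (tmod M M)) rMM leqnn andbT.
  by apply/subvP => _ /memv_imgP[_ /memv_imgP[x _ ->] ->]; rewrite hf memv_img ?memvf.
have Ll := LS (tmod F' M) il (tmapf_hom hi h1) _ rFM.
have Lr := LS (tmod M F') ir (tmapf_hom h1 hi) _ (etrans rMF (mulnC _ _)).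
have {}Ll : limg (act (tmod M M) L) = (il @: limg (act (tmod F' M) L))%VS.
  apply: Ll; apply: (left_inv_lker0 (g := tmapf i' \1)).
  by rewrite tmapf_comp i'i comp_lfun1l tmapf_id.
have {}Lr : limg (act (tmod M M) L) = (ir @: limg (act (tmod M F') L))%VS.
  apply: Lr; apply: (left_inv_lker0 (g := tmapf \1 i')).
  by rewrite tmapf_comp i'i comp_lfun1l tmapf_id.
pose ii := tmapf i i; pose jj := tmapf i' i'.
have jjii : (jj \o ii = \1)%VF by rewrite tmapf_comp i'i tmapf_id.
have kii : lker ii = 0%VS by apply: left_inv_lker0 jjii.
have hii : @mod_hom k A (tmod F' F') (tmod M M) ii by apply: tmapf_hom.
(* A tensor in [F (x) H] and in [H (x) F] is fixed by [i i' (x) i i']. *)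
have sub : (limg (act (tmod M M) L) <= ii @: limg (act (tmod F' F') L))%VS.
  apply/subvP => t tL.
  have tii : t = ii (jj t).
    have -> : ii (jj t) = tmapf (i \o i')%VF (\1 : 'End(M)) (tmapf (\1 : 'End(M)) (i \o i')%VF t).
      by rewrite /ii /jj -[LHS]comp_lfunE -[RHS]comp_lfunE !tmapf_comp comp_lfun1l comp_lfun1r.
    have -> : tmapf (\1 : 'End(M)) (i \o i')%VF t = t.
      have := tL; rewrite Lr => /memv_imgP[u _ ->].
      by rewrite -comp_lfunE tmapf_comp -comp_lfunA i'i !comp_lfun1r.
    have := tL; rewrite Ll => /memv_imgP[u _ ->].
    by rewrite -comp_lfunE tmapf_comp -comp_lfunA i'i !comp_lfun1r.
  rewrite tii memv_img //; apply: invFF => a.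
  have iiI x : ii x = 0 -> x = 0.
    by move/eqP; rewrite -memv_ker kii memv0 => /eqP.
  apply/eqP; rewrite -subr_eq0; apply/eqP/iiI.
  have iia : ii (act (tmod F' F') a (jj t)) = act (tmod M M) a t by rewrite [in RHS]tii; apply: hii.
  rewrite linearB linearZ /= [X in X - _]iia -tii; apply/eqP; rewrite subr_eq0; apply/eqP.
  by case/memv_imgP: tL => u _ ->; rewrite -act_mul Lint linearZ /= scale_lfunE.
have := dimvS sub; rewrite -/(rk L (tmod M M)) rMM (limg_dim_eq (f := ii)) ?kii ?capv0 //.
rewrite -/(rk L (tmod F' F')) rFF leq_pmul2l // => le_p.
have le_mn : (m * n <= p)%N by rewrite -dF dimvS ?subvf.
by apply/dvdnP; exists n; apply/eqP; rewrite eqn_leq [(n * m)%N]mulnC le_p le_mn.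
Qed.

(** When [m] does not divide the prime [p], it is prime to it, which makes [A] unipotent;
    but then it divides [p]. *)
Lemma nichols_zoeller : prime p -> m = 1%N \/ m = p.
Proof.
move=> pr; have [|d] := EM (m %| p)%N.
  by move/primeP: pr => [_ h] /h /orP[/eqP|/eqP]; [left|right].
case: (d); apply/unipotent_dvd/coprime_unipotent.
rewrite coprime_sym prime_coprime //; apply/negP => /dvdn_leq.
move/(_ (mod_dim_gt0 A)) => le_pm; apply: d.
suff le_mp : (m <= p)%N by rewrite (_ : m = p) //; apply/eqP; rewrite eqn_leq le_mp.
have <- : \dim (limg (lfn li)) = m; last by rewrite dimvS ?subvf.
rewrite limg_dim_eq //; apply/eqP; rewrite -subv0; apply/subvP => a.
by rewrite memv_cap memv_ker memv0 lfnE => /andP[_ /eqP/iinj->].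
Qed.

End NicholsZoeller.

(** * Hopf subalgebras generated by a subcoalgebra *)

Section SubHopf.
Context (k : fieldType) (H : hopfAlgType k) (U : {aspace H}).
Local Notation S := (@antipode k H).
Local Notation B := (subvs_of U).
Local Notation P := (projv U).

Hypothesis U1 : 1 \in U.
Hypothesis UC : forall u, u \in U -> tmap P P (comul u) = comul u.

Local Notation v := (@vsval k H U).

Fact val_lin : linear (v : B -> H). Proof. by []. Qed.

Fact algid1 : algid U = 1.
Proof. by apply/eqP; rewrite algid_eq1. Qed.

Fact val1 : v 1 = 1.
Proof. exact: algid1. Qed.

Fact valM (x y : B) : v (x * y) = v x * v y. Proof. by []. Qed.

Definition sub_comul (b : B) : tens B B := tmap (vsproj U) (vsproj U) (comul (v b)).

Let lv := val_lin.

Lemma vv_inj (W W' : vectType k) (s t : tens B W) (f : W -> W') : linear f -> injective f ->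
  tmap v f s = tmap v f t -> s = t.
Proof.
move=> lf inf; pose F := tmapf (lfn lv) (lfn lf).
have [|g gv] := @lker0_left_inv _ _ _ (lfn lv).
  by apply: lker0_inj => x; rewrite lfnE => x0; apply: val_inj.
have [|h hf] := @lker0_left_inv _ _ _ (lfn lf).
  apply: lker0_inj => x; rewrite lfnE => x0; apply: inf; rewrite x0 lin0 //.
have FE u : tmap v f u = F u.
  by rewrite lfnE; apply: eq_tmap => x; rewrite lfnE.
rewrite !FE => /(congr1 (tmapf g h)).
by rewrite -!comp_lfunE tmapf_comp gv hf tmapf_id !id_lfunE.
Qed.

Lemma sub_comulE b : tmap v v (sub_comul b) = comul (v b).
Proof.
rewrite /sub_comul tmap_comp // -[RHS]UC ?subvsP //; apply: eq_tmap => x /=.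
  by rewrite unlock.
by rewrite unlock.
Qed.

Lemma sub_sw (W : vectType k) (F : H -> H -> W) b : bilin F ->
  tlift (fun x y : B => F (v x) (v y)) (sub_comul b) = tlift F (comul (v b)).
Proof. by move=> bF; rewrite -sub_comulE tlift_tmap. Qed.

(** In finite dimension a subbialgebra is a Hopf subalgebra. The Galois map
    [x (x) y |-> x1 (x) x2 y] of [B] is injective as that of [H] is, hence bijective; the
    preimage of [b (x) 1] is [b1 (x) S(b2)], which is therefore a tensor over [B]. *)
Lemma sub_antipode (b : B) : S (v b) \in U.
Proof.
pose th := tlift (fun x y : B => tlift (fun p q : B => pure p (q * y)) (sub_comul x)).
have lsc : linear sub_comul by rewrite /sub_comul /tmap; lin.
have lth : linear th by apply: tlift_linear.
have thE t : tmap v v (th t) = theta (regular_mod H) (tmap v v t).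
  move: t; apply: tens_ext.
  - by apply: lin_comp lth; apply: lin_tmap.
  - by move=> c x y; rewrite lin_tmap linearP.
  move=> x y; rewrite tmap_pure // theta_pure /th tlift_pure; last by bil.
  have lvv : linear (tmap v v) by apply: lin_tmap.
  rewrite (tlift_lin _ _ lvv) -sub_sw; last by bil.
  by apply: eq_tlift => p q; rewrite tmap_pure // act_reg.
have [|t tE] := @inj_surj_dim k (tens B B) (tens B B) (lfn lth) (erefl _) _ (pure b 1).
  have lvv : linear (tmap v v : tens B B -> _) by apply: lin_tmap.
  move=> s; rewrite lfnE => s0; apply: (vv_inj lv val_inj).
  rewrite [RHS](lin0 lvv); apply: (theta_inj (V := regular_mod H)).
  by rewrite -thE s0 (lin0 lvv).
have : tmap v v t = tlift (fun x y => pure x (S y)) (comul (v b)).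
  apply/eqP; rewrite -subr_eq0; apply/eqP/(theta_inj (V := regular_mod H)).
  rewrite linearB /= -thE -(lfnE lth) tE tmap_pure // val1.
  rewrite (tlift_lin (L := theta (regular_mod H))); last by lin.
  apply/eqP; rewrite subr_eq0; apply/eqP; symmetry.
  under eq_tlift => x y do rewrite theta_pure.
  rewrite (sweedler3 (T := fun x p y => pure x (act (regular_mod H) p (S y)))); try by move=> *; lin.
  under eq_tlift => x y.
    under eq_tlift => p q do rewrite act_reg.
    rewrite (sw_antipoder (F := fun z => pure x z)); last by lin.
    over.
  by rewrite (sw_counitr (F := fun x => pure x 1)) //; lin.
move=> tvE; have <- : tlift (fun x y : H => counit x *: y) (tmap v v t) = S (v b).
  rewrite tvE (tlift_lin _ _ (tlift_linear _)) -(sw_counitl (F := S)); last by lin.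
  by apply: eq_tlift => x y; rewrite tlift_pure //; bil.
rewrite tlift_tmap; last by bil.
rewrite /tlift; apply: memv_suml => i _; apply: memv_suml => j _.
by apply/memvZ/memvZ/subvsP.
Qed.

Definition sub_cnt (b : B) : k := counit (v b).
Definition sub_ant (b : B) : B := Subvs (sub_antipode b).

Fact sub_comul_linear : linear sub_comul.
Proof. by rewrite /sub_comul /tmap; lin. Qed.
Fact sub_cnt_linear : scalar sub_cnt.
Proof. by move=> c x y; rewrite /sub_cnt !linearP. Qed.
Fact sub_ant_linear : linear sub_ant.
Proof. by move=> c x y; apply: val_inj; rewrite /= linearP. Qed.

Fact sub_comulA a :
  tassoc (tmap sub_comul idfun (sub_comul a)) = tmap idfun sub_comul (sub_comul a).
Proof.
have lsc := sub_comul_linear; have lvv : linear (tmap v v) by apply: lin_tmap.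
have ivv : injective (tmap v v : tens B B -> _) by move=> s t; apply: (vv_inj lv val_inj).
apply: (vv_inj lvv ivv); have lJ : linear (tmap v (tmap v v)) by apply: lin_tmap.
rewrite /tassoc tlift_tmap; last by bil.
rewrite (tlift_lin _ _ lJ).
have -> : tmap idfun sub_comul (sub_comul a) =
  tlift (fun b c => pure b (sub_comul c)) (sub_comul a) by [].
rewrite [RHS](tlift_lin _ _ lJ).
transitivity (tlift (fun b c => tlift (fun x y => pure x (pure y c)) (comul b)) (comul (v a))).
  rewrite -sub_sw; last by bil.
  apply: eq_tlift => b c; rewrite (tlift_lin _ _ lJ) /= -sub_sw; last by bil.
  by apply: eq_tlift => x y; rewrite tmap_pure // tmap_pure.
rewrite (sweedler3 (T := fun x y z => pure x (pure y z))); try by move=> *; lin.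
rewrite -sub_sw; last by bil.
apply: eq_tlift => b c; rewrite tmap_pure //= sub_comulE.
rewrite -[in RHS](tlift_id (comul (v c))) (tlift_lin (L := fun w => pure (v b) w)) //; lin.
Qed.

Fact sub_counitl a : tlift (fun x y : B => sub_cnt x *: y) (sub_comul a) = a.
Proof.
apply: val_inj; rewrite /= (tlift_lin _ _ lv) -[RHS](counitl (v a)) -sub_sw; last by bil.
exact: eq_tlift.
Qed.

Fact sub_counitr a : tlift (fun x y : B => sub_cnt y *: x) (sub_comul a) = a.
Proof.
apply: val_inj; rewrite /= (tlift_lin _ _ lv) -[RHS](counitr (v a)) -sub_sw; last by bil.
exact: eq_tlift.
Qed.

Fact sub_comul1 : sub_comul 1 = pure 1 1.
Proof.
by apply: (vv_inj lv val_inj); rewrite sub_comulE tmap_pure // val1 comul1.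
Qed.

Fact sub_comulM a b : sub_comul (a * b) = tmul (sub_comul a) (sub_comul b).
Proof.
have lvv : linear (tmap v v) by apply: lin_tmap.
apply: (vv_inj lv val_inj); rewrite sub_comulE valM comulM /tmul (tlift_lin _ _ lvv).
rewrite -sub_sw; last by bil.
apply: eq_tlift => x y; rewrite (tlift_lin _ _ lvv) -sub_sw; last by bil.
by apply: eq_tlift => z t; rewrite tmap_pure.
Qed.

Fact sub_counit1 : sub_cnt 1 = 1.
Proof. by rewrite /sub_cnt val1 counit1. Qed.

Fact sub_counitM a b : sub_cnt (a * b) = sub_cnt a * sub_cnt b.
Proof. by rewrite /sub_cnt valM counitM. Qed.

Fact sub_antipodel a : tlift (fun x y : B => sub_ant x * y) (sub_comul a) = (sub_cnt a)%:A.
Proof.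
apply: val_inj; rewrite /= (tlift_lin _ _ lv) algid1 -(antipodel (v a)).
by rewrite -sub_sw; [exact: eq_tlift | bil].
Qed.

Fact sub_antipoder a : tlift (fun x y : B => x * sub_ant y) (sub_comul a) = (sub_cnt a)%:A.
Proof.
apply: val_inj; rewrite /= (tlift_lin _ _ lv) algid1 -(antipoder (v a)).
by rewrite -sub_sw; [exact: eq_tlift | bil].
Qed.

Definition sub_hopf : hopfAlgType k := HB.pack B
  (isHopf.Build k B sub_comul_linear sub_cnt_linear sub_ant_linear sub_comulA
     sub_counitl sub_counitr sub_comul1 sub_comulM sub_counit1 sub_counitM
     sub_antipodel sub_antipoder).

End SubHopf.

Section Generation.
Context (k : closedFieldType) (H : hopfAlgType k).

Definition subcoalg (C : {vspace H}) :=
  forall c, c \in C -> tmap (projv C) (projv C) (comul c) = comul c.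

Lemma agenv_subcoalg (C : {vspace H}) : subcoalg C -> subcoalg (agenv C).
Proof.
move=> cC; set U := agenv C; pose P := projv U.
have PU x : P x \in U by apply: memv_proj.
have UM x y : x \in U -> y \in U -> x * y \in U.
  by move=> xU yU; have := memv_mul xU yU; rewrite agenvM.
have PPP (s t : tens H H) : tmap P P s = s -> tmap P P t = t -> tmap P P (tmul s t) = tmul s t.
  move=> <- <-; have lPP : linear (tmap P P) by apply: lin_tmap.
  rewrite /tmul tlift_tmap; last by bil.
  rewrite (tlift_lin _ _ lPP); apply: eq_tlift => a b.
  rewrite tlift_tmap; last by bil.
  rewrite (tlift_lin _ _ lPP); apply: eq_tlift => c d.
  rewrite tmap_pure; try by lin.
  by rewrite /P (projv_id (UM _ _ (PU a) (PU c))) (projv_id (UM _ _ (PU b) (PU d))).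
have lz : linear (fun u => tmap P P (comul u) - comul u).
  by rewrite /tmap; lin.
pose Z := (U :&: lker (lfn lz))%VS.
have ZP u : u \in Z = (u \in U) && (tmap P P (comul u) == comul u).
  by rewrite memv_cap memv_ker lfnE subr_eq0.
suff UZ : (U <= Z)%VS by move=> u /(subvP UZ); rewrite ZP => /andP[_ /eqP].
have CU : (C <= U)%VS by exact: sub_agenv.
have CZ : (C <= Z)%VS.
  apply/subvP => c cc; rewrite ZP (subvP CU) //= -{1}(cC c cc) tmap_comp; try by lin.
  rewrite -[X in _ == X](cC c cc); apply/eqP/eq_tmap => x /=.
    by apply: projv_id; apply: (subvP CU); apply: memv_proj.
  by apply: projv_id; apply: (subvP CU); apply: memv_proj.
apply: agenv_sub_modl.
  rewrite -memvE ZP comul1 tmap_pure; try by lin.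
  have U1 : 1 \in U by rewrite memvE /U sub1_agenv.
  by rewrite U1 projv_id ?eqxx.
apply/prodvP => x y /(subvP CZ); rewrite !ZP => /andP[xU /eqP xz] /andP[yU /eqP yz].
by rewrite comulM PPP // eqxx andbT UM.
Qed.

(** The algebra generated by [C] is a Hopf subalgebra, and its dimension divides that
    of [H]. *)
Lemma subcoalg_generates (C : {vspace H}) : prime (\dim {:H}) -> subcoalg C ->
  (C <= 1%VS)%VS \/ agenv C = fullv.
Proof.
move=> pr cC; have cU := agenv_subcoalg cC.
have U1 : 1 \in (<<C>>%AS : {vspace H}) by rewrite memvE sub1_agenv.
pose A := sub_hopf U1 cU.
have [] := @nichols_zoeller k A H (@vsval k H <<C>>%AS) (@val_lin _ _ _) (val1 U1) (@valM _ _ _) _ _ pr.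
- by move=> a a0; apply: val_inj.
- by move=> a; rewrite -(sub_comulE cU a).
- rewrite dimvf => dA; left.
  suff -> : 1%VS = agenv C by apply: sub_agenv.
  have dU : \dim (agenv C) = 1%N by exact: dA.
  by apply/eqP; rewrite eqEdim sub1_agenv dU dimv1.
rewrite dimvf => dA; right; have dU : \dim (agenv C) = \dim {:H} by exact: dA.
by apply/eqP; rewrite eqEdim subvf dU leqnn.
Qed.

End Generation.

(** * Hopf algebras of prime dimension *)

Section PredSpace.
Context (k : fieldType) (V : vectType k).

(** Take a subspace of maximal dimension on which [P] holds. *)
Lemma vspace_of_pred (P : V -> Prop) : P 0 ->
    (forall c x y, P x -> P y -> P (c *: x + y)) ->
  exists U : {vspace V}, forall x, x \in U <-> P x.
Proof.
move=> P0 PL; pose Q n := exists2 U : {vspace V}, (forall x, x \in U -> P x) & \dim U = n.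
have Q0 : exists n, `[< Q n >].
  by exists 0%N; apply/asboolP; exists 0%VS; rewrite ?dimv0 // => x; rewrite memv0 => /eqP->.
have Qb n : `[< Q n >] -> (n <= \dim {:V})%N.
  by move/asboolP => [U _ <-]; rewrite dimvS ?subvf.
case: (ex_maxnP Q0 Qb) => n /asboolP[U UP dU] mx.
exists U => x; split=> [/UP//|Px].
have /asboolP/mx le : Q (\dim (U + <[x]>)%VS).
  exists (U + <[x]>)%VS => // y /memv_addP[u uU [_ /vlineP[c ->] ->]].
  by rewrite addrC; apply: PL => //; apply: UP.
have /eqP-> : U == (U + <[x]>)%VS by rewrite eqEdim addvSl dU.
by rewrite (subvP (addvSr _ _)) // memv_line.
Qed.

End PredSpace.

(** Induction on words in [C]; the predicate is arbitrary because a linear one carves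
    out a subspace. *)
Lemma agenv_ind (k : fieldType) (A : falgType k) (C : {vspace A}) (P : A -> Prop) :
    P 0 -> (forall c x y, P x -> P y -> P (c *: x + y)) -> P 1 ->
    (forall c x, c \in C -> P x -> P (c * x)) ->
  forall x, x \in agenv C -> P x.
Proof.
move=> P0 PL P1 PC; have [U UP] := vspace_of_pred P0 PL.
have /subvP AU : (agenv C <= U)%VS.
  apply: agenv_sub_modl; first by rewrite -memvE; apply/UP.
  by apply/prodvP => c x cC /UP Px; apply/UP/PC.
by move=> x /AU/UP.
Qed.

Definition comm_cocomm (k : fieldType) (H : hopfAlgType k) :=
  commutative (@GRing.mul H) /\ cocommutative H.

Section PrimeDim.
Context (k : closedFieldType).

Lemma gen_commutative (A : falgType k) (C : {vspace A}) :
  (forall x y, x \in C -> y \in C -> x * y = y * x) -> agenv C = fullv ->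
  commutative (@GRing.mul A).
Proof.
move=> CC full.
have c1 c x : c \in C -> c * x = x * c.
  move=> cC; have : x \in agenv C by rewrite full memvf.
  apply: (agenv_ind (P := fun x => c * x = x * c)) => {x}.
  - by rewrite mulr0 mul0r.
  - by move=> b x y ex ey; rewrite mulrDr mulrDl -scalerAr -scalerAl ex ey.
  - by rewrite mulr1 mul1r.
  - by move=> b x bC ex; rewrite mulrA (CC c b) // -mulrA ex mulrA.
move=> x y; have : x \in agenv C by rewrite full memvf.
apply: (agenv_ind (P := fun x => x * y = y * x)) => {x}.
- by rewrite mulr0 mul0r.
- by move=> b x z ex ey; rewrite mulrDr mulrDl -scalerAr -scalerAl ex ey.
- by rewrite mulr1 mul1r.
- by move=> b x bC ex; rewrite -mulrA ex mulrA (c1 b y bC) mulrA.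
Qed.

Lemma tflip_mul (A : falgType k) (s t : tens A A) : tflip (tmul s t) = tmul (tflip s) (tflip t).
Proof.
have lf : linear (@tflip k A A) by apply: tlift_linear.
have flt (W : vectType k) (B : A -> A -> W) u : bilin B -> tlift B (tflip u) = tlift (fun x y => B y x) u.
  move=> bB; rewrite /tflip (tlift_lin _ _ (tlift_linear _)).
  by apply: eq_tlift => x y; rewrite tlift_pure.
rewrite /tmul (tlift_lin _ _ lf) flt; last by bil.
apply: eq_tlift => a b; rewrite (tlift_lin _ _ lf) flt; last by bil.
by apply: eq_tlift => c d; rewrite /tflip tlift_pure //; bil.
Qed.

Lemma gen_cocommutative (A : hopfAlgType k) (C : {vspace A}) :
  (forall c, c \in C -> tflip (comul c) = comul c) -> agenv C = fullv -> cocommutative A.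
Proof.
move=> CC full x; have : x \in agenv C by rewrite full memvf.
have lf : linear (@tflip k A A) by apply: tlift_linear.
apply: (agenv_ind (P := fun x => tflip (comul x) = comul x)) => {x}.
- by rewrite linear0 lin0.
- by move=> b x y ex ey; rewrite linearP lf ex ey.
- by rewrite comul1 /tflip tlift_pure //; bil.
- by move=> b x bC ex; rewrite comulM tflip_mul CC // ex.
Qed.

Lemma tmap_proj_pure (V : vectType k) (C : {vspace V}) x y : x \in C -> y \in C ->
  tmap (projv C) (projv C) (pure x y) = pure x y.
Proof. by move=> xC yC; rewrite tmap_pure ?projv_id //; lin. Qed.

(** A nontrivial group-like element [g] would generate [H], which would then be
    the group algebra of a cyclic group. *)
Lemma grouplike_trivial (H : hopfAlgType k) (g : H) : prime (\dim {:H}) ->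
  comul g = pure g g -> counit g = 1 -> ~ comm_cocomm H -> g = 1.
Proof.
move=> pr gg g1 nc; have sg : subcoalg <[g]>%VS.
  move=> _ /vlineP[c ->]; rewrite linearZ /= gg linZ; last by rewrite /tmap; lin.
  by rewrite tmap_proj_pure ?memv_line.
have [g1v|full] := subcoalg_generates pr sg.
  have /vlineP[c gc] : g \in <[1 : H]>%VS by rewrite (subvP g1v) // memv_line.
  have : counit g = c by rewrite gc linearZ /= counit1; apply: mulr1.
  by rewrite g1 gc => <-; rewrite scale1r.
case: nc; split.
  apply: gen_commutative full => _ _ /vlineP[c ->] /vlineP[d ->].
  by rewrite -!scalerAr -!scalerAl !scalerA mulrC.
apply: gen_cocommutative full => _ /vlineP[c ->].
rewrite linearZ /= gg linZ; last by rewrite /tflip; lin.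
by rewrite /tflip tlift_pure //; bil.
Qed.

Lemma comm_cocomm_dual (H : hopfAlgType k) : comm_cocomm (hdual H) -> comm_cocomm H.
Proof.
move=> [cK cK']; split=> [x y|a].
  apply: hev_sep => f; rewrite -!sw_hdual -{1}(cK' f) /tflip.
  rewrite (tlift_lin _ _ (tlift_linear _)); apply: eq_tlift => g h.
  by rewrite tlift_pure 1?mulrC //; bil.
apply: tens_sep => f g; rewrite /tflip (tlift_lin _ _ (tlift_linear _)) -hevM cK hevM.
by apply: eq_tlift => x y; rewrite tlift_pure 1?mulrC //; bil.
Qed.

Context (H : hopfAlgType k).
Hypotheses (pr : prime (\dim {:H})) (nc : ~ comm_cocomm H).
Local Notation K := (hdual H).
Local Notation S := (@antipode k H).

Lemma prK : prime (\dim {:K}).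
Proof. by rewrite dim_hdual. Qed.

(** A character is a group-like element of the dual. *)
Lemma char_trivial (al : K) : hev al 1 = 1 -> (forall x y, hev al (x * y) = hev al x * hev al y) ->
  forall x, hev al x = counit x.
Proof.
move=> a1 aM; suff -> : al = 1 by move=> x; rewrite hev1.
apply: grouplike_trivial prK _ _ _ => [|//|/comm_cocomm_dual//].
apply: tev_inj => x y; rewrite tev_comul aM /tev tlift_pure //; bil.
Qed.

(** The modular element and the modular character are trivial, so that Radford's formula
    reads [S^4 = 1]. *)
Lemma prime_antipode4 : forall a, S (S (S (S a))) = a.
Proof.
have [lam lam0 llam] := exists_lcoint H.
have [L LE Lint] := exists_lint lam0 llam.
have [g [gg g1 gE]] := modular_elt lam0 llam.
have [al [al1 alM alE]] := modular_char lam0 llam LE Lint.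
have g1' := grouplike_trivial pr gg g1 nc.
apply: (antipode4 lam0 llam _ LE) => [y|b]; first by rewrite gE g1'.
rewrite alE (char_trivial al1 alM) hevZr -[L]mul1r LE counit1.
by rewrite mulr1.
Qed.

Section Coefficients.
Variable X : amod H.
Local Notation n := (\dim {:X}).
Local Notation b := (vbasis {:X}).

Fact coef_lin (f : 'Hom(X, k^o)) (v : X) : linear (fun x : H => f (act X x v)).
Proof. by lin. Qed.

Definition coef f v : K := lfn (coef_lin f v).

Lemma coefE f v x : hev (coef f v) x = f (act X x v).
Proof. exact: lfnE. Qed.

Fact coordf_lin (i : 'I_n) : linear (coord b i : X -> k^o). Proof. by lin. Qed.
Definition coordf i : 'Hom(X, k^o) := lfn (coordf_lin i).

Definition mcoef (i j : 'I_n) : K := coef (coordf i) b`_j.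

Lemma mcoefE i j x : hev (mcoef i j) x = coord b i (act X x b`_j).
Proof. by rewrite coefE lfnE. Qed.

Lemma act_mcoef x (j : 'I_n) : act X x b`_j = \sum_(i < n) (hev (mcoef i j) x : k) *: b`_i.
Proof. by rewrite [LHS](coord_vbasis (memvf _)); apply: eq_bigr => i _; rewrite mcoefE. Qed.

Definition mcoefs : {vspace K} := (\sum_(i < n) \sum_(j < n) <[mcoef i j]>)%VS.

Lemma mcoefsP (P : K -> Prop) : P 0 -> (forall c x y, P x -> P y -> P (c *: x + y)) ->
  (forall i j, P (mcoef i j)) -> forall f, f \in mcoefs -> P f.
Proof.
move=> P0 PL PC; have [U UP] := vspace_of_pred P0 PL.
suff /subvP CU : (mcoefs <= U)%VS by move=> f /CU/UP.
by apply/subv_sumP => i _; apply/subv_sumP => j _; rewrite -memvE; apply/UP.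
Qed.

Lemma mcoef_mem i j : mcoef i j \in mcoefs.
Proof.
rewrite memvE /mcoefs; apply: subv_trans (sumv_sup i _ (subvv _)); last by [].
by apply: subv_trans (sumv_sup j _ (subvv _)).
Qed.

(** The coproduct of a matrix coefficient is given by matrix multiplication. *)
Lemma mcoefs_subcoalg : subcoalg mcoefs.
Proof.
have lP : linear (tmap (projv mcoefs) (projv mcoefs)) by apply: lin_tmap.
apply: mcoefsP.
- by rewrite linear0 lin0.
- by move=> c x y ex ey; rewrite linearP lP ex ey.
move=> i j; have -> : comul (mcoef i j) = \sum_(l < n) pure (mcoef i l) (mcoef l j).
  apply: tev_inj => x y; rewrite tev_comul mcoefE act_mul act_mcoef.
  have lt : linear (fun t => tev t x y) by rewrite /tev; lin.
  rewrite !linear_sum (linS (f := fun t => tev t x y)) //; apply: eq_bigr => l _.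
  rewrite !linearZ /= /tev tlift_pure; last by bil.
  by rewrite -[coord b i _]mcoefE; apply: mulrC.
rewrite linS //; apply: eq_bigr => l _.
by rewrite tmap_proj_pure ?mcoef_mem.
Qed.

(** Were the coefficients scalars, [H] would act on [X] through the counit. *)
Lemma mcoefs_generate : simple_mod X -> ~ mod_iso X (triv_mod H) -> agenv mcoefs = fullv.
Proof.
move=> sX nX; have [c1|//] := subcoalg_generates prK mcoefs_subcoalg.
have cE (i j : 'I_n) x : hev (mcoef i j) x = counit x * hev (mcoef i j) 1.
  have /vlineP[c ->] : mcoef i j \in <[1 : K]>%VS by rewrite (subvP c1) ?mcoef_mem.
  by rewrite !hevZ !hev1 counit1 mulr1 mulrC.
have aX x v : act X x v = counit x *: v.
  rewrite (coord_vbasis (memvf v)) linear_sum scaler_sumr; apply: eq_bigr => j _.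
  rewrite linearZ /= act_mcoef scalerA mulrC -scalerA; congr (_ *: _).
  under eq_bigr => i _ do rewrite cE -scalerA.
  by rewrite -scaler_sumr -act_mcoef act_one.
case: nX; have [v v0] := simple_nz sX.
have lf : linear (fun c : k^o => (c : k) *: v) by lin.
have hf : @mod_hom k H (triv_mod H) X (lfn lf).
  move=> x c; rewrite [LHS](lfnE lf) (lfnE lf) aX /= scale_lfunE id_lfunE scalerA; exact: erefl.
have [f0|//] := simple_hom_bij (triv_simple H) sX hf; last by move/mod_iso_sym.
have : lfn lf 1 = 0 by rewrite f0 zero_lfunE.
by rewrite lfnE scale1r => /eqP; rewrite (negPf v0).
Qed.

End Coefficients.

End PrimeDim.

Section Faithfulness.
Context (k : closedFieldType) (H : hopfAlgType k).
Hypotheses (pr : prime (\dim {:H})).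
Local Notation K := (hdual H).
Local Notation S := (@antipode k H).
Variable X : amod H.
Hypotheses (sX : simple_mod X) (nX : ~ mod_iso X (triv_mod H)).

(** The coefficients of [X] are fixed by [S^2], and they generate the dual of [H]. *)
Lemma S2_trivial : (forall x, act X (S (S x)) = act X x) -> forall a, S (S a) = a.
Proof.
move=> h a; apply: hev_sep => f; rewrite -!hev_antipode.
suff -> : antipode (antipode f) = f by [].
have : f \in agenv (mcoefs X) by rewrite (mcoefs_generate pr sX nX) memvf.
have L c (x y : K) : antipode (antipode x) = x -> antipode (antipode y) = y ->
    antipode (antipode (c *: x + y)) = c *: x + y.
  by move=> ex ey; rewrite !linearP /= ex ey.
apply: (agenv_ind (P := fun f => antipode (antipode f) = f)) => {f} //.
- by rewrite !linear0.
- by rewrite !antipode1.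
move=> c f cC ef; rewrite !antipodeM ef; congr (_ * _).
move: c cC; apply: mcoefsP => [|//|i j]; first by rewrite !linear0.
by apply: hevP => x; rewrite !hev_antipode !mcoefE h.
Qed.

Fixpoint tower n (V : amod H) : amod H := if n is m.+1 then tower m (tmod V X) else V.

(** Contracting the second factor against a basis recovers the tensor. *)
Lemma tens_sepr (V : vectType k) (t : tens V H) :
  (forall f : K, tlift (fun v x => (hev f x : k) *: v) t = 0) -> t = 0.
Proof.
move=> e; pose n := \dim {:H}; pose b := vbasis {:H}.
transitivity (\sum_(j < n) pure (tlift (fun (v : V) x => (hev (hbasis j : K) x : k) *: v) t) b`_j); last first.
  by apply: big1 => j _; rewrite e (lin0 (f := fun v => pure v b`_j)) //; lin.
under eq_bigr => j _.
  rewrite (tlift_lin (L := fun v => pure v b`_j)); last by lin.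
  over.
rewrite tlift_sum -[LHS]tlift_id; apply: eq_tlift => v x.
rewrite {1}(coord_vbasis (memvf x)) linS; last by lin.
apply: eq_bigr => j _; rewrite (linZ (f := fun x => pure v x)); last by lin.
by rewrite (linZ (f := fun v => pure v b`_j)) ?hbasisE //; lin.
Qed.

(** The functionals of [H] are polynomials in the coefficients of [X], and a product of
    [n] of them is a coefficient of [X^n]; if [e] killed all the modules [V (x) X^n], it
    would kill [V (x) H], where it acts faithfully. *)
Lemma tower_faithful (V : amod H) (e : H) : e != 0 -> {:V}%VS <> 0%VS ->
  exists n, act (tower n V) e <> 0.
Proof.
move=> e0 V0; apply: contrapT => h.
have {}h n : act (tower n V) e = 0 by apply: contrapT => hn; apply: h; exists n.
have main (f : K) : forall V : amod H, (forall n, act (tower n V) e = 0) ->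
    forall v : V, tlift (fun x y : H => (hev f y : k) *: act V x v) (comul e) = 0.
  have : f \in agenv (mcoefs X) by rewrite (mcoefs_generate pr sX nX) memvf.
  pose P f := forall V : amod H, (forall n, act (tower n V) e = 0) ->
    forall v : V, tlift (fun x y : H => (hev f y : k) *: act V x v) (comul e) = 0.
  have PL c f1 f2 : P f1 -> P f2 -> P (c *: f1 + f2).
    move=> h1 h2 U hU u.
    have lt : linear (fun f : K => tlift (fun x y : H => (hev f y : k) *: act U x u) (comul e)) by lin.
    by rewrite lt h1 // h2 // scaler0 addr0.
  have P0 : P 0.
    move=> U hU u; have lt : linear (fun f : K => tlift (fun x y : H => (hev f y : k) *: act U x u) (comul e)) by lin.
    by rewrite (lin0 lt).
  apply: (agenv_ind (P := P)) => // {f}.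
    move=> U hU u; under eq_tlift => x y do rewrite hev1.
    rewrite (sw_counitr (F := fun x => act U x u)); last by lin.
    by rewrite (hU 0%N) zero_lfunE.
  move=> c f cC Pf; move: c cC; apply: mcoefsP.
  - by rewrite mul0r.
  - by move=> c f1 f2 h1 h2; rewrite mulrDl -scalerAl; apply: PL.
  move=> i j U hU u.
  have hUX n : act (tower n (tmod U X)) e = 0 by apply: (hU n.+1).
  pose F := tlift (fun (u : U) (x : X) => (coord (vbasis {:X}) i x) *: u).
  have lF : linear F by apply: tlift_linear.
  have /(congr1 F) := Pf _ hUX (pure u (vbasis {:X})`_j).
  rewrite (lin0 lF) (tlift_lin _ _ lF) => <-.
  transitivity (tlift (fun x y => tlift (fun y1 y2 : H =>
     ((hev (mcoef i j) y1 * hev f y2) : k) *: act U x u) (comul y)) (comul e)).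
    apply: eq_tlift => x y; rewrite hevM.
    by rewrite (tlift_lin (L := fun z : k^o => (z : k) *: act U x u)) //; lin.
  rewrite -(sweedler3 (T := fun x y1 y2 => ((hev (mcoef i j) y1 * hev f y2) : k) *: act U x u));
    try by move=> *; lin.
  apply: eq_tlift => x y2; rewrite act_tmod (linZ _ _ lF) (tlift_lin _ _ lF) -tliftZ.
  apply: eq_tlift => x1 x2; rewrite /F tlift_pure; last by bil.
  by rewrite mcoefE scalerA mulrC.
have [v v0] : exists v : V, v != 0.
  by exists (vpick {:V}); rewrite vpick0; apply/eqP.
suff : act (tmod V (regular_mod H)) e (pure v (1 : H)) = 0.
  by case/reg_tensr_inj => /eqP; rewrite ?(negPf e0) ?(negPf v0).
apply: tens_sepr => f; rewrite act_tmod.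
rewrite (tlift_lin (L := tlift _)); last by exact: tlift_linear.
rewrite -(main f V h v); apply: eq_tlift => x y.
by rewrite tlift_pure ?act_reg ?mulr1 //; bil.
Qed.

End Faithfulness.

(** * Multiplicities and the double dual *)

Section DoubleDual.
Context (k : fieldType) (H : hopfAlgType k).
Local Notation S := (@antipode k H).
Implicit Types U V W Q : amod H.

Lemma hom_ddual V W (f : 'Hom(V, W)) : @mod_hom k H V W f -> @mod_hom k H (ddual V) (ddual W) f.
Proof. by move=> h a; apply: h. Qed.

Lemma ses_ddual U V Q : ses U V Q -> ses (ddual U) (ddual V) (ddual Q).
Proof.
case=> i [pi [hi hp ki sp e]]; exists i, pi.
by split=> //; apply: hom_ddual.
Qed.

Lemma iso_ddual V W : mod_iso V W -> mod_iso (ddual V) (ddual W).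
Proof. by case=> f [bf hf]; exists f; split=> // a; apply: hf. Qed.

Lemma simple_ddual V : (forall a, exists b, S b = a) -> simple_mod V -> simple_mod (ddual V).
Proof.
move=> Ss [V0 sV]; split=> // U sU; apply: sV => a.
by have [b <-] := Ss a; have [c <-] := Ss b; apply: sU.
Qed.

Lemma ddual_tmod V W a : act (ddual (tmod V W)) a = act (tmod (ddual V) (ddual W)) a.
Proof.
apply: lfun_tens_ext => v w; rewrite [LHS](@act_tmod k H V W) [RHS](@act_tmod k H (ddual V) (ddual W)).
by rewrite sw_S2 //; bil.
Qed.

Lemma rk_S2_reg a : (forall x, S (S (S (S x))) = x) ->
  rk (S (S a)) (regular_mod H) = rk a (regular_mod H).
Proof.
move=> S4; have lSS : linear (fun x : H => S (S x)) by lin.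
rewrite /rk -[RHS](limg_dim_eq (f := lfn lSS)); last first.
  apply/eqP; rewrite -subv0; apply/subvP => x; rewrite memv_cap memv_ker memv0 lfnE.
  by case/andP => _ /eqP x0; rewrite -(S4 x) x0 !linear0.
congr (\dim _); apply/vspaceP => y; apply/memv_imgP/memv_imgP.
  case=> x _ ->; exists (act (regular_mod H) a (S (S x))); first by rewrite memv_img ?memvf.
  by rewrite (lfnE lSS) !act_reg !antipodeM S4.
case=> _ /memv_imgP[x _ ->] ->; exists (S (S x)); rewrite ?memvf //.
by rewrite (lfnE lSS) !act_reg !antipodeM.
Qed.

End DoubleDual.

Section Multiplicities.
Context (k : closedFieldType) (H : hopfAlgType k) (r : nat).
Variables (X : 'I_r -> amod H) (e : 'I_r -> H) (o : 'I_r).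
Hypotheses (aX : all_simples X) (ie : simple_idems X e) (Xo : mod_iso (X o) (triv_mod H)).
Hypotheses (pr : prime (\dim {:H})) (nc : ~ comm_cocomm H).
Local Notation S := (@antipode k H).
Local Notation reg := (regular_mod H).
Local Notation p := (\dim {:H}).

Definition sdim j := \dim {:X j}.
(** The multiplicity of [X j] in [H], which is the dimension of its injective hull. *)
Definition pmul j := rk (e j) reg.
Definition tmul_mx (Y : amod H) i j := rk (e j) (tmod (X i) Y).

Let ee j : e j * e j = e j := ie.1 j.
Let re i j : rk (e j) (X i) = (i == j) := ie.2 i j.

Lemma idem_neq0 j : e j != 0.
Proof.
by apply/eqP => ej; have := re j j; rewrite ej /rk linear0 lim0g dimv0 eqxx.
Qed.

Lemma pmul_gt0 j : (0 < pmul j)%N.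
Proof. by apply: rk_reg_gt0 (idem_neq0 j). Qed.

Lemma sdim_gt0 j : (0 < sdim j)%N.
Proof. by rewrite lt0n dimv_eq0; apply/eqP; case: aX => /(_ j)[]. Qed.

Lemma sum_pmul_sdim : (\sum_j pmul j * sdim j = p)%N.
Proof. by rewrite -(additive_expand reg aX ie (@additive_dim k H)). Qed.

Lemma additive_tmod Y j : additive_fun (fun V => rk (e j) (tmod V Y)).
Proof. by move=> U V Q s; rewrite (additive_rk (ee j) (ses_tmod Y s)). Qed.

Lemma sum_pmul_tmul Y j : (\sum_i pmul i * tmul_mx Y i j = pmul j * \dim {:Y})%N.
Proof. by rewrite -(additive_expand reg aX ie (additive_tmod Y j)) rk_reg_tmod. Qed.

Lemma sum_tmul_sdim Y i : (\sum_j tmul_mx Y i j * sdim j = sdim i * \dim {:Y})%N.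
Proof. by rewrite -dim_tens -(additive_expand (tmod (X i) Y) aX ie (@additive_dim k H)). Qed.

Lemma tmul_o Y j : tmul_mx Y o j = rk (e j) Y.
Proof.
apply: additive_iso (additive_rk (ee j)) _.
apply: mod_iso_trans (tmod_trivl Y).
exact: tmod_iso Xo (mod_iso_refl Y).
Qed.

Lemma counit_idem_o : counit (e o) = 1.
Proof.
have := re o o; rewrite (additive_iso (additive_rk (ee o)) Xo) eqxx /rk.
have /eqP := counitM (e o) (e o); rewrite ee -{1}[counit (e o)]mulr1.
have [c0 _|c0 /eqP/(mulfI c0) <- //] := eqVneq (counit (e o)) 0.
by rewrite /= c0 scale0r lim0g dimv0.
Qed.

(** Both inequalities count composition factors of the free module [H (x) Y]: those
    isomorphic to [X_j] for [Y = X_j], where [X_o (x) X_j] contributes, and the trivial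
    ones for the dual [Y] of [X_j], where [X_j (x) X_j^*] contributes. *)
Lemma pmul_sdim_ge j : (pmul o <= pmul j * sdim j)%N.
Proof.
rewrite /sdim -sum_pmul_tmul (bigD1 o) //= tmul_o re eqxx muln1.
exact: leq_addr.
Qed.

Lemma pmul_le j : (pmul j <= pmul o * sdim j)%N.
Proof.
pose Y := dual_mod (X j).
have dY : \dim {:Y} = sdim j by rewrite /sdim !dimvf /dim /= muln1.
rewrite -dY -sum_pmul_tmul (bigD1 j) //= (leq_trans _ (leq_addr _ _)) //.
rewrite -[X in (X <= _)%N]muln1 leq_mul2l rk_tmod_dual ?orbT //; last exact: counit_idem_o.
by case: aX => /(_ j)[].
Qed.

Let S4 := prime_antipode4 pr nc.

Lemma S_surj (a : H) : exists b, S b = a.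
Proof. by exists (S (S (S a))). Qed.

Lemma exists_sigma : exists sg : 'I_r -> 'I_r, forall j, mod_iso (ddual (X j)) (X (sg j)).
Proof.
have [sX nX cX] := aX.
apply: (fin_all_exists (P := fun j l => mod_iso (ddual (X j)) (X l))) => j.
by apply: cX; apply: simple_ddual => //; apply: S_surj.
Qed.

Variable sg : 'I_r -> 'I_r.
Hypothesis sgP : forall j, mod_iso (ddual (X j)) (X (sg j)).

Lemma sg_fix j : mod_iso (ddual (X j)) (X j) <-> sg j = j.
Proof.
have [_ nX _] := aX; split=> [h|sj]; last by have := sgP j; rewrite sj.
by apply: nX; apply: mod_iso_trans (mod_iso_sym (sgP j)) h.
Qed.

Lemma sgK : involutive sg.
Proof.
move=> j; have [_ nX _] := aX; apply: nX.
apply: mod_iso_trans (mod_iso_sym (sgP (sg j))) _.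
apply: mod_iso_trans (mod_iso_sym (iso_ddual (sgP j))) _.
exists \1%VF; split; first by exists id => x; rewrite id_lfunE.
by move=> a x; rewrite !id_lfunE /= S4.
Qed.

Lemma rk_ddual j (V : amod H) : rk (e j) (ddual V) = rk (e (sg j)) V.
Proof.
have aF : additive_fun (fun V => rk (e j) (ddual V)).
  by move=> U W Q s; rewrite (additive_rk (ee j) (ses_ddual s)).
rewrite (additive_expand V aX ie aF) (bigD1 (sg j)) //= big1 ?addn0 => [|l nl].
  by rewrite (additive_iso (additive_rk (ee j)) (sgP _)) re sgK eqxx muln1.
rewrite (additive_iso (additive_rk (ee j)) (sgP _)) re.
by rewrite -(inj_eq (inv_inj sgK)) sgK (negPf nl) muln0.
Qed.

Lemma sg_pmul j : pmul (sg j) = pmul j.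
Proof. by rewrite /pmul -rk_ddual -[RHS](rk_S2_reg _ S4). Qed.

Lemma sg_sdim j : sdim (sg j) = sdim j.
Proof. by rewrite /sdim -(additive_iso (@additive_dim k H) (sgP j)). Qed.

Lemma sg_tmul i l : sg i = i -> tmul_mx (X i) (sg l) i = tmul_mx (X i) l i.
Proof.
move=> si; rewrite /tmul_mx.
have -> : rk (e i) (tmod (X (sg l)) (X i)) = rk (e i) (tmod (ddual (X l)) (ddual (X i))).
  apply: additive_iso (additive_rk (ee i)) (tmod_iso (mod_iso_sym (sgP l)) _).
  by apply: mod_iso_sym; apply/sg_fix.
transitivity (rk (e i) (ddual (tmod (X l) (X i)))); first by rewrite /rk ddual_tmod.
by rewrite rk_ddual si.
Qed.

Lemma odd_sum_inv (s : 'I_r -> 'I_r) (x : 'I_r -> nat) : involutive s ->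
    (forall j, x (s j) = x j) ->
  odd (\sum_j x j) = odd (\sum_(j | s j == j) x j).
Proof.
move=> sK sx; rewrite (bigID (fun j => s j == j)) /= oddD.
suff -> : odd (\sum_(j | s j != j) x j) = false by rewrite addbF.
rewrite (bigID (fun j : 'I_r => (j < s j)%N)) /=.
rewrite [X in (_ + X)%N](reindex_inj (inv_inj sK)) /=.
rewrite [X in (_ + X)%N](eq_bigl (fun j : 'I_r => (s j != j) && (j < s j)%N)) => [|j]; last first.
  rewrite sK [j == s j]eq_sym; case: eqP => //= /eqP nj.
  by rewrite -leqNgt leq_eqVlt; case: eqP => // /val_inj jj; rewrite -jj eqxx in nj.
rewrite [X in (_ + X)%N](eq_bigr x) => [|j _]; last exact: sx.
by rewrite oddD addbb.
Qed.

Lemma odd_p : (exists2 i, i != o & (1 < sdim i)%N) -> odd p.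
Proof.
case=> i io d2; have [p2|//] := even_prime pr.
have : (2 < p)%N.
  rewrite -sum_pmul_sdim (bigD1 o) //= (bigD1 i) //= addnA.
  apply: (leq_trans _ (leq_addr _ _)); rewrite -add1n leq_add ?muln_gt0 ?pmul_gt0 ?sdim_gt0 //.
  by rewrite -[2%N]mul1n leq_mul ?pmul_gt0.
by rewrite p2.
Qed.

(** Suppose that the nontrivial [X_j] isomorphic to their double dual have even
    multiplicity in [H]. The other ones cancel in pairs modulo 2, so that a sum
    [\sum_j pmul j * y j] with [y] invariant under the double dual is congruent to
    [pmul o * y o]. The multiplicity of [X_i] in the free module [H (x) X_i] is such a
    sum and is even, so [pmul o] is even; the dimension of [H] is another. *)
Lemma exists_odd_pmul : odd p -> (exists2 i, i != o & sg i = i) ->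
  exists j, [/\ j != o, sg j = j & odd (pmul j)].
Proof.
move=> op [i io si]; apply: contrapT => h.
have ev j : j != o -> sg j = j -> ~~ odd (pmul j).
  by move=> jo sj; apply/negP => oj; apply: h; exists j.
have so : sg o = o.
  apply/sg_fix; apply: mod_iso_trans (iso_ddual Xo) _; apply: mod_iso_trans (mod_iso_sym Xo).
  exists \1%VF; split; first by exists id => x; rewrite id_lfunE.
  by move=> a x; rewrite !id_lfunE /= !counit_antipode.
have key (y : 'I_r -> nat) : (forall j, y (sg j) = y j) ->
    odd (\sum_j pmul j * y j) = odd (pmul o * y o).
  move=> sy; rewrite (odd_sum_inv sgK) => [|j]; last by rewrite sg_pmul sy.
  rewrite (bigD1 o) ?so //= oddD.
  suff -> : odd (\sum_(j | (sg j == j) && (j != o)) pmul j * y j) = false by rewrite addbF.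
  apply/negbTE; rewrite (@big_ind _ (fun n => ~~ odd n)) //.
    by move=> a b ea eb; rewrite oddD (negbTE ea) (negbTE eb).
  by move=> j /andP[/eqP sj jo]; rewrite oddM (negbTE (ev j jo sj)).
have := key _ (fun j => sg_tmul j si); rewrite sum_pmul_tmul tmul_o re.
rewrite eqxx muln1 oddM (negbTE (ev i io si)) => /esym oo.
by have := key _ sg_sdim; rewrite sum_pmul_sdim op oddM oo.
Qed.

End Multiplicities.

(** * Determinants of diagonally dominated integer matrices *)

Section MMatrix.
Variable R : realFieldType.

Definition offdiag_le0 n (M : 'M[R]_n) := forall i j, i != j -> M i j <= 0.

Lemma mmatrix_diag_ge0 n (M : 'M[R]_n) (w : 'cV[R]_n) : offdiag_le0 M ->
  (forall i, 0 < w i 0) -> (forall i, 0 <= (M *m w) i 0) -> forall i, 0 <= M i i.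
Proof.
move=> Mo w0 Mw i; rewrite -(pmulr_lge0 _ (w0 i)); apply: le_trans (Mw i) _.
rewrite mxE (bigD1 i) //= gerDl; apply: sumr_le0 => j ji.
by rewrite mulr_le0_ge0 ?Mo 1?eq_sym // ltW.
Qed.

(** Hadamard's inequality for M-matrices, by Gaussian elimination: the Schur
    complement of a diagonal entry is again an M-matrix, with a smaller diagonal. *)
Lemma mmatrix_det n (M : 'M[R]_n) (w : 'cV[R]_n) : offdiag_le0 M ->
  (forall i, 0 < w i 0) -> (forall i, 0 <= (M *m w) i 0) ->
  0 <= \det M <= \prod_i M i i.
Proof.
elim: n => [|n IH] in M w *; first by rewrite det_mx00 big_ord0 ler01 lexx.
move=> Mo w0 Mw; have Md := mmatrix_diag_ge0 Mo w0 Mw.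
pose b := M 0 0; pose C : 'M[R]_n := \matrix_(i, j) M (lift 0 i) (lift 0 j).
pose u : 'rV[R]_n := \row_j M 0 (lift 0 j); pose v : 'cV[R]_n := \col_i M (lift 0 i) 0.
have ME : M = block_mx b%:M u v C :> 'M[R]_(1 + n).
  apply/matrixP => i j; rewrite !mxE; case: splitP => i' ei; rewrite !mxE;
    case: splitP => j' ej; rewrite !mxE ?ord1 ?eqxx ?mulr1n;
    congr (M _ _); apply: val_inj; rewrite /= ?ei ?ej ?ord1 //=.
have dM : \det M = \det (block_mx b%:M u v C : 'M[R]_(1 + n)) by rewrite -ME.
pose w' : 'cV[R]_n := \col_i w (lift 0 i) 0.
have u0 j : u 0 j <= 0 by rewrite mxE Mo.
have v0 i : v i 0 <= 0 by rewrite mxE Mo // eq_sym.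
have w'0 i : 0 < w' i 0 by rewrite mxE.
have Mw0 : 0 <= b * w 0 0 + (u *m w') 0 0.
  have := Mw 0; rewrite mxE big_ord_recl mxE; congr (_ <= _ + _).
  by apply: eq_bigr => j _; rewrite !mxE.
have Mwi i : 0 <= v i 0 * w 0 0 + (C *m w') i 0.
  have := Mw (lift 0 i); rewrite mxE big_ord_recl !mxE; congr (_ <= _ + _).
  by apply: eq_bigr => j _; rewrite !mxE.
have prodE : \prod_i M i i = b * \prod_i C i i.
  by rewrite big_ord_recl; congr (_ * _); apply: eq_bigr => i _; rewrite mxE.
have b0 : 0 <= b by apply: Md.
(* Without a pivot the whole first row vanishes. *)
have [bz|bn] := eqVneq b 0.
  have uz : u = 0.
    apply/rowP => j; rewrite [RHS]mxE; apply/eqP; rewrite eq_le u0 /=.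
    move: Mw0; rewrite bz mul0r add0r mxE (bigD1 j) //= => h.
    have : 0 <= u 0 j * w' j 0.
      apply: le_trans h _; rewrite gerDl; apply: sumr_le0 => l _.
      by rewrite mulr_le0_ge0 ?u0 // ltW.
    by rewrite pmulr_lge0.
  by rewrite prodE dM uz det_lblock det_scalar1 bz !mul0r lexx.
have bp : 0 < b by rewrite lt_neqAle eq_sym bn.
pose C' := C - b^-1 *: (v *m u).
have detE : \det M = b * \det C'.
  pose E : 'M[R]_(1 + n) := block_mx 1%:M 0 (- (b^-1 *: v)) 1%:M.
  have : \det (E *m (block_mx b%:M u v C : 'M[R]_(1 + n))) = \det (block_mx b%:M u 0 C' : 'M[R]_(1 + n)).
    congr (\det _); rewrite mulmx_block !mul1mx !mul0mx !addr0.
    rewrite mulNmx mul_mx_scalar scalerA mulfV // scale1r addNr.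
    by rewrite mulNmx -scalemxAl addrC.
  by rewrite det_mulmx -dM /E det_lblock !det1 !mul1r det_ublock det_scalar1.
have C'E i j : C' i j = C i j - b^-1 * (v i 0 * u 0 j).
  by rewrite !mxE big_ord1 !mxE.
have vu i j : 0 <= b^-1 * (v i 0 * u 0 j).
  by rewrite mulr_ge0 ?invr_ge0 ?mulr_le0.
have C'o : offdiag_le0 C'.
  move=> i j ij; rewrite C'E subr_le0; apply: le_trans (vu i j).
  by rewrite mxE Mo // (inj_eq (@lift_inj _ 0)).
have C'w i : 0 <= (C' *m w') i 0.
  have -> : (C' *m w') i 0 = (C *m w') i 0 - b^-1 * (v i 0 * (u *m w') 0 0).
    rewrite mulmxBl mxE [X in _ + X]mxE -scalemxAl -mulmxA; congr (_ - _).
    by rewrite mxE mxE big_ord1.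
  have : b^-1 * v i 0 * (b * w 0 0 + (u *m w') 0 0) <= 0.
    by rewrite mulr_le0_ge0 // mulr_ge0_le0 // invr_ge0.
  rewrite mulrDr -!mulrA [v i 0 * (b * _)]mulrCA mulKf // => h.
  have := Mwi i; move: h; set x := b^-1 * _; lra.
have /andP[d0 d1] := IH C' w' C'o w'0 C'w.
rewrite detE prodE mulr_ge0 //= ler_wpM2l // (le_trans d1) // ler_prod // => i _.
rewrite (mmatrix_diag_ge0 C'o w'0 C'w) /= C'E gerDl oppr_le0; exact: vu.
Qed.

End MMatrix.

(** The fusion data of a finite tensor category, numerically: [N i l] is the
    multiplicity of [X_l] in [X_i (x) X_j], and [a] and [dd] are the multiplicities in the
    regular object and the dimensions, which are the Perron-Frobenius eigenvectors. *)
Section FusionBound.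
Variables (r : nat) (N : 'I_r -> 'I_r -> nat) (a dd : 'I_r -> nat) (o j : 'I_r).
Let d := dd j.
Hypotheses (oj : o != j) (dd0 : forall i, (0 < dd i)%N).
Hypothesis aN : forall l, (\sum_i a i * N i l = a l * d)%N.
Hypothesis Ndd : forall i, (\sum_l N i l * dd l = dd i * d)%N.
Hypothesis No : forall l, N o l = (j == l).
Hypothesis conn : forall Z : {set 'I_r}, Z != finset.set0 ->
  (forall i l, i \in Z -> (0 < N i l)%N -> l \in Z) -> o \in Z.

Let out (i : 'I_r) := (i == o) || (i == j).
(* The singular matrix [d - N] restricted to the indices other than [o] and [j], and
   completed by the identity. *)
Let B : 'M[int]_r := \matrix_(i, l)
  if out i || out l then (i == l)%:R else (i == l)%:R * d%:Z - (N i l)%:Z.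

Let Ndd' (R : realDomainType) i : \sum_l (N i l)%:R * (dd l)%:R = (dd i)%:R * d%:R :> R.
Proof. by rewrite -natrM -Ndd natr_sum; apply: eq_bigr => l _; rewrite natrM. Qed.

(** The maximum principle: where a null vector is largest relative to [dd], so it is at
    all neighbours, hence at [o], where it is zero. *)
Lemma fusion_det_neq0 : \det B != 0.
Proof.
have <- : ((\det B)%:~R == 0 :> rat) = (\det B == 0) by rewrite intr_eq0.
rewrite -(det_map_mx (intr : {rmorphism int -> rat})) -det_tr.
apply/negP => /det0P[v v0 vB].
have vE i : if out i then v 0 i = 0
    else d%:R * v 0 i = \sum_l (N i l)%:R * v 0 l.
  have Bv i' : \sum_l (B i' l)%:~R * v 0 l = 0.
    have /= := congr1 (fun u : 'rV_r => u 0 i') vB; rewrite mxE [X in _ = X]mxE => e.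
    by rewrite -[RHS]e; apply: eq_bigr => l _; rewrite !mxE mulrC.
  have vz i' : out i' -> v 0 i' = 0.
    move=> oi; rewrite -(Bv i') (bigD1 i') //= mxE oi eqxx mul1r big1 ?addr0 // => l li.
    by rewrite mxE oi eq_sym (negbTE li) mul0r.
  case oi: (out i); first exact: vz.
  apply/eqP; rewrite -subr_eq0; apply/eqP; rewrite -[RHS](Bv i).
  rewrite (bigD1 i) //= [RHS](bigD1 i) //= opprD addrA.
  rewrite mxE oi eqxx /= mul1r rmorphB /= mulrBl; congr (_ + _).
  rewrite -sumrN; apply: eq_bigr => l li; rewrite mxE oi /=.
  case ol: (out l); first by rewrite (vz l ol) !mulr0 oppr0.
  by rewrite eq_sym (negbTE li) mul0r sub0r rmorphN mulNr.
have dQ i : 0 < (dd i)%:R :> rat by rewrite ltr0n.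
pose t i : rat := `|v 0 i| / (dd i)%:R.
have [m _ tm] := @arg_maxP _ _ _ o xpredT t isT.
have {}tm i : t i <= t m by apply: tm.
have vt i : `|v 0 i| = t i * (dd i)%:R by rewrite divfK // gt_eqF.
have tm0 : 0 < t m.
  rewrite lt_neqAle eq_sym; apply/andP; split; last by rewrite divr_ge0 // ltW.
  apply: contra v0 => /eqP tm0; apply/eqP/rowP => i; apply/eqP.
  by rewrite mxE -normr_le0 vt mulr_le0_ge0 ?(ltW (dQ i)) // -tm0 tm.
pose Z := [set i | t i == t m]%SET.
suff : o \in Z.
  have := vE o; rewrite /out eqxx inE => vo.
  by rewrite {1}/t vo normr0 mul0r => /eqP h; rewrite -h ltxx in tm0.
apply: conn => [|i l].
  by apply/set0Pn; exists m; rewrite inE.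
rewrite !inE => /eqP ti Nil.
have := vE i; case: ifP => [_ vi|_ vi].
  by rewrite -ti /t vi normr0 mul0r ltxx in tm0.
have Nle (l' : 'I_r) : 0 <= (N i l')%:R * ((t m - t l') * (dd l')%:R).
  by rewrite mulr_ge0 // mulr_ge0 ?(ltW (dQ _)) // subr_ge0 tm.
have : \sum_l' (N i l')%:R * ((t m - t l') * (dd l')%:R) <= 0.
  under eq_bigr => l' _ do rewrite mulrBl mulrBr [X in X - _]mulrCA -vt.
  rewrite sumrB -mulr_sumr Ndd' -ti mulrA -vt -(@normr_nat rat d) -normrM mulrC vi subr_le0.
  by apply: le_trans (ler_norm_sum _ _ _) _; apply: ler_sum => l' _; rewrite normrM normr_nat.
rewrite (bigD1 l) //= => h.
have {h} : (N i l)%:R * ((t m - t l) * (dd l)%:R) <= 0.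
  by apply: le_trans h; rewrite lerDl sumr_ge0.
by rewrite pmulr_rle0 ?ltr0n // pmulr_lle0 // subr_le0 eq_le tm => ->.
Qed.

Lemma fusion_det_le : (absz (\det B) <= d ^ (r - 2))%N.
Proof.
pose w : 'cV[rat]_r := \col_i (dd i)%:R.
have BR : \det (map_mx intr B) = (\det B)%:~R :> rat by rewrite -det_map_mx.
have : 0 <= \det (map_mx intr B : 'M[rat]_r) <= \prod_i (map_mx intr B : 'M[rat]_r) i i.
  apply: (@mmatrix_det _ _ _ w) => [i l il|i|i].
  - rewrite !mxE (negbTE il) mul0r sub0r lerz0; by case: ifP.
  - by rewrite mxE ltr0n.
  rewrite mxE; case oi: (out i).
    rewrite sumr_ge0 // => l _; rewrite !mxE oi /=.
    by case: eqP => _; rewrite ?mul0r // mul1r ler0n.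
  apply: (@le_trans _ _ (\sum_l ((i == l)%:R * d%:R - (N i l)%:R) * (dd l)%:R)).
    under eq_bigr => l _ do rewrite mulrBl.
    rewrite sumrB Ndd' (bigD1 i) //= eqxx mul1r big1 => [|l li].
      by rewrite addr0 mulrC subrr.
    by rewrite eq_sym (negbTE li) !mul0r.
  apply: ler_sum => l _; rewrite !mxE oi /= ler_wpM2r //.
  case ol: (out l); last first.
    by rewrite intrB intrM; case: (i == l); rewrite ?mul1r ?mul0r.
  have il : i != l by apply: contraFneq oi => ->.
  by rewrite (negbTE il) mul0r sub0r oppr_le0.
rewrite BR => /andP[D0 D1].
have : (absz (\det B))%:R <= (d ^ (r - 2))%:R :> rat.
  rewrite -[X in X <= _]/((absz (\det B))%:R) natr_absz ger0_norm -?(ler0z rat) //.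
  apply: le_trans D1 _; rewrite (bigD1 o) //= (bigD1 j) /=; last by rewrite eq_sym.
  rewrite !mxE /out !eqxx orbT /= !mul1r natrX.
  have -> : (r - 2 = #|[pred i : 'I_r | (i != o) && (i != j)]|)%N.
    rewrite -[r in LHS]card_ord -(cardC (pred2 o j)) card2 oj addKn.
    by apply: eq_card => i; rewrite !inE negb_or.
  rewrite -prodr_const; apply: ler_prod => i /andP[io ij].
  rewrite mxE [B i i]mxE /out (negbTE io) (negbTE ij) /= eqxx mul1r.
  rewrite ler0z subr_ge0 intrB gerBl ler0n andbT lez_nat.
  have := Ndd i; rewrite (bigD1 i) //= => h.
  by rewrite -(leq_pmul2r (dd0 i)) [(d * _)%N]mulnC -h leq_addr.
by rewrite ler_nat.
Qed.

(** The vector [a] restricted to the indices other than [o] and [j] is mapped by [B] to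
    a multiple of [a j], since [N o l = 0] there; multiply by the adjugate. Column [j] of
    the eigenvector equation then expresses [a o]. *)
Lemma fusion_dvd l : (a j %| absz (\det B) * a l)%N.
Proof.
pose at_ : 'rV[int]_r := \row_i if out i then 0 else (a i)%:Z.
pose u : 'rV[int]_r := \row_l if out l then 0 else (N j l)%:Z.
have aNj l' : (a l' * d = a o * N o l' + (a j * N j l' +
    \sum_(i | (i != o) && (i != j)) a i * N i l'))%N.
  by rewrite -aN (bigD1 o) //= (bigD1 j) //= eq_sym.
have atB : at_ *m B = (a j)%:Z *: u.
  apply/rowP => l'; rewrite mxE [RHS]mxE [X in _ = _ * X]mxE.
  case ol: (out l').
    rewrite mulr0; apply: big1 => i _; rewrite !mxE ol orbT.
    have [->|_] := eqVneq i l'; last by rewrite mulr0.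
    by rewrite ol mul0r.
  rewrite (eq_bigr (fun i => if (i != o) && (i != j) then
     (a i)%:Z * ((i == l')%:R * d%:Z) - (a i)%:Z * (N i l')%:Z else 0)); last first.
    move=> i _; rewrite !mxE -negb_or -/(out i) ol orbF.
    by case: (out i); rewrite /= ?mul0r // mulrBr.
  rewrite -big_mkcond /= sumrB.
  have /norP[lo lj] := negbT ol.
  rewrite (bigD1 l') ?lo ?lj //= eqxx mul1r big1 => [|i /andP[_ il]]; last first.
    by rewrite (negbTE il) mul0r mulr0.
  have := aNj l'; rewrite No eq_sym (negbTE lj) muln0 add0n addr0.
  rewrite -!PoszM => ->; rewrite PoszD (big_morph _ PoszD (erefl 0)).
  by rewrite (eq_bigl (fun i => (i != o) && (i != j))) ?addrK // => i; rewrite negb_or.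
have key i : (a j %| absz (\det B * at_ 0 i)%R)%N.
  have : at_ *m B *m \adj B = \det B *: at_ by rewrite -mulmxA mul_mx_adj mul_mx_scalar.
  rewrite atB -scalemxAl => /rowP/(_ i); rewrite mxE [RHS]mxE => <-.
  by rewrite abszM dvdn_mulr.
have key' i : i != o -> (a j %| absz (\det B) * a i)%N.
  move=> io; have [->|ij] := eqVneq i j; first by rewrite dvdn_mull.
  by have := key i; rewrite mxE /out (negbTE io) (negbTE ij) abszM.
have [->|/key' //] := eqVneq l o.
have : (a j %| absz (\det B) * (a j * d))%N by rewrite dvdn_mull ?dvdn_mulr.
rewrite aNj No eqxx muln1 !mulnDr dvdn_addl //.
apply: dvdn_add; first by rewrite mulnCA dvdn_mulr.
rewrite big_distrr /= dvdn_sum // => i /andP[io _].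
by rewrite mulnA dvdn_mulr ?key'.
Qed.

(** By [fusion_dvd], [a j] divides [det B] times the prime [\sum_l a l * dd l], and is
    smaller than that prime. *)
Lemma fusion_bound : prime (\sum_l a l * dd l) -> (0 < a j < \sum_l a l * dd l)%N ->
  (a j <= d ^ (r - 2))%N.
Proof.
move=> pr /andP[aj0 aj1]; apply: leq_trans fusion_det_le.
apply: dvdn_leq; first by rewrite absz_gt0 fusion_det_neq0.
have : (a j %| absz (\det B) * \sum_l a l * dd l)%N.
  by rewrite big_distrr /= dvdn_sum // => l _; rewrite mulnA dvdn_mulr ?fusion_dvd.
rewrite Gauss_dvdl // coprime_sym prime_coprime //.
by apply/negP => /(dvdn_leq aj0); rewrite leqNgt aj1.
Qed.

End FusionBound.

(** * Multiplicities of self-double-dual modules *)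

Section IdempotentTrace.
Context (k : fieldType) (V : vectType k).
Implicit Types P Q : 'End(V).

Lemma ltr_rank1 (ph : V -> k^o) (u : V) : linear ph -> ltr (fun x => ph x *: u) = ph u.
Proof.
move=> lp; rewrite [in RHS](coord_vbasis (memvf u)) (linS _ _ lp).
apply: eq_bigr => i _; rewrite linearZ (linZ _ _ lp); apply: mulrC.
Qed.

(** In positive characteristic the trace thus determines the rank modulo that prime. *)
Lemma ltr_idem P : (P \o P)%VF = P -> ltr P = (\dim (limg P))%:R.
Proof.
move=> PP; pose B := vbasis (limg P).
have PE x : P x = \sum_i (coord B i (P x) *: B`_i).
  by apply: coord_vbasis; apply: memv_img; apply: memvf.
rewrite (eq_ltr PE) /ltr.
under eq_bigr => l _ do rewrite linear_sum.
rewrite exchange_big /=.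
transitivity (\sum_(i < \dim (limg P)) (1 : k^o)); last first.
  by rewrite sumr_const card_ord.
apply: eq_bigr => i _.
have lB : linear (fun x => coord B i (P x) : k^o) by lin.
rewrite -[LHS]/(ltr (fun x => (coord B i (P x) : k) *: B`_i)) (ltr_rank1 _ lB).
have /memv_imgP[y _ e] : B`_i \in limg P by apply: vbasis_mem; rewrite mem_nth ?size_tuple.
have -> : P B`_i = B`_i by rewrite e -comp_lfunE PP.
rewrite (coord_free i i (basis_free (vbasisP _))).
by rewrite eqxx.
Qed.

Lemma dim_limg_add P Q : (P \o P)%VF = P -> (Q \o Q)%VF = Q ->
    (P \o Q)%VF = 0 -> (Q \o P)%VF = 0 ->
  \dim (limg (P + Q)) = (\dim (limg P) + \dim (limg Q))%N.
Proof.
move=> PP QQ PQ QP; rewrite -dimv_disjoint_sum; last first.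
  apply/eqP; rewrite -subv0; apply/subvP => _ /memv_capP[/memv_imgP[x _ ->] /memv_imgP[y _ e]].
  by rewrite -PP comp_lfunE e -comp_lfunE PQ zero_lfunE mem0v.
congr (\dim _); apply/eqP; rewrite eqEsubv; apply/andP; split; apply/subvP => z.
  by case/memv_imgP=> x _ ->; rewrite add_lfunE memv_add ?memv_img ?memvf.
case/memv_addP => _ /memv_imgP[x _ ->] [_ /memv_imgP[y _ ->] ->].
apply/memv_imgP; exists (P x + Q y); rewrite ?memvf // add_lfunE !linearD /=.
rewrite -!comp_lfunE PP QQ PQ QP !zero_lfunE; by rewrite addr0 add0r.
Qed.

End IdempotentTrace.

Section SelfDual.
Context (k : closedFieldType) (H : hopfAlgType k) (r : nat).
Variables (X : 'I_r -> amod H) (e : 'I_r -> H) (o : 'I_r).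
Hypotheses (aX : all_simples X) (ie : simple_idems X e) (Xo : mod_iso (X o) (triv_mod H)).
Hypotheses (pr : prime (\dim {:H})) (nc : ~ comm_cocomm H).
Local Notation S := (@antipode k H).
Local Notation reg := (regular_mod H).
Local Notation p := (\dim {:H}).

Let ee j : e j * e j = e j := ie.1 j.
Let re i j : rk (e j) (X i) = (i == j) := ie.2 i j.

Lemma ntriv j : j != o -> ~ mod_iso (X j) (triv_mod H).
Proof.
move=> jo h; have [_ nX _] := aX; move/eqP: jo; apply.
by apply: nX; apply: mod_iso_trans h (mod_iso_sym Xo).
Qed.

Lemma additive_tower (W : amod H) n : additive_fun (fun V => rk (e o) (tower W n V)).
Proof.
elim: n => [|n IH] U V Q s; first exact: additive_rk (ee o) _ _ _ s.
exact: IH _ _ _ (ses_tmod W s).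
Qed.

(** If the modules [X_i] with [i] in [Z] reproduce one another under tensoring with [X_j]
    and are nontrivial, the trivial module occurs in none of the [X_i (x) X_j^n], against
    [tower_faithful]. *)
Lemma tower_connected j (Z : {set 'I_r}) : j != o -> Z != finset.set0 ->
  (forall i l, i \in Z -> (0 < tmul_mx X e (X j) i l)%N -> l \in Z) -> o \in Z.
Proof.
move=> jo /set0Pn[i iZ] cZ; apply: contraT => oZ.
have Z0 n : forall i, i \in Z -> rk (e o) (tower (X j) n (X i)) = 0%N.
  elim: n => [|n IH] {iZ}i iZ /=; first by rewrite re; case: eqP iZ oZ => // -> ->.
  rewrite (additive_expand _ aX ie (additive_tower (X j) n)) big1 // => l _.
  have [|/(cZ _ _ iZ)/IH ->] := posnP (tmul_mx X e (X j) i l); last by rewrite muln0.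
  by rewrite /tmul_mx => ->.
have [[Xi0 _] sX] : simple_mod (X i) /\ simple_mod (X j) by case: aX => sX _ _; split.
have [n] := tower_faithful pr sX (ntriv jo) (idem_neq0 ie o) Xi0; case.
have /eqP := Z0 n i iZ; rewrite dimv_eq0 => /eqP l0.
apply/lfunP => v; apply/eqP; rewrite zero_lfunE -memv0 -l0; apply: memv_img; exact: memvf.
Qed.

Lemma pmul_lt_p j : j != o -> (pmul e j < p)%N.
Proof.
move=> jo; rewrite -(sum_pmul_sdim aX ie) (bigD1 o) //= (bigD1 j) //= addnA -add1n.
apply: leq_trans (leq_addr _ _).
by rewrite leq_add ?muln_gt0 ?(pmul_gt0 ie) ?leq_pmulr ?(sdim_gt0 aX).
Qed.

Lemma pmul_le_exp j : j != o -> (pmul e j <= sdim X j ^ (r - 2))%N.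
Proof.
move=> jo.
have dj l : (0 < sdim X l)%N by apply: sdim_gt0 aX l.
apply: (@fusion_bound r (tmul_mx X e (X j)) (pmul e) (sdim X) o j) => //.
- by rewrite eq_sym.
- by move=> l; rewrite (sum_pmul_tmul aX ie).
- by move=> i; rewrite (sum_tmul_sdim aX ie).
- by move=> l; rewrite (tmul_o ie Xo) re.
- by move=> Z; apply: tower_connected.
- by rewrite (sum_pmul_sdim aX ie).
by rewrite (sum_pmul_sdim aX ie) (pmul_gt0 ie) pmul_lt_p.
Qed.

(** A module of dimension 1 is a character, and characters are trivial. *)
Lemma sdim_gt1 j : j != o -> (1 < sdim X j)%N.
Proof.
move=> jo; rewrite ltn_neqAle (sdim_gt0 aX) andbT eq_sym; apply/eqP => d1.
case: (ntriv jo); pose x := vpick {:X j}.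
have x0 : x != 0 by rewrite vpick0 -dimv_eq0 [\dim _]d1.
have xf : <<[:: x]>>%VS = {:X j}%VS.
  by apply/eqP; rewrite eqEdim subvf span_seq1 dim_vline x0 [\dim _]d1.
have fx : free [:: x] by rewrite seq1_free.
pose c := coord [tuple x] 0.
have cE y : y = c y *: x.
  have : y \in <<[tuple x]>>%VS by have := memvf y; rewrite -xf.
  by move/coord_span; rewrite big_ord1 => {1}->.
have cZ z y : c (z *: y) = z * c y by apply: linearZ.
have cx : c x = 1 by rewrite /c (coord_free 0 0 fx).
have la : linear (fun a => c (act (X j) a x) : k^o) by lin.
have aE a y : act (X j) a y = (counit a : k) *: y.
  have <- : hev (lfn la : hdual H) a = counit a.
    apply: (char_trivial pr nc) => [|a1 a2]; rewrite /hev !(lfnE la) ?act_one //.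
    by rewrite act_mul {1}[act (X j) a2 x]cE [act _ _ (_ *: x)]linearZ cZ mulrC.
  rewrite /hev (lfnE la) {1}[y]cE [act _ _ (_ *: x)]linearZ /= [act (X j) a x]cE scalerA mulrC.
  by rewrite -scalerA -!cE.
have lc : linear (c : X j -> k^o) by lin.
exists (lfn lc); split=> [|a y].
  by exists (fun z : k^o => (z : k) *: x) => y; rewrite (lfnE lc) -?cE // cZ cx [LHS]mulr1.
by rewrite !(lfnE lc) aE cZ scale_lfunE id_lfunE.
Qed.

Section QPart.
Variables (q : nat) (sg : 'I_r -> 'I_r) (j : 'I_r).
Hypothesis sgP : forall i, mod_iso (ddual (X i)) (X (sg i)).
Hypotheses (cq : q \in [pchar k]) (q2 : (2 < q)%N) (jo : j != o).
Local Notation V := (X j).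
Local Notation S2 x := (S (S x)).

Let S4 := prime_antipode4 pr nc.

Lemma S2M x y : S2 (x * y) = S2 x * S2 y.
Proof. by rewrite !antipodeM. Qed.

Lemma S2X x n : S2 (x ^+ n) = S2 x ^+ n.
Proof. by elim: n => [|n IH]; rewrite ?expr0 ?antipode1 // !exprS S2M IH. Qed.

Lemma S2_idem_of x n : S2 x = x -> S2 (idem_of x n) = idem_of x n.
Proof.
by move=> sx; rewrite /idem_of !linearB /= !antipode1 S2X !linearB /= !antipode1 S2X sx.
Qed.

Lemma two_neq0 : 2%:R != 0 :> k.
Proof. by rewrite -(dvdn_pcharf cq) gtnNdvd. Qed.

(** The isomorphism [X^** -> X], normalised to have square 1: its square commutes with
    [H], as [S^4 = 1], and so is a scalar. *)
Lemma ddual_involution : mod_iso (ddual V) V -> exists2 g : 'End(V),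
  (forall x, g (g x) = x) & forall a x, g (act V (S2 a) x) = act V a (g x).
Proof.
case=> f [bf hf]; pose h : 'End(V) := f.
have hS a x : h (act V (S2 a) x) = act V a (h x) by apply: hf.
have sV : simple_mod V by case: aX.
have [c hh] : exists c, forall x, (h \o h)%VF x = c *: x.
  by apply: schur sV _ => a x; rewrite !comp_lfunE -hS -hS S4.
have c0 : c != 0.
  apply/eqP => c0; case: sV => + _; apply; apply/eqP; rewrite -vpick0; apply/eqP.
  apply: (bij_inj bf); rewrite [RHS]linear0; apply: (bij_inj bf); rewrite [RHS]linear0.
  by have := hh (vpick {:V}); rewrite c0 scale0r comp_lfunE.
have [t tc] : exists t : k, t ^+ 2 = c.
  have [t] := solve_monicpoly (fun i => if i == 0%N then c else 0) (isT : 0 < 2)%N.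
  by rewrite !big_ord_recl big_ord0 /= mul0r !addr0 expr0 mulr1; exists t.
have t0 : t != 0 by apply: contraNneq c0 => t0; rewrite -tc t0 expr0n.
exists (t^-1 *: h) => [x|a x]; rewrite !scale_lfunE ?hS ?linearZ //=.
by rewrite -comp_lfunE hh !scalerA -invfM -expr2 tc mulVf // scale1r.
Qed.

(** If [g] is the involution and [v] an eigenvector, a projector [a] to the line of [v]
    and its conjugate [S^2 a] by [g] have the same image; their mean is a projector too,
    fixed by [S^2], and it lifts to an idempotent by a polynomial. *)
Lemma S2_fixed_idem : mod_iso (ddual V) V ->
  exists e', [/\ e' * e' = e', S2 e' = e' & forall i, rk e' (X i) = (i == j)].
Proof.
move=> ih; have [g gg gS] := ddual_involution ih.
have [sX nX _] := aX; have [V0 _] := sX j.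
have [c [v [v0 gv]]] := lfun_eigen g V0.
have c2 : c * c = 1.
  have := gg v; rewrite gv linearZ /= gv scalerA => /eqP.
  by rewrite -{2}[v]scale1r -subr_eq0 -scalerBl scaler_eq0 (negbTE v0) orbF subr_eq0 => /eqP.
have [s [vs vsf]] := line_compl v0.
have [a [av as0 a0]] := simple_projector sX nX vs.
pose b := 2%:R^-1 *: (a + S2 a).
have Sb : S2 b = b by rewrite /b !linearZ /= !linearD /= S4 addrC.
have actS x y : act V (S2 x) y = g (act V x (g y)) by rewrite -gS gg.
have bv : act V b v = v.
  rewrite /b linearZ linearD /= scale_lfunE add_lfunE actS gv [act _ a (c *: v)]linearZ /= av.
  by rewrite linearZ /= gv scalerA c2 scale1r -mulr2n -scaler_nat scalerA mulVf ?scale1r ?two_neq0.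
have aline y : act V a y \in <[v]>%VS.
  have /memv_addP[_ /vlineP[z ->] [u us ->]] : y \in (<[v]> + << s >>)%VS by rewrite vsf memvf.
  rewrite linearD /= [act _ _ (_ *: v)]linearZ /= av.
  suff -> : act V a u = 0 by rewrite addr0 memvZ ?memv_line.
  apply/eqP; rewrite -memv_ker; move: u us; apply/subvP/span_subvP => u us.
  by rewrite memv_ker as0.
have bline y : act V b y \in <[v]>%VS.
  rewrite /b linearZ linearD /= scale_lfunE add_lfunE actS memvZ // memvD //.
  by have /vlineP[z ->] := aline (g y); rewrite linearZ /= gv scalerA memvZ ?memv_line.
have bb : act V (b * b) = act V b.
  apply/lfunP => y; rewrite act_mul; have /vlineP[z ->] := bline y.
  by rewrite linearZ /= bv.
have rb : rk b V = 1%N.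
  rewrite /rk; suff -> : limg (act V b) = <[v]>%VS by rewrite dim_vline v0.
  apply/eqP; rewrite eqEsubv; apply/andP; split; first by apply/subvP => _ /memv_imgP[y _ ->].
  by rewrite -memvE -{1}bv memv_img ?memvf.
have b0 i : i != j -> act (X i) b = 0.
  move=> ij; rewrite /b linearZ linearD /= a0 // add0r.
  suff -> : act (X i) (S2 a) = 0 by rewrite scaler0.
  have [f [[f' fK _] hf]] := sgP i.
  have lj : sg i != j by rewrite (inv_eq (sgK aX pr nc sgP)) (sg_fix aX sgP j).1.
  apply/lfunP => y; apply: (can_inj fK); rewrite [LHS]hf a0 // !zero_lfunE.
  by rewrite [RHS]linear0.
have [n [ee' re' _]] := rk_idem_of aX bb rb b0.
by exists (idem_of b n); split=> //; apply: S2_idem_of.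
Qed.

(** Substituting [y x] for [x], the element [S^2 x - x] maps [X_j] into the largest
    submodule killed by [e'], which is zero. *)
Lemma S2_trivial_of_idem e' : rk e' V != 0%N -> (forall x, e' * S2 x = e' * x) ->
  forall a, S2 a = a.
Proof.
move=> re' h; have [sX _ _] := aX.
apply: (S2_trivial pr (sX j) (ntriv jo)) => x; apply/eqP; rewrite -subr_eq0 -linearB.
pose P (u : V) := forall y, act V (e' * y) u = 0.
have [U UP] : exists U : {vspace V}, forall u, u \in U <-> P u.
  apply: vspace_of_pred => [y|c u u' hu hu' y]; first by rewrite linear0.
  by rewrite linearP /= hu hu' scaler0 addr0.
have [_ sV] := sX j.
have [|U0|UV] := sV U.
- apply/submodP => a u /UP hu; apply/UP => y.
  by rewrite -act_mul -mulrA.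
- apply/eqP/lfunP => u; rewrite zero_lfunE; apply/eqP; rewrite -memv0 -U0.
  apply/UP => y; rewrite -act_mul; suff -> : e' * y * (S2 x - x) = 0.
    by rewrite linear0 zero_lfunE.
  by apply/eqP; rewrite mulrBr subr_eq0 -{1}h -!mulrA -S2M h.
have /negP[] := re'; apply/eqP; rewrite /rk; suff -> : act V e' = 0 by rewrite lim0g dimv0.
apply/lfunP => u; have : P u by apply/UP; rewrite UV memvf.
by move/(_ 1); rewrite mulr1 zero_lfunE.
Qed.

(** On [e' H] the map [S^2] induces an involution [T], whose eigenspaces have dimensions
    [np] and [nm] with sum [pmul e j]. Its trace vanishes in characteristic [q], so that
    [np] and [nm] are congruent modulo [q]; they differ as their sum is odd. If [np] were
    zero, so would be [2 e']. If [nm] were zero, [S^2] would be trivial, and its trace [p]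
    would vanish: then [q = p], which is too large to divide [pmul e j]. *)
Lemma pmul_ge_q : ~ semisimple_alg H -> mod_iso (ddual V) V -> odd (pmul e j) ->
  (q + 2 <= pmul e j)%N.
Proof.
move=> nss ih od; have [e' [ee' Se' re']] := S2_fixed_idem ih.
have rE : rk e' reg = pmul e j.
  rewrite (additive_expand reg aX ie (additive_rk ee')) (bigD1 j) //= re' eqxx muln1.
  by rewrite big1 ?addn0 // => i ij; rewrite re' (negbTE ij) muln0.
have lT : linear (fun x : H => e' * S2 x) by lin.
pose L : 'End(H) := act reg e'; pose T : 'End(H) := lfn lT.
have LE x : L x = e' * x by rewrite /L act_reg.
have TE x : T x = e' * S2 x by rewrite /T (lfnE lT).
(* For [c = 1] and [c = -1], the projectors to the eigenspaces. *)
pose E c := 2%:R^-1 *: (L + c *: T).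
have EE c x : E c x = 2%:R^-1 *: (e' * x + c *: (e' * S2 x)).
  by rewrite scale_lfunE add_lfunE scale_lfunE LE TE.
have t0 := two_neq0.
have Ecd c d x : E c (E d x) =
    2%:R^-1 *: (2%:R^-1 *: ((1 + c * d) *: (e' * x) + (c + d) *: (e' * S2 x))).
  rewrite !EE; congr (_ *: _); rewrite !linearZ !linearD /= !linearZ /= !S2M Se' S4.
  rewrite -!scalerAr !mulrDr -!scalerAr !mulrA ee'.
  have sw z (w : H) : 2%:R^-1 *: (z *: w) = z *: (2%:R^-1 *: w) by rewrite !scalerA mulrC.
  rewrite [2%:R^-1 *: (_ + d *: _)]scalerDr sw scalerDr [c *: (d *: _)]scalerA.
  by rewrite !scalerDl scale1r [X in _ + _ + X]addrC addrACA [X in _ + X = _]addrC.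
have Eid c : c * c = 1 -> (E c \o E c)%VF = E c.
  move=> cc; apply/lfunP => x; rewrite comp_lfunE Ecd cc EE; congr (_ *: _).
  by rewrite -!mulr2n -[c *+ 2]mulr_natl -scalerA -scalerDr scalerA mulVf ?scale1r.
have E0 c : c * c = 1 -> (E c \o E (- c))%VF = 0.
  move=> cc; apply/lfunP => x; rewrite comp_lfunE Ecd mulrN cc !subrr !scale0r addr0.
  by rewrite !scaler0 zero_lfunE.
have o1 : -1 * -1 = 1 :> k by rewrite mulrNN mulr1.
pose np := \dim (limg (E 1)); pose nm := \dim (limg (E (-1))).
have nn : (np + nm = pmul e j)%N.
  rewrite -rE /rk -/L -dim_limg_add ?Eid ?E0 ?mulr1 //; last by rewrite -{2}[1]opprK E0.
  congr (\dim (limg _)); apply/lfunP => x; rewrite add_lfunE !EE LE -scalerDr.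
  by rewrite addrACA scale1r scaleN1r subrr addr0 -mulr2n -scaler_nat scalerA mulVf ?scale1r.
have nq : np%:R = nm%:R :> k.
  rewrite -[LHS]/(np%:R : k^o) -[RHS]/(nm%:R : k^o).
  rewrite -(ltr_idem (Eid _ (mulr1 1))) -(ltr_idem (Eid _ o1)).
  rewrite -[RHS]addr0 -(trace_S2 nss e') /ltr -big_split; apply: eq_bigr => i _ /=.
  rewrite -linearD !EE; congr (coord _ _ _).
  rewrite !scale1r scaleN1r scalerBr -addrA scalerDr; congr (_ + _); rewrite addrC.
  apply: (scalerI t0). rewrite scalerBr !scalerA mulfV // !scale1r.
  by rewrite -[2%:R]natr1 scalerDl scale1r addrK.
have n1 : (0 < np)%N.
  rewrite lt0n dimv_eq0; apply/negP => /eqP l0.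
  have : E 1 1 \in limg (E 1) by rewrite memv_img ?memvf.
  rewrite l0 memv0 EE mulr1 !antipode1 mulr1 scale1r -mulr2n -scaler_nat scalerA mulVf // scale1r.
  by move/eqP => e0; have := re' j; rewrite e0 /rk linear0 lim0g dimv0 eqxx.
have n2 : (0 < nm)%N.
  rewrite lt0n; apply/eqP => n20.
  have h x : e' * S2 x = e' * x.
    move/eqP: n20; rewrite dimv_eq0 => /eqP l0.
    have : E (-1) x \in limg (E (-1)) by rewrite memv_img ?memvf.
    rewrite l0 memv0 EE scaler_eq0 invr_eq0 (negbTE t0) scaleN1r subr_eq0 /=.
    by move/eqP.
  have S2id : forall a, S2 a = a by apply: (S2_trivial_of_idem _ h); rewrite re' eqxx.
  have : (p%:R == 0 :> k).
    have id_id : (\1 \o \1)%VF = \1%VF :> 'End(H) by rewrite comp_lfun1l.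
    have := ltr_idem id_id; rewrite lim1g => <-.
    apply/eqP; rewrite -(trace_S2 nss 1); apply: eq_ltr => x.
    by rewrite id_lfunE mul1r S2id.
  rewrite -(dvdn_pcharf cq) dvdn_prime2 ?(pcharf_prime cq) // => /eqP qp.
  have : (q %| np)%N by rewrite (dvdn_pcharf cq) nq n20.
  move/(dvdn_leq n1); rewrite leqNgt qp; case/negP.
  rewrite -[np]addn0 -n20 nn; exact: pmul_lt_p jo.
rewrite -nn; have : np != nm.
  by apply: contraTneq od => nE; rewrite -nn nE oddD addbb.
clearbody np nm; move: np nm n1 n2 nq {nn} => a b a0 b0 ab.
wlog lab : a b a0 b0 ab / (a <= b)%N.
  move=> W; case: (leqP a b) => [/W|/ltnW/W h nab]; first exact.
  by rewrite [(a + b)%N]addnC; apply: h; rewrite 1?eq_sym.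
move=> nab; have : (q %| b - a)%N.
  by rewrite (dvdn_pcharf cq) natrB // ab subrr.
move=> /dvdn_leq h; have {}h : (q <= b - a)%N by apply: h; rewrite subn_gt0 ltn_neqAle nab.
by rewrite -(subnK lab) addnCA leq_add // addnn (leq_double 1).
Qed.

End QPart.

End SelfDual.

(** * Real estimates *)

Section Estimates.
Variable R : realType.
Implicit Types x y : R.

(** With [w = lambertW y], the hypothesis gives [x ^ 2 <= e ^ w] and [2 ln x <= w], and
    [w e ^ w = y]. *)
Lemma lambert_bound x y : 0 <= y -> 0 < x -> x <= expR (1 / 2 * lambertW y) ->
  x ^+ 2 * (2 * ln x) <= y.
Proof.
move=> y0 x0 xw; have [w0 wE] := lambertWP y0; rewrite -[leRHS]wE.
have lx : 2 * ln x <= lambertW y.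
  by move: xw; rewrite -ler_ln ?posrE ?expR_gt0 // expRK; lra.
have x2 : x ^+ 2 <= expR (lambertW y).
  have -> : lambertW y = (1 / 2 * lambertW y) * 2%:R by field.
  by rewrite expRM_natr lerXn2r ?nnegrE ?expR_ge0 // ltW.
rewrite mulrC; have [l0|l0] := leP 0 (2 * ln x).
  by apply: ler_pM => //; rewrite exprn_ge0 // ltW.
apply: (@le_trans _ _ 0); last by rewrite mulr_ge0 ?expR_ge0.
by rewrite mulr_le0_ge0 ?ltW // exprn_gt0.
Qed.

(** Here [s = r - 1] and [N = p / (q + 2)]. The hypotheses give [d < N], hence
    [p <= N ^ s], which excludes the first inequality; and [s <= d (N - d) <= N ^ 2 / 4],
    hence [ln p <= (N ^ 2 / 4) ln N]. For [D = 2 ^ (2/3) N] the second inequality would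
    give [2 D ^ 2 ln D <= 2 ^ (13/3) ln p <= 2 D ^ 2 ln N], but [N < D]. *)
Lemma numeric_contra (s p d : nat) (N : R) : (2 <= d)%N -> (0 < s)%N -> (1 < p)%N ->
    d%:R + s%:R / d%:R <= N -> p%:R <= N * d%:R ^+ s.-1 ->
  ~ (N <= 2 `^ (- (2 / 3)) * p%:R `^ (1 / s%:R)) /\ ~ (N <= phi p%:R).
Proof.
move=> d2 s0 p1 Nd pN.
have d0 : 0 < d%:R :> R by rewrite ltr0n (leq_trans _ d2).
have s0' : 0 < s%:R :> R by rewrite ltr0n.
have p0 : 1 < p%:R :> R by rewrite ltr1n.
have dN : d%:R < N by apply: lt_le_trans Nd; rewrite ltrDl divr_gt0.
have N0 : 0 < N by apply: lt_trans dN.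
have d2' : 2 <= d%:R :> R by rewrite (ler_nat _ 2).
have pNs : p%:R <= N ^+ s.
  apply: (le_trans pN); rewrite -[in leRHS](prednK s0) exprS ler_pM2l //.
  by apply: lerXn2r; rewrite ?nnegrE ltW.
have sN : s%:R * 4 <= N ^+ 2.
  have : s%:R / d%:R <= N - d%:R by lra.
  rewrite ler_pdivrMr // => sd; apply: (@le_trans _ _ ((N - d%:R) * d%:R * 4)).
    by rewrite ler_wpM2r.
  rewrite -subr_ge0; have -> : N ^+ 2 - (N - d%:R) * d%:R * 4 = (N - 2 * d%:R) ^+ 2 by ring.
  exact: sqr_ge0.
have lnp : ln p%:R <= s%:R * ln N.
  have -> : s%:R * ln N = ln (N ^+ s) by rewrite lnXn // mulr_natl.
  by rewrite ler_ln ?posrE ?exprn_gt0 // (lt_trans _ p0).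
have two1 (c : R) : 0 < c -> 1 < 2 `^ c.
  move=> c0; have e : 1 `^ c = 1 :> R by rewrite powR1.
  by rewrite -[X in X < _]e; apply: gt0_ltr_powR; rewrite ?nnegrE ?ler01 ?ler0n ?ltr1n.
split=> [Np|Np].
  have : 2 `^ (- (2 / 3)) * p%:R `^ (1 / s%:R) <= 2 `^ (- (2 / 3)) * N.
    rewrite ler_wpM2l ?powR_ge0 //.
    have -> : N = (N ^+ s) `^ (1 / s%:R).
      by rewrite -powR_mulrn ?ltW // -powRrM mulrA mulr1 mulfV ?gt_eqF // powRr1 ?ltW.
    by rewrite ge0_ler_powR ?nnegrE ?divr_ge0 ?exprn_ge0 // ltW.
  move/(le_trans Np); apply/negP; rewrite -ltNge gtr_pMl // powRN.
  by rewrite invf_lt1 ?powR_gt0 ?two1.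
pose D := 2 `^ (2 / 3) * N.
have D0 : 0 < D by rewrite mulr_gt0 ?powR_gt0.
have DN : ln N < ln D by rewrite ltr_ln ?posrE // ltr_pMl // two1.
have lnN : 0 < ln N by rewrite ln_gt0 //; lra.
have : D <= expR (1 / 2 * lambertW (2 `^ (13 / 3) * ln p%:R)).
  by rewrite /D mulrC -ler_pdivlMr ?powR_gt0 // mulrC -powRN.
move/(lambert_bound _ D0) => h.
have {}h : D ^+ 2 * (2 * ln D) <= 2 `^ (13 / 3) * ln p%:R.
  by apply: h; rewrite mulr_ge0 ?powR_ge0 // ltW // ln_gt0.
have e : 2 `^ (13 / 3) * N ^+ 2 = 8 * D ^+ 2.
  rewrite /D exprMn [RHS]mulrA; congr (_ * N ^+ 2).
  rewrite -powR_mulrn ?powR_ge0 // -powRrM.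
  have -> : 8 = 2 `^ 3 :> R by rewrite (powR_mulrn 3) //; ring.
  by rewrite -powRD ?pnatr_eq0 ?implybT //; congr (_ `^ _); lra.
have : 2 `^ (13 / 3) * ln p%:R <= 2 `^ (13 / 3) * (N ^+ 2 / 4 * ln N).
  rewrite ler_wpM2l ?powR_ge0 //; apply: (le_trans lnp).
  by apply: ler_wpM2r; [exact: ltW | rewrite ler_pdivlMr].
rewrite 2!mulrA e => h2; have := le_trans h h2.
have -> : 8 * D ^+ 2 / 4 * ln N = D ^+ 2 * (2 * ln N) by field.
by rewrite ler_pM2l ?exprn_gt0 // ler_pM2l // leNgt DN.
Qed.

End Estimates.

Theorem corollary8p4 (R : realType) (k : closedFieldType) (p q : nat)
    (H : hopfAlgType k) (r : nat) (X : 'I_r -> amod H) (r_gt0 : (0 < r)%N)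
    (p_prime : prime p) (dimH : \dim {:H} = p)
    (char_k : q \in [pchar k]) (q_gt2 : (2 < q)%N)
    (H_nss : ~ semisimple_alg H)
    (X_simples : all_simples X)
    (X_0 : mod_iso (X (Ordinal r_gt0)) (triv_mod H))
    (X_ddual : exists i : 'I_r,
       i <> Ordinal r_gt0 /\ mod_iso (ddual (X i)) (X i)) :
  (p%:R / (q%:R + 2) <= 2 `^ (- (2 / 3)) * p%:R `^ (1 / (r%:R - 1)) :> R ->
     commutative (@GRing.mul H) /\ cocommutative H) /\
  (p%:R / (q%:R + 2) <= phi p%:R :> R ->
     commutative (@GRing.mul H) /\ cocommutative H).
Proof.
have [//|nc] := EM (comm_cocomm H).
have pr : prime (\dim {:H}) by rewrite dimH.
set o := Ordinal r_gt0 in X_0 X_ddual.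
have [i [/eqP io ii]] := X_ddual.
have [e ie] := exists_idems X_simples.
have [sg sgP] := exists_sigma X_simples pr nc.
have si := (sg_fix X_simples sgP i).1 ii.
have d_gt1 := sdim_gt1 X_simples X_0 pr nc.
have op : odd (\dim {:H}).
  by apply: (odd_p (o := o) X_simples ie pr); exists i => //; apply: d_gt1.
have [j [jo sj oj]] : exists j, [/\ j != o, sg j = j & odd (pmul e j)].
  by apply: (exists_odd_pmul X_simples ie X_0 pr nc sgP) => //; exists i.
(* The multiplicity of [X j] lies between [q + 2] and [d ^ (r - 2)]. *)
have a_ge : (q + 2 <= pmul e j)%N.
  apply: (pmul_ge_q X_simples ie X_0 pr nc sgP char_k q_gt2 jo H_nss _ oj).
  exact/(sg_fix X_simples sgP).
have a_le := pmul_le_exp X_simples ie X_0 pr jo.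
set a := pmul e j in a_ge a_le; set d := sdim X j in a_le.
have d2 : (2 <= d)%N by apply: d_gt1.
have r2 : (0 < r - 1)%N.
  rewrite subn_gt0; apply: leq_ltn_trans (ltn_ord j); rewrite lt0n.
  by apply: contraNneq jo => j0; apply/eqP/val_inj.
have pE : (a * d + (r - 1) * pmul e o <= p)%N.
  rewrite -dimH -(sum_pmul_sdim X_simples ie) (bigD1 j) //= leq_add2l.
  have -> : (r - 1 = #|predC1 j|)%N by rewrite cardC1 card_ord subn1.
  rewrite -sum_nat_const; apply: leq_sum => l _; exact: pmul_sdim_ge X_simples ie X_0 l.
have ao : (a <= pmul e o * d)%N by apply: (pmul_le X_simples ie X_0).
have qR : 0 < q%:R + 2 :> R by rewrite -natrD ltr0n addn2.
have dR : 0 < d%:R :> R by rewrite ltr0n (leq_trans _ d2).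
have := @numeric_contra R (r - 1) p d (p%:R / (q%:R + 2)) d2 r2 (prime_gt1 p_prime).
rewrite natrB //; case.
- rewrite ler_pdivlMr // -(ler_pM2r dR) mulrAC mulrDl divfK ?gt_eqF //.
  rewrite -(natrB _ r_gt0) -!natrD -!natrM -!natrD -natrM ler_nat.
  apply: (@leq_trans ((d * d + (r - 1)) * a)); first by rewrite leq_mul2l a_ge orbT.
  apply: leq_trans (leq_mul pE (leqnn d)); rewrite !mulnDl leq_add //.
    by rewrite mulnC mulnA.
  by rewrite -mulnA leq_mul2l ao orbT.
- rewrite mulrAC ler_pdivlMr // -natrX ler_wpM2l ?ler0n // -natrD ler_nat.
  by rewrite (leq_trans a_ge) // -subn1 -subnDA.
by move=> h1 h2; split=> [/h1|/h2].
Qed.
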